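(* Let $\varphi: M^2 \to N^4(\epsilon)$ be a non-CMC W-surface with flat normal bundle. Assume that $3 f^2 + K - \epsilon \neq 0$, $\nabla^\perp E_3 \neq 0$, $A_4 \neq 0$ and $\nabla_{E_2} E_2 \neq 0$ at any point. Then $M$ is biharmonic if and only if, around any point, there exist local coordinates $(s, t)$, in which the metric is $ds^2+g_{22}(s)\,dt^2$ with $E_1=\partial/\partial s$ and $E_2=g_{22}^{-1/2}\,\partial/\partial t$, such that $f$, $k_1$, $k_2$, $\alpha$, $a_2$, $b_1$ and $K$ depend only on $s$ and the following ODE system is satisfied: \[ \left\{ \begin{array}{l} \dot a_2 = \epsilon + k_2 (2 f - k_2) - \alpha^2 + a_2^2 \\[3pt] (3f - k_2) \dot f = - f \alpha b_1 \\[3pt] \dot \alpha = 2 \alpha a_2 + k_2 b_1 \\[3pt] \dot k_2 = 2 a_2 (k_2 - f) - \alpha b_1 \\[3pt] \ddot f = a_2 \dot f + f \left( b_1^2 + k_1^2 + k_2^2 - 2 \epsilon \right) \\[3pt] \dot b_1 = - \dfrac{2 b_1}{f} \dot f + a_2 b_1 - \alpha (k_2 - k_1) \end{array} \right. \] where the dot denotes the derivative with respect to $s$.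
   Context: $N^4(\epsilon)$, $\epsilon\in\mathbb R$, is the 4-dimensional space form (complete, simply connected) of constant sectional curvature $\epsilon$. Manifolds are connected and immersions are isometric. For a surface $\varphi:M^2\to N^4(\epsilon)$: $B$ is the second fundamental form, $A_\eta$ the shape operator in the normal direction $\eta$, $\nabla$ the Levi-Civita connection, $\nabla^\perp$ the normal connection, $\Delta^\perp=-\operatorname{trace}(\nabla^\perp\nabla^\perp-\nabla^\perp_\nabla)$, $H=\frac12\operatorname{trace}B$, $f=|H|$, $K$ the Gaussian curvature. Flat normal bundle means the curvature of $\nabla^\perp$ vanishes. The surface is biharmonic (vanishing bitension field) if and only if $2\operatorname{trace}A_{\nabla^\perp_{(\cdot)}H}(\cdot)+\operatorname{grad}|H|^2=0$ and $\Delta^\perp H+\operatorname{trace}B(\cdot,A_H(\cdot))-2\epsilon H=0$. A W-surface is one for which there is a smooth $W:\mathbb R^2\to\mathbb R$ with nowhere zero gradient such that $W(f,K)=0$ on $M$. ''Non-CMC'' here means $H\neq0$, $\operatorname{grad}f\neq0$ and $A_{H/f}\neq f\,\mathrm{Id}$ at every point. Frame (all results are local; $M$ is taken to be a connected domain where the following is defined): $E_3=H/f$, $E_4$ is a unit normal section orthogonal to $E_3$, $A_3=A_{E_3}$, $A_4=A_{E_4}$, and $\{E_1,E_2\}$ is an orthonormal tangent frame with $A_3E_1=k_1E_1$, $A_3E_2=k_2E_2$. Flatness of the normal bundle gives $A_4E_1=\alpha E_1$, $A_4E_2=-\alpha E_2$ for a smooth function $\alpha$. The functions $a_i,b_i$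 are defined by $\nabla_{E_1}E_1=-a_1E_2$, $\nabla_{E_2}E_2=a_2E_1$ and $b_i=\langle\nabla^\perp_{E_i}E_3,E_4\rangle$, $i=1,2$. Labelling convention: whenever $b_1b_2=0$ on $M$ and $\nabla^\perp E_3\neq0$ at every point, $E_1,E_2$ are labelled (interchanging them if necessary) so that $b_1\neq0$ everywhere and $b_2=0$ on $M$. *)

(* Defs.v *)
From HB Require Import structures.
From mathcomp Require Import all_boot all_order all_algebra.
From mathcomp Require Import all_classical all_reals all_analysis.
Set Implicit Arguments.
Unset Strict Implicit.
Unset Printing Implicit Defensive.
Import Order.TTheory GRing.Theory Num.Theory.
Import numFieldNormedType.Exports.
Local Open Scope classical_set_scope.
Local Open Scope ring_scope.

(* C^oo maps on an open set [U] of a finite-dimensional normed space: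
   every iterated directional derivative is Frechet differentiable. *)

Fixpoint smooth_upto (R : realType) (V W : normedModType R) (n : nat)
    (U : set V) (u : V -> W) : Prop :=
  match n with
  | 0 => forall x, U x -> {for x, continuous u}
  | n'.+1 => (forall x, U x -> differentiable u x) /\
             (forall v : V, smooth_upto n' U (fun x => 'D_v u x))
  end.

Definition smooth_on (R : realType) (V W : normedModType R)
    (U : set V) (u : V -> W) : Prop := forall n, smooth_upto n U u.

(* Abstract smooth surfaces.  A chart is a homeomorphism of the open set
   [dom] onto an open set of the plane; [cmap] and [cinv] are total
   functions whose values off [dom] and [cmap @` dom] are irrelevant. *)

Record chart (R : realType) (M : topologicalType) := Chart {
  dom : set M;
  cmap : M -> (R * R)%type;
  cinv : (R * R)%type -> M;
  dom_open : open dom;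
  codom_open : open (cmap @` dom);
  cmapK : forall p, dom p -> cinv (cmap p) = p;
  cmap_cont : forall p, dom p -> {for p, continuous cmap};
  cinv_cont : forall p, dom p -> {for cmap p, continuous cinv}
}.

Definition smooth_transition (R : realType) (M : topologicalType)
    (c d : chart R M) : Prop :=
  smooth_on (cmap c @` (dom c `&` dom d)) (cmap d \o cinv c).

(* The smooth structure is given by an atlas in which each point p has a
   preferred chart [chart_at p].  This identifies T_pM with R^2: a tangent
   vector at p is represented by its coordinates in [chart_at p]. *)

Record surface (R : realType) := Surface {
  points :> topologicalType;
  chart_at : points -> chart R points;
  chart_at_dom : forall p, dom (chart_at p) p;
  chart_at_smooth : forall p q,
    smooth_transition (chart_at p) (chart_at q);
  surface_hausdorff : hausdorff_space points;
  surface_second_countable : @second_countable points;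
  surface_connected : connected [set: points]
}.

Section Surface.
Variables (R : realType) (M : surface R).

(* a chart belonging to the maximal atlas, i.e. local coordinates (s,t) *)
Definition local_coordinates (c : chart R M) : Prop :=
  forall p : M, smooth_transition (chart_at p) c /\
                smooth_transition c (chart_at p).

Definition msmooth_on (W : normedModType R) (A : set M) (u : M -> W) : Prop :=
  forall q : M, smooth_on (cmap (chart_at q) @` (A `&` dom (chart_at q)))
                          (u \o cinv (chart_at q)).

Definition msmooth (W : normedModType R) (u : M -> W) : Prop :=
  msmooth_on setT u.

(* v(u), the derivative at p of the W-valued map u along v in T_pM *)
Definition mder (W : normedModType R) (u : M -> W) (p : M)
    (v : (R * R)%type) : W :=
  'D_v (u \o cinv (chart_at p)) (cmap (chart_at p) p).

Definition vfield := M -> (R * R)%type.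

(* the components of X in the chart c *)
Definition components (c : chart R M) (X : vfield) : vfield :=
  fun q => mder (cmap c) q (X q).

Definition smooth_vfield (X : vfield) : Prop :=
  forall q : M, msmooth_on (dom (chart_at q)) (components (chart_at q) X).

(* Lie bracket, by the coordinate formula in the chart [chart_at p] *)
Definition bracket (X Y : vfield) : vfield := fun p =>
  mder (components (chart_at p) Y) p (X p)
  - mder (components (chart_at p) X) p (Y p).

(* the coordinate vector fields d/ds and d/dt of a chart c *)
Definition coord_s (c : chart R M) : vfield := fun p =>
  'D_((1, 0) : (R * R)%type) (cmap (chart_at p) \o cinv c) (cmap c p).
Definition coord_t (c : chart R M) : vfield := fun p =>
  'D_((0, 1) : (R * R)%type) (cmap (chart_at p) \o cinv c) (cmap c p).

Definition metric_tensor := M -> (R * R)%type -> (R * R)%type -> R.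

(* [nab Y p v] stands for (nabla_v Y)(p), with v in T_pM *)
Definition connection := vfield -> M -> (R * R)%type -> (R * R)%type.

Record levi_civita (g : metric_tensor) (nab : connection) : Prop := LeviCivita {
  lc_smooth : forall X Y, smooth_vfield X -> smooth_vfield Y ->
    smooth_vfield (fun p => nab Y p (X p));
  lc_linear : forall Y, smooth_vfield Y -> forall p (a : R) v w,
    nab Y p (a *: v + w) = a *: nab Y p v + nab Y p w;
  lc_add : forall Y Z, smooth_vfield Y -> smooth_vfield Z -> forall p v,
    nab (fun q => Y q + Z q) p v = nab Y p v + nab Z p v;
  lc_leibniz : forall (u : M -> R) Y, msmooth u -> smooth_vfield Y ->
    forall p v,
    nab (fun q => u q *: Y q) p v = mder u p v *: Y p + u p *: nab Y p v;
  lc_metric : forall Y Z, smooth_vfield Y -> smooth_vfield Z -> forall p v,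
    mder (fun q => g q (Y q) (Z q)) p v
    = g p (nab Y p v) (Z p) + g p (Y p) (nab Z p v);
  lc_torsion_free : forall X Y, smooth_vfield X -> smooth_vfield Y ->
    forall p, nab Y p (X p) - nab X p (Y p) = bracket X Y p
}.

End Surface.

(* The space form N^4(eps), as the standard model in R^5: the hyperplane
   x_4 = 0 if eps = 0, the sphere of radius eps^(-1/2) if eps > 0, and the
   upper sheet of the hyperboloid <x,x> = 1/eps in Minkowski space if
   eps < 0 (coordinates are numbered 0..4). *)

Section SpaceForm.
Variables (R : realType) (eps : R).

(* Euclidean product of R^5 for eps >= 0, Lorentzian one for eps < 0 *)
Definition ip (x y : 'rV[R]_5) : R :=
  \sum_(i < 5) (if (eps < 0) && (i == ord_max) then -1 else 1)
               * x 0 i * y 0 i.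

Definition space_form : set 'rV[R]_5 := [set x : 'rV[R]_5 |
  if eps == 0 then x 0 ord_max = 0
  else ip x x = eps^-1 /\ (eps < 0 -> 0 < x 0 ord_max)].

Definition space_form_tangent (x : 'rV[R]_5) : set 'rV[R]_5 := [set v : 'rV[R]_5 |
  if eps == 0 then v 0 ord_max = 0 else ip x v = 0].

(* curvature tensor R^N(x,y)z of constant sectional curvature eps, with the
   sign convention R(X,Y) = [nabla_X, nabla_Y] - nabla_[X,Y] *)
Definition curvN (x y z : 'rV[R]_5) : 'rV[R]_5 :=
  eps *: (ip y z *: x - ip x z *: y).

End SpaceForm.

Section Immersion.
Variables (R : realType) (eps : R) (M : surface R) (phi : M -> 'rV[R]_5).

Definition dphi (p : M) (v : (R * R)%type) : 'rV[R]_5 := mder phi p v.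

Definition immersion : Prop :=
  [/\ msmooth phi, forall p, space_form eps (phi p)
    & forall p v, dphi p v = 0 -> v = 0].

(* the metric of M: immersions are isometric *)
Definition metric : metric_tensor M :=
  fun p v w => ip eps (dphi p v) (dphi p w).

(* The pull-back to M of the Levi-Civita connection of N, for a section V of
   phi^*TN: the projection of the flat derivative onto TN, along phi. *)
Definition pb_conn (V : M -> 'rV[R]_5) (p : M) (v : (R * R)%type) :
    'rV[R]_5 :=
  mder V p v + (eps * ip eps (dphi p v) (V p)) *: phi p.

Definition normal_section (xi : M -> 'rV[R]_5) : Prop :=
  forall p, space_form_tangent eps (phi p) (xi p) /\
            forall v, ip eps (dphi p v) (xi p) = 0.

Variable nab : connection M.

(* B(v, Y), the second fundamental form *)
Definition sff (Y : vfield M) (p : M) (v : (R * R)%type) : 'rV[R]_5 :=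
  pb_conn (fun q => dphi q (Y q)) p v - dphi p (nab Y p v).

(* From here on, (E1, E2) is an orthonormal frame, used to express traces and
   orthogonal projections; the results do not depend on its choice. *)
Variables E1 E2 : vfield M.

Definition orthonormal_frame : Prop :=
  [/\ smooth_vfield E1, smooth_vfield E2
    & forall p, [/\ metric p (E1 p) (E1 p) = 1, metric p (E2 p) (E2 p) = 1
                  & metric p (E1 p) (E2 p) = 0]].

Definition normal_proj (p : M) (w : 'rV[R]_5) : 'rV[R]_5 :=
  w - ip eps w (dphi p (E1 p)) *: dphi p (E1 p)
    - ip eps w (dphi p (E2 p)) *: dphi p (E2 p).

Definition nconn (xi : M -> 'rV[R]_5) (p : M) (v : (R * R)%type) : 'rV[R]_5 :=
  normal_proj p (pb_conn xi p v).

(* A_eta v, determined by <A_eta v, w> = <B(v, w), eta> *)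
Definition shape_operator (eta : M -> 'rV[R]_5) (p : M) (v : (R * R)%type) :
    (R * R)%type :=
  ip eps (sff E1 p v) (eta p) *: E1 p + ip eps (sff E2 p v) (eta p) *: E2 p.

Definition grad (u : M -> R) : vfield M := fun p =>
  mder u p (E1 p) *: E1 p + mder u p (E2 p) *: E2 p.

(* Gaussian curvature <R(E1,E2)E2, E1> *)
Definition gauss_curvature (p : M) : R :=
  metric p
    (nab (fun q => nab E2 q (E2 q)) p (E1 p)
     - nab (fun q => nab E2 q (E1 q)) p (E2 p)
     - nab E2 p (bracket E1 E2 p))
    (E1 p).

Definition flat_normal_bundle : Prop :=
  forall (X Y : vfield M) (xi : M -> 'rV[R]_5),
    smooth_vfield X -> smooth_vfield Y -> msmooth xi -> normal_section xi ->
    forall p,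
      nconn (fun q => nconn xi q (Y q)) p (X p)
      - nconn (fun q => nconn xi q (X q)) p (Y p)
      - nconn xi p (bracket X Y p) = 0.

Definition mean_curv (p : M) : 'rV[R]_5 :=
  2^-1 *: (sff E1 p (E1 p) + sff E2 p (E2 p)).

Definition mean_norm (p : M) : R :=
  Num.sqrt (ip eps (mean_curv p) (mean_curv p)).

Definition E3 (p : M) : 'rV[R]_5 := (mean_norm p)^-1 *: mean_curv p.

(* tau = trace (nabla d phi) *)
Definition tension (p : M) : 'rV[R]_5 :=
  sff E1 p (E1 p) + sff E2 p (E2 p).

(* tau_2 = - Delta tau - trace R^N(d phi, tau) d phi, where Delta is the rough
   Laplacian - trace (nabla^phi nabla^phi - nabla^phi_nabla) *)
Definition bitension (p : M) : 'rV[R]_5 :=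
  let term (X : vfield M) :=
    pb_conn (fun q => pb_conn tension q (X q)) p (X p)
    - pb_conn tension p (nab X p (X p))
    - curvN eps (dphi p (X p)) (tension p) (dphi p (X p)) in
  term E1 + term E2.

Definition biharmonic : Prop := forall p, bitension p = 0.

Definition W_surface : Prop :=
  exists W : (R * R)%type -> R,
    [/\ smooth_on setT W,
        forall z, exists v, 'D_v W z != 0
      & forall p, W (mean_norm p, gauss_curvature p) = 0].

Definition non_CMC : Prop :=
  forall p, [/\ mean_curv p != 0, grad mean_norm p != 0
              & ~ forall v, shape_operator E3 p v = mean_norm p *: v].

Variable E4 : M -> 'rV[R]_5.

Definition k1 (p : M) : R := metric p (shape_operator E3 p (E1 p)) (E1 p).
Definition k2 (p : M) : R := metric p (shape_operator E3 p (E2 p)) (E2 p).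
Definition alpha (p : M) : R := metric p (shape_operator E4 p (E1 p)) (E1 p).

(* nabla_{E1} E1 = - a1 E2 and nabla_{E2} E2 = a2 E1 *)
Definition a1 (p : M) : R := - metric p (nab E1 p (E1 p)) (E2 p).
Definition a2 (p : M) : R := metric p (nab E2 p (E2 p)) (E1 p).
Definition b1 (p : M) : R := ip eps (nconn E3 p (E1 p)) (E4 p).
Definition b2 (p : M) : R := ip eps (nconn E3 p (E2 p)) (E4 p).

Record adapted_frame : Prop := AdaptedFrame {
  af_tangent : orthonormal_frame;
  af_principal1 : forall p, shape_operator E3 p (E1 p) = k1 p *: E1 p;
  af_principal2 : forall p, shape_operator E3 p (E2 p) = k2 p *: E2 p;
  af_E4_smooth : msmooth E4;
  af_E4_normal : normal_section E4;
  af_E4_unit : forall p, ip eps (E4 p) (E4 p) = 1;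
  af_E4_orth : forall p, ip eps (E3 p) (E4 p) = 0
}.

(* choice of the order of E1, E2 *)
Definition labelling_convention : Prop :=
  (forall p, b1 p * b2 p = 0) ->
  (forall p, exists v, nconn E3 p v != 0) ->
  forall p, b1 p != 0 /\ b2 p = 0.

(* On dom c, with coordinates (s,t), the metric is ds^2 + g22(s) dt^2,
   E1 = d/ds and E2 = g22^(-1/2) d/dt. *)
Definition adapted_coordinates (c : chart R M) (g22 : R -> R) : Prop :=
  forall q, dom c q ->
    [/\ metric q (coord_s c q) (coord_s c q) = 1,
        metric q (coord_s c q) (coord_t c q) = 0,
        metric q (coord_t c q) (coord_t c q) = g22 (cmap c q).1,
        E1 q = coord_s c q
      & E2 q = (Num.sqrt (g22 (cmap c q).1))^-1 *: coord_t c q].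

(* u = F(s) on dom c *)
Definition depends_only_on_s (c : chart R M) (u : M -> R) (F : R -> R) : Prop :=
  forall q, dom c q -> u q = F (cmap c q).1.

End Immersion.

(* Main.v *)
Require Import Defs.
From HB Require Import structures.
From mathcomp Require Import all_boot all_order all_algebra.
From mathcomp Require Import all_classical all_reals all_analysis.
From mathcomp Require Import ring lra.
Import Order.TTheory GRing.Theory Num.Theory.
Import numFieldNormedType.Exports.
Local Open Scope classical_set_scope.
Local Open Scope ring_scope.
Set Implicit Arguments.
Unset Strict Implicit.
Unset Printing Implicit Defensive.

(** Let [X] and [Y] be the derivatives of [f] along [E1] and [E2].  Everything
    is expressed through these two derivations, whose commutator is the
    derivation along [a1 E1 + a2 E2].

    Differentiating the moving frame of the tangent vectors [E1], [E2] and the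
    normals [E3], [E4] turns flatness of the normal bundle into the equations of
    Gauss, Codazzi and Ricci for [k1], [k2], [alpha], [a1], [a2], [b1], [b2]
    (lemmas [codazzi], [ricci], [gauss_curvatureE]), and the bitension field
    into four scalar equations ([bitension_eq0]).

    Suppose that the surface is biharmonic.  Codazzi and the tangential part of
    the biharmonic equation give [E1 K = 6 f X - a2 d] and
    [E2 K = 6 f Y + a1 d], where [d = 4 (f^2 - K + eps)] is positive.  Since
    [W(f, K) = 0], the gradients of [f] and [K] are proportional, whence
    [a1 X + a2 Y = 0].  In other words the commutator annihilates [f], so that
    [E1 Y = E2 X]; moreover [X] cannot vanish, because [a2] does not.  The
    commutator on [K] then gives [E1 a1 + E2 a2 = 0], and on [f (k1 - f)] it
    gives [f E1 Y = 3 f a2 Y - X Y].  The tangential equations express [b1] and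
    [b2] through [X] and [Y]; with these values the Ricci equation becomes
    [f^2 b1 b2 = - X Y], that is [X Y (3 f^2 + K - eps) = 0].  Hence [Y = 0], and
    then [a1 = 0] and [b2 = 0] ([Y_eq0], [a1_eq0], [b2_eq0]).  Now the bracket of
    [E1] and [E2] is [a2 E2], all invariants are constant along [E2], and what
    remains of the structure equations and of the biharmonic equation is exactly
    the system of ordinary differential equations ([frame_biharmonic_ode]).

    The coordinates come from the Poincare lemma: with such a bracket, a system
    [E1 u = A], [E2 u = B] has local solutions as soon as [E1 B - E2 A = a2 B].
    This provides [s] with derivatives [(1, 0)], [log h] with [(a2, 0)] and [t]
    with [(0, h)].  By the inverse function theorem [(s, t)] is a chart; in it
    [E1 = d/ds] and [E2 = h(s) d/dt], and functions annihilated by [E2] depend on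
    [s] alone ([straightening_chart]).

    Conversely, in coordinates as in the theorem, [f], [X] and [k1] are constant
    along [E2].  The commutator on [f] reads [a1 X = 0], and [X] is nowhere zero,
    so [a1 = 0]; the Codazzi equation for [E2 k1] leaves [alpha b2 = 0], so
    [b2 = 0] ([symmetric_of_charts]); and [frame_biharmonic_ode] applies again.

    The Schwarz lemma, the Poincare lemma and the inverse function theorem are
    proved in the plane, for maps all of whose iterated directional derivatives
    are differentiable ([derive_comm], [closed_form_primitive],
    [inverse_function]). *)


(** * Differentiable maps *)

Section Differentiation.
Variables (R : realType) (V W : normedModType R).
Implicit Types (f g : V -> W) (x v : V).

(** The form in which differentiability is met below: mean value arguments bound
    the remainder by a multiple of the increment. *)
Lemma differentiable_estimate (f : V -> W) x (L : {linear V -> W}) :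
  continuous L ->
  (forall e : R, 0 < e ->
     \forall h \near 0, `|f (h + x) - f x - L h| <= e * `|h|) ->
  differentiable f x /\ 'd f x = L :> (V -> W).
Proof.
move=> Lc Lo.
have E : f \o shift x = cst (f x) + L +o_ 0 id.
  apply/eqaddoP => e e0; near=> h.
  rewrite [X in `|X|](_ : _ = f (h + x) - f x - L h); last first.
    by rewrite !fctE /= opprD addrA.
  by near: h; exact: Lo.
have dL := diff_unique Lc E.
by split=> //; apply/diff_locallyP; rewrite dL.
Unshelve. all: end_near. Qed.

Lemma estimate_differentiable f x : differentiable f x ->
  forall e : R, 0 < e ->
     \forall h \near 0, `|f (h + x) - f x - 'd f x h| <= e * `|h|.
Proof.
move=> /diff_locallyP [_ /eqaddoP E] e e0.
have := E _ e0; apply: filter_app; near=> h => /=.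
by rewrite !fctE /= opprD addrA.
Unshelve. all: end_near. Qed.

Lemma near_eq_differentiable f g x :
  {near x, f =1 g} -> differentiable f x -> differentiable g x.
Proof.
move=> fg df; have /diff_locallyP[dc _] := df.
suff : differentiable g x /\ 'd g x = 'd f x :> (V -> W) by case.
apply: differentiable_estimate => // e e0.
have fgx : f x = g x by exact: (nbhs_singleton fg).
have fg0 : \forall h \near 0, f (h + x) = g (h + x).
  by move: fg; rewrite (near_shift 0 x) /= subr0.
near=> h.
rewrite -fgx -(near fg0 h) //.
by near: h; exact: estimate_differentiable.
Unshelve. all: end_near. Qed.

End Differentiation.

Section Plane.
Variable R : realType.
Local Notation R2 := (R * R)%type.
Variable W : normedModType R.

Definition ex : R2 := (1, 0).
Definition ey : R2 := (0, 1).
Definition det2 (v w : R2) : R := v.1 * w.2 - v.2 * w.1.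

Lemma det2_span (a b v : R2) : det2 a b != 0 -> exists x y : R, v = x *: a + y *: b.
Proof.
rewrite /det2 => d0; exists ((v.1 * b.2 - v.2 * b.1) / (a.1 * b.2 - a.2 * b.1)).
exists ((a.1 * v.2 - a.2 * v.1) / (a.1 * b.2 - a.2 * b.1)).
move: d0; case: a => a b'; case: b => c d; case: v => x y /= d0.
by apply: injective_projections; rewrite /= /GRing.scale /=; field.
Qed.

Lemma derive_plane (u : R2 -> W) z (v : R2) : differentiable u z ->
  'D_v u z = v.1 *: 'D_ex u z + v.2 *: 'D_ey u z.
Proof.
move=> du; rewrite !deriveE // -!linearZ -linearD /=; congr ('d u z _).
by case: v => a b; apply: injective_projections; rewrite /= /GRing.scale /= ?mulr1 ?mulr0 ?addr0 ?add0r.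
Qed.

Lemma derive_linear (V : normedModType R) (u : V -> W) z a (v w : V) : differentiable u z ->
  'D_(a *: v + w) u z = a *: 'D_v u z + 'D_w u z.
Proof. by move=> du; rewrite !deriveE // linearP. Qed.

Lemma derive_homogeneous (V : normedModType R) (u : V -> W) z a (v : V) : differentiable u z ->
  'D_(a *: v) u z = a *: 'D_v u z.
Proof. by move=> du; rewrite -[a *: v]addr0 derive_linear // derive0 addr0. Qed.

Lemma derive_comp (U V W' : normedModType R) (f : U -> V) (g : V -> W') x v :
  differentiable f x -> differentiable g (f x) ->
  'D_v (g \o f) x = 'D_('D_v f x) g (f x).
Proof.
move=> df dg; rewrite !deriveE //; last exact: differentiable_comp.
by rewrite diff_comp.
Qed.

Lemma derive_linear_comp (V : normedModType R) (W' : normedModType R) (f : V -> W)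
   (L : {linear W -> W'}) x v : continuous L -> differentiable f x ->
  'D_v (L \o f) x = L ('D_v f x).
Proof.
move=> Lc df.
have dL : differentiable L (f x) by exact: linear_differentiable.
by rewrite (derive_comp v df dL) (deriveE _ dL) diff_lin.
Qed.

Lemma scalev_continuous : continuous (fun p : R * W => p.1 *: p.2).
Proof. exact: scale_continuous. Qed.

(** Scaling of [W] under a name that can carry a bilinear structure. *)
Definition scalev (a : R) (w : W) := a *: w.

Lemma scale_is_bilinear :
  bilinear_for
    (GRing.Scale.Law.clone _ _ *:%R _) (GRing.Scale.Law.clone _ _ *:%R _)
    scalev.
Proof.
split=> [u'|u] a x y /=; rewrite /scalev.
- by rewrite scalerDl scalerA.
- by rewrite scalerDr !scalerA mulrC.
Qed.
HB.instance Definition _ :=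
  bilinear_isBilinear.Build R R W W _ _ scalev scale_is_bilinear.

Lemma differentiable_scale (V : normedModType R) (a : V -> R) (w : V -> W) x :
  differentiable a x -> differentiable w x ->
  differentiable (fun y => a y *: w y) x /\
  (forall v, 'D_v (fun y => a y *: w y) x = 'D_v a x *: w x + a x *: 'D_v w x).
Proof.
move=> da dw.
have dp := differentiable_pair da dw.
pose m := scalev : {bilinear R -> W -> W}.
have dm : differentiable (fun p : R * W => m p.1 p.2) (a x, w x).
  exact/differentiable_bilin/scalev_continuous.
have E : (fun y => a y *: w y) = (fun p : R * W => m p.1 p.2) \o (fun y => (a y, w y)) by [].
rewrite E; split; first exact: differentiable_comp.
move=> v; rewrite (derive_comp v dp dm) (deriveE _ dm) diff_bilin /=; last exact: scalev_continuous.
by rewrite addrC (deriveE v dp) (deriveE v da) (deriveE v dw) diff_pair.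
Qed.

End Plane.

(** * Calculus of smooth maps *)

Lemma open_near (T : topologicalType) (U : set T) (P : T -> Prop) x :
  open U -> U x -> (forall y, U y -> P y) -> \forall y \near x, P y.
Proof. by move=> oU Ux UP; apply: filterS UP _; exact: open_nbhs_nbhs. Qed.

Section SmoothCalculus.
Variables (R : realType) (V : normedModType R).
Implicit Types U : set V.

Lemma smooth_uptoW (W : normedModType R) n U (u : V -> W) :
  smooth_upto n.+1 U u -> smooth_upto n U u.
Proof.
elim: n u => [|n IH] u /= [du Du].
  by move=> x Ux; apply: differentiable_continuous; exact: du.
split=> // v; apply: IH; exact: Du.
Qed.

Lemma smooth_upto_eq (W : normedModType R) n U (u w : V -> W) : open U ->
  (forall x, U x -> u x = w x) -> smooth_upto n U u -> smooth_upto n U w.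
Proof.
move=> oU; elim: n u w => [|n IH] u w uw /=.
  move=> cu x Ux; suff: w @ x --> w x by [].
  have H : u @ x --> u x := cu x Ux.
  rewrite -(uw x Ux); apply: cvg_trans H.
  by apply: near_eq_cvg; apply: (open_near oU Ux) => y Uy; rewrite uw.
move=> [du Du]; split=> [x Ux|v].
  by apply: near_eq_differentiable (du x Ux); apply: (open_near oU Ux).
apply: IH (Du v) => x Ux.
by apply: near_eq_derive; apply: (open_near oU Ux).
Qed.

Lemma smooth_upto_sub (W : normedModType R) n U U' (u : V -> W) :
  U' `<=` U -> smooth_upto n U u -> smooth_upto n U' u.
Proof.
move=> UU; elim: n u => [|n IH] u /=; first by move=> cu x /UU /cu.
by move=> [du Du]; split=> [x /UU /du//|v]; exact: IH.
Qed.

Lemma smooth_upto_cst (W : normedModType R) n U (c : W) :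
  smooth_upto n U (fun=> c).
Proof.
elim: n c => [|n IH] c /=; first by move=> x _; exact: cvg_cst.
split=> [x _|v]; first exact: differentiable_cst.
have -> // : (fun x => 'D_v (fun=> c) x) = fun=> 0 :> W.
by apply/funext => x; exact: derive_cst.
Qed.

Lemma smooth_upto_linear_comp (W W' : normedModType R) n U (u : V -> W)
   (L : {linear W -> W'}) :
  open U -> continuous L -> smooth_upto n U u -> smooth_upto n U (L \o u).
Proof.
move=> oU Lc; elim: n u => [|n IH] u /=.
  by move=> cu x Ux; apply: continuous_comp; [exact: cu | exact: Lc].
move=> [du Du]; split=> [x Ux|v].
  by apply: differentiable_comp; [exact: du | exact: linear_differentiable].
apply: smooth_upto_eq (IH _ (Du v)) => // x Ux.
by rewrite (derive_linear_comp _ Lc (du x Ux)).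
Qed.

Lemma smooth_uptoD (W : normedModType R) n U (u w : V -> W) : open U ->
  smooth_upto n U u -> smooth_upto n U w -> smooth_upto n U (fun x => u x + w x).
Proof.
move=> oU; elim: n u w => [|n IH] u w /=.
  by move=> cu cw x Ux; apply: cvgD; [exact: cu | exact: cw].
move=> [du Du] [dw Dw]; split=> [x Ux|v].
  by apply: differentiableD; [exact: du | exact: dw].
apply: smooth_upto_eq (IH _ _ (Du v) (Dw v)) => // x Ux.
by rewrite -deriveD //; apply: diff_derivable; [exact: du | exact: dw].
Qed.

Lemma smooth_uptoZ (W : normedModType R) n U (a : V -> R) (w : V -> W) : open U ->
  smooth_upto n U a -> smooth_upto n U w -> smooth_upto n U (fun x => a x *: w x).
Proof.
move=> oU; elim: n a w => [|n IH] a w.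
  by move=> /= ca cw x Ux; apply: cvgZ; [exact: ca | exact: cw].
move=> sa sw; have [da Da] := sa; have [dw Dw] := sw.
split=> [x Ux|v]; first by have [] := differentiable_scale (da x Ux) (dw x Ux).
have S := smooth_uptoD oU (IH _ _ (Da v) (smooth_uptoW sw))
                          (IH _ _ (smooth_uptoW sa) (Dw v)).
apply: smooth_upto_eq S => // x Ux.
by have [_ ->] := differentiable_scale (da x Ux) (dw x Ux).
Qed.

Lemma smooth_uptoV n U (a : V -> R) : open U -> (forall x, U x -> a x != 0) ->
  smooth_upto n U a -> smooth_upto n U (fun x => (a x)^-1).
Proof.
move=> oU a0; elim: n => [|n IH].
  by move=> /= ca x Ux; apply: cvgV; [exact: a0 | exact: ca].
move=> sa; have [da Da] := sa; split=> [x Ux|v].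
  by apply: differentiableV; [exact: da | exact: a0].
have I := IH (smooth_uptoW sa).
have S := smooth_uptoZ oU (smooth_uptoZ oU (smooth_upto_cst n U (-1 : R)) I)
  (smooth_uptoZ oU I (Da v)).
apply: smooth_upto_eq S => // x Ux.
rewrite deriveV ?a0 //; last by apply: diff_derivable; exact: da.
rewrite /GRing.scale /= expr2 invfM; ring.
Qed.

(** A scalar function whose derivative is smooth along [a] whenever it is smooth
    itself, such as [Num.sqrt] or [expR]. *)
Lemma smooth_upto_scalar n U (a : V -> R) (F F' : R -> R) : open U ->
  (forall x, U x -> is_derive (a x) 1 F (F' (a x))) ->
  (forall m, smooth_upto m U a -> smooth_upto m U (F \o a) ->
     smooth_upto m U (F' \o a)) ->
  smooth_upto n U a -> smooth_upto n U (F \o a).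
Proof.
move=> oU dF SF'.
have dFx x : U x -> differentiable F (a x).
  by move=> Ux; apply/derivable1_diffP; have [] := dF x Ux.
elim: n => [|n IH].
  move=> /= ca x Ux; apply: continuous_comp; first exact: ca.
  exact: differentiable_continuous (dFx x Ux).
move=> sa; have [da Da] := sa; split=> [x Ux|v].
  by apply: differentiable_comp; [exact: da | exact: dFx].
have I := IH (smooth_uptoW sa).
have S := smooth_uptoZ oU (Da v) (SF' _ (smooth_uptoW sa) I).
apply: smooth_upto_eq S => // x Ux.
rewrite (derive_comp v (da x Ux) (dFx x Ux)) [RHS]deriveE; last exact: dFx.
rewrite diff1E //; last exact: dFx.
by rewrite derive1E (@derive_val _ _ _ _ _ _ _ (dF x Ux)).
Qed.

End SmoothCalculus.

Section SmoothComp.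
Variables (R : realType) (V : normedModType R).
Local Notation R2 := (R * R)%type.

Lemma smooth_upto_sqrt n (U : set V) (a : V -> R) : open U ->
  (forall x, U x -> 0 < a x) ->
  smooth_upto n U a -> smooth_upto n U (fun x => Num.sqrt (a x)).
Proof.
move=> oU a0; apply: (@smooth_upto_scalar _ _ _ _ _ Num.sqrt (fun r => (2 * Num.sqrt r)^-1)) => //.
  by move=> x Ux; apply: is_derive1_sqrt; exact: a0.
move=> m sa ssa; apply: (smooth_uptoV oU) => [x Ux|].
  by rewrite mulf_neq0 ?pnatr_eq0 // gt_eqF // sqrtr_gt0 a0.
exact: (smooth_uptoZ oU (smooth_upto_cst _ _ (2 : R)) ssa).
Qed.

Lemma smooth_upto_exp n (U : set V) (a : V -> R) : open U ->
  smooth_upto n U a -> smooth_upto n U (fun x => expR (a x)).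
Proof.
by move=> oU; apply: (@smooth_upto_scalar _ _ _ _ _ expR expR).
Qed.

Lemma fst_continuous (W1 W2 : normedModType R) :
  continuous (fst : W1 * W2 -> W1).
Proof. by move=> x; apply: cvg_fst. Qed.

Lemma snd_continuous (W1 W2 : normedModType R) :
  continuous (snd : W1 * W2 -> W2).
Proof. by move=> x; apply: cvg_snd. Qed.

Lemma derive_fst (f : V -> R2) x v : differentiable f x ->
  'D_v (fun y => (f y).1) x = ('D_v f x).1.
Proof. exact: (derive_linear_comp v (L := fst : {linear R2 -> R}) (@fst_continuous R R)). Qed.

Lemma derive_snd (f : V -> R2) x v : differentiable f x ->
  'D_v (fun y => (f y).2) x = ('D_v f x).2.
Proof. exact: (derive_linear_comp v (L := snd : {linear R2 -> R}) (@snd_continuous R R)). Qed.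

Lemma smooth_upto_fst n (U : set V) (f : V -> R2) : open U ->
  smooth_upto n U f -> smooth_upto n U (fun x => (f x).1).
Proof.
move=> oU; apply: (smooth_upto_linear_comp (L := fst : {linear R2 -> R}) oU).
exact: fst_continuous.
Qed.

Lemma smooth_upto_snd n (U : set V) (f : V -> R2) : open U ->
  smooth_upto n U f -> smooth_upto n U (fun x => (f x).2).
Proof.
move=> oU; apply: (smooth_upto_linear_comp (L := snd : {linear R2 -> R}) oU).
exact: snd_continuous.
Qed.

(** By the chain rule a derivative of [g \o f] is a combination of the two partial
    derivatives of [g] composed with [f], so the order goes down by induction. *)
Lemma smooth_upto_comp (W : normedModType R) n (U : set V) (U' : set R2) (f : V -> R2) (g : R2 -> W) :
  open U -> (forall x, U x -> U' (f x)) ->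
  smooth_upto n U f -> smooth_upto n U' g -> smooth_upto n U (g \o f).
Proof.
move=> oU fU; elim: n f g fU => [|n IH] f g fU.
  by move=> /= cf cg x Ux; apply: continuous_comp; [exact: cf | apply: cg; exact: fU].
move=> sf [dg Dg]; have [df Df] := sf; split=> [x Ux|v].
  by apply: differentiable_comp; [exact: df | apply: dg; exact: fU].
have sf' := smooth_uptoW sf.
have S := smooth_uptoD oU
  (smooth_uptoZ oU (smooth_upto_fst oU (Df v)) (IH _ _ fU sf' (Dg (ex R))))
  (smooth_uptoZ oU (smooth_upto_snd oU (Df v)) (IH _ _ fU sf' (Dg (ey R)))).
apply: smooth_upto_eq S => // x Ux.
rewrite (derive_comp v (df x Ux) (dg _ (fU _ Ux))).
by rewrite [RHS]derive_plane //; apply: dg; exact: fU.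
Qed.

Lemma smooth_upto_pair n (U : set V) (f g : V -> R) : open U ->
  smooth_upto n U f -> smooth_upto n U g -> smooth_upto n U (fun x => (f x, g x)).
Proof.
move=> oU sf sg.
have S := smooth_uptoD oU (smooth_uptoZ oU sf (smooth_upto_cst n U (ex R)))
  (smooth_uptoZ oU sg (smooth_upto_cst n U (ey R))).
apply: smooth_upto_eq S => // x _.
by apply: injective_projections;
  rewrite /= /GRing.scale /= ?mulr1 ?mulr0 ?addr0 ?add0r.
Qed.

End SmoothComp.

Section SmoothOn.
Variables (R : realType) (V : normedModType R) (U : set V).
Hypothesis oU : open U.
Local Notation R2 := (R * R)%type.

Lemma smooth_on_eq (W : normedModType R) (u w : V -> W) :
  (forall x, U x -> u x = w x) -> smooth_on U u -> smooth_on U w.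
Proof. by move=> uw su n; apply: smooth_upto_eq (su n). Qed.

Lemma smooth_on_sub (W : normedModType R) (U' : set V) (u : V -> W) :
  U' `<=` U -> smooth_on U u -> smooth_on U' u.
Proof. by move=> UU su n; apply: smooth_upto_sub UU _; exact: su. Qed.

Lemma smooth_onS (W : normedModType R) (u : V -> W) :
  smooth_on U u -> forall x, U x -> differentiable u x.
Proof. by move=> su; have [du _] := su 1%N; exact: du. Qed.

Lemma smooth_on_derive (W : normedModType R) (u : V -> W) v :
  smooth_on U u -> smooth_on U (fun x => 'D_v u x).
Proof. by move=> su n; have [_] := su n.+1; exact. Qed.

Lemma smooth_on_continuous (W : normedModType R) (u : V -> W) :
  smooth_on U u -> forall x, U x -> {for x, continuous u}.
Proof. by move=> su; exact: (su 0%N). Qed.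

Lemma smooth_on_cst (W : normedModType R) (c : W) : smooth_on U (fun=> c).
Proof. by move=> n; exact: smooth_upto_cst. Qed.

Lemma smooth_onD (W : normedModType R) (u w : V -> W) :
  smooth_on U u -> smooth_on U w -> smooth_on U (fun x => u x + w x).
Proof. by move=> su sw n; apply: smooth_uptoD. Qed.

Lemma smooth_onZ (W : normedModType R) (a : V -> R) (w : V -> W) :
  smooth_on U a -> smooth_on U w -> smooth_on U (fun x => a x *: w x).
Proof. by move=> su sw n; apply: smooth_uptoZ. Qed.

Lemma smooth_onN (W : normedModType R) (u : V -> W) :
  smooth_on U u -> smooth_on U (fun x => - u x).
Proof.
move=> su; apply: smooth_on_eq (smooth_onZ (smooth_on_cst (-1 : R)) su) => x _.
by rewrite scaleN1r.
Qed.

Lemma smooth_onB (W : normedModType R) (u w : V -> W) :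
  smooth_on U u -> smooth_on U w -> smooth_on U (fun x => u x - w x).
Proof. by move=> su sw; apply: smooth_onD => //; exact: smooth_onN. Qed.

Lemma smooth_onM (a b : V -> R) :
  smooth_on U a -> smooth_on U b -> smooth_on U (fun x => a x * b x).
Proof. exact: smooth_onZ. Qed.

Lemma smooth_onV (a : V -> R) : (forall x, U x -> a x != 0) ->
  smooth_on U a -> smooth_on U (fun x => (a x)^-1).
Proof. by move=> a0 sa n; apply: smooth_uptoV. Qed.

Lemma smooth_on_sqrt (a : V -> R) : (forall x, U x -> 0 < a x) ->
  smooth_on U a -> smooth_on U (fun x => Num.sqrt (a x)).
Proof. by move=> a0 sa n; apply: smooth_upto_sqrt. Qed.

Lemma smooth_on_exp (a : V -> R) :
  smooth_on U a -> smooth_on U (fun x => expR (a x)).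
Proof. by move=> sa n; apply: smooth_upto_exp. Qed.

Lemma smooth_on_linear_comp (W W' : normedModType R) (L : {linear W -> W'}) (u : V -> W) :
  continuous L -> smooth_on U u -> smooth_on U (L \o u).
Proof. by move=> Lc su n; apply: smooth_upto_linear_comp. Qed.

Lemma smooth_on_fst (u : V -> R2) : smooth_on U u -> smooth_on U (fun x => (u x).1).
Proof. by move=> su n; apply: smooth_upto_fst. Qed.

Lemma smooth_on_snd (u : V -> R2) : smooth_on U u -> smooth_on U (fun x => (u x).2).
Proof. by move=> su n; apply: smooth_upto_snd. Qed.

Lemma smooth_on_pair (a b : V -> R) :
  smooth_on U a -> smooth_on U b -> smooth_on U (fun x => (a x, b x)).
Proof. by move=> sa sb n; apply: smooth_upto_pair. Qed.

Lemma smooth_on_comp (W : normedModType R) (U' : set R2) (f : V -> R2) (g : R2 -> W) :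
  (forall x, U x -> U' (f x)) -> smooth_on U f -> smooth_on U' g ->
  smooth_on U (g \o f).
Proof. by move=> fU sf sg n; apply: smooth_upto_comp fU _ _. Qed.

End SmoothOn.

(** * Mean values and second derivatives *)

Section MeanValue.
Variables (R : realType).
Local Notation R2 := (R * R)%type.

Lemma continuous_near (V W : normedModType R) (u : V -> W) z (e : R) :
  {for z, continuous u} -> 0 < e -> \forall x \near z, `|u z - u x| < e.
Proof. by move=> /cvgrPdist_lt cu e0; exact: cu. Qed.

Lemma dist_le_half (a b p e : R) :
  `|a - p| < e / 2 -> `|b - p| < e / 2 -> `|a - b| <= e.
Proof.
by rewrite !ltr_norml ler_norml => /andP[? ?] /andP[? ?]; apply/andP; split; lra.
Qed.

(** No order is imposed on [a] and [b], which is why the intermediate point is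
    located by its distance to [a]. *)
Lemma mean_value (f df : R -> R) (a b : R) :
  (forall t, `|t - a| <= `|b - a| -> is_derive t 1 f (df t)) ->
  exists2 c, `|c - a| <= `|b - a| & f b - f a = df c * (b - a).
Proof.
move=> fdf.
have cts c d : (forall t, c <= t <= d -> `|t - a| <= `|b - a|) ->
    {within `[c, d], continuous f}.
  move=> cd; apply: derivable_within_continuous => t; rewrite in_itv /= => tcd.
  by have [] := fdf t (cd t tcd).
have [ab|ba|<-] := ltgtP a b.
- have I t : a <= t <= b -> `|t - a| <= `|b - a|.
    by move=> /andP[at_ tb]; rewrite !ger0_norm ?subr_ge0 ?(ltW ab) // lerB.
  have [|c cab E] := MVT (df := df) ab _ (cts _ _ I).
    by move=> t; rewrite in_itv /= => /andP[a1 a2]; apply/fdf/I; rewrite !ltW.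
  by exists c => //; apply: I; move: cab; rewrite in_itv /= => /andP[a1 a2]; rewrite !ltW.
- have I t : b <= t <= a -> `|t - a| <= `|b - a|.
    move=> /andP[at_ tb]; rewrite !ler0_norm ?subr_le0 ?(ltW ba) //.
    by rewrite lerN2 lerB.
  have [|c cab E] := MVT (df := df) ba _ (cts _ _ I).
    by move=> t; rewrite in_itv /= => /andP[a1 a2]; apply/fdf/I; rewrite !ltW.
  exists c; first by apply: I; move: cab; rewrite in_itv /= => /andP[a1 a2]; rewrite !ltW.
  by rewrite -opprB E -mulrN opprB.
- by exists a; rewrite !subrr ?normr0 // mulr0.
Qed.

Lemma is_derive_line (V : normedModType R) (F : V -> R) (z v : V) (t : R) :
  differentiable F (t *: v + z) ->
  is_derive t 1 (fun s => F (s *: v + z)) ('D_v F (t *: v + z)).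
Proof.
move=> dF.
have L : is_diff t (fun s : R => s *: v + z) (fun s => s *: v).
  have H := is_diffD (is_diff_scalel t v) (is_diff_cst z t).
  by apply: (is_diff_eq H); apply/funext => s; rewrite !fctE /= addr0.
have dL : differentiable (fun s : R => s *: v + z) t by [].
apply: DeriveDef.
  by apply/derivable1_diffP; exact: (differentiable_comp dL dF).
rewrite [LHS](derive_comp (1 : R^o) dL dF) (deriveE _ dL).
by rewrite (@diff_val _ _ _ _ _ _ _ L) scale1r.
Qed.

Lemma mean_value_segment (V : normedModType R) (F : V -> R) (z v : V) :
  (forall t : R, 0 <= t <= 1 -> differentiable F (t *: v + z)) ->
  exists2 t : R, 0 <= t <= 1 & F (v + z) - F z = 'D_v F (t *: v + z).
Proof.
move=> dF.
have D (t : R^o) : t \in `[0, 1] ->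
    is_derive t 1 (fun s => F (s *: v + z)) ('D_v F (t *: v + z)).
  by rewrite in_itv /= => t01; apply: is_derive_line; exact: dF.
pose f (s : R) : R := F (s *: v + z); pose df (s : R) : R := 'D_v F (s *: v + z).
have fc : {within `[0, 1], continuous f}.
  by apply: derivable_within_continuous => t /D[].
have fdf (t : R) : t \in `]0, 1[ -> is_derive t 1 f (df t).
  by move=> t01; apply: D; exact: subset_itv_oo_cc.
have [t t01] := MVT ltr01 fdf fc.
rewrite /f /df subr0 mulr1 scale1r scale0r add0r => E; exists t => //.
by have := subset_itv_oo_cc t01; rewrite /= in_itv.
Qed.

(** Symmetry of second derivatives: the second difference of [F] along [v] and
    [w] is a value of either mixed derivative near the base point. *)
Lemma derive_comm (V : normedModType R) (U : set V) (F : V -> R) (z v w : V) :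
  open U -> U z -> smooth_on U F ->
  'D_w (fun x => 'D_v F x) z = 'D_v (fun x => 'D_w F x) z.
Proof.
move=> oU Uz sF.
have dF x : U x -> differentiable F x by have [dF _] := sF 1%N; exact: dF.
have dD v' x : U x -> differentiable (fun x => 'D_v' F x) x.
  by have [_ /(_ v')[dF' _]] := sF 2%N; exact: dF'.
have cDD v' w' : {for z, continuous (fun x => 'D_w' (fun x => 'D_v' F x) x)}.
  by have [_ /(_ v')[_ /(_ w') H]] := sF 2%N; exact: H.
apply/eqP; rewrite -subr_eq0 -normr_le0; apply/ler_addgt0Pr => e e0; rewrite add0r.
have e2 : 0 < e / 2 by rewrite divr_gt0.
have : \forall x \near z, [/\ U x,
   `|'D_w (fun x => 'D_v F x) z - 'D_w (fun x => 'D_v F x) x| < e / 2 &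
   `|'D_v (fun x => 'D_w F x) z - 'D_v (fun x => 'D_w F x) x| < e / 2].
  have A1 : \forall x \near z, U x by exact: open_nbhs_nbhs.
  have A2 := continuous_near (cDD v w) e2.
  have A3 := continuous_near (cDD w v) e2.
  apply: (@filterS3 _ _ _ _ _ _ _ _ A1 A2 A3).
  move=> x B1 B2 B3.
  exact: And3 B1 B2 B3.
move=> /nbhs_ballP[r /= r0]; rewrite -ball_normE /= => Hr.
pose n := `|v| + `|w| + 1.
have n0 : 0 < n by rewrite ltr_wpDl // addr_ge0.
have [h h0 Eh] : exists2 h : R, 0 < h & r = h * (2 * n).
  have n2 : 0 < 2 * n by rewrite mulr_gt0.
  by exists (r / (2 * n)); [rewrite divr_gt0 | rewrite mulfVK // gt_eqF].
have inr (t s : R) : 0 <= t <= 1 -> 0 <= s <= 1 ->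
   `|z - (s *: (h *: w) + (t *: (h *: v) + z))| < r.
  move=> /andP[t0 t1] /andP[s0 s1].
  rewrite addrA opprD [- _ - z]addrC addrA subrr add0r normrN.
  apply: le_lt_trans (ler_normD _ _) _; rewrite !normrZ (ger0_norm s0) (ger0_norm t0) (gtr0_norm h0).
  rewrite Eh !(mulrCA _ h) -mulrDr ltr_pM2l //.
  have A1 : s * `|w| <= `|w| by rewrite ler_piMl.
  have A2 : t * `|v| <= `|v| by rewrite ler_piMl.
  have := normr_ge0 v; have := normr_ge0 w; rewrite /n; lra.
(* Two applications of the mean value theorem, first along [v'] to the increment
   of [F] in the direction [w'], then along [w']. *)
have key v' w' : (forall t s : R, 0 <= t <= 1 -> 0 <= s <= 1 ->
     U (s *: (h *: w') + (t *: (h *: v') + z))) ->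
   exists ts : R2, [/\ 0 <= ts.1 <= 1, 0 <= ts.2 <= 1 &
     F (h *: v' + h *: w' + z) - F (h *: w' + z) - F (h *: v' + z) + F z =
     h ^+ 2 * 'D_w' (fun x => 'D_v' F x) (ts.2 *: (h *: w') + (ts.1 *: (h *: v') + z))].
  move=> UU.
  have U0 (t : R) : 0 <= t <= 1 -> U (t *: (h *: v') + z).
    by move=> t01; have := UU t 0 t01; rewrite scale0r add0r lexx ler01 => /(_ isT).
  have U1 (t : R) : 0 <= t <= 1 -> U (h *: w' + (t *: (h *: v') + z)).
    by move=> t01; have := UU t 1 t01; rewrite scale1r lexx ler01 => /(_ isT).
  pose G := fun x => F (h *: w' + x) - F x.
  have dshift x : U (h *: w' + x) -> differentiable (fun x => F (h *: w' + x)) x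
      /\ 'D_(h *: v') (fun x => F (h *: w' + x)) x = 'D_(h *: v') F (h *: w' + x).
    move=> Ux; have dA : differentiable (fun x => h *: w' + x) x.
      exact: differentiableD.
    split; first exact: (differentiable_comp dA (dF _ Ux)).
    rewrite (derive_comp _ dA (dF _ Ux)); congr derive.
    rewrite deriveD; [|exact: derivable_cst|exact: derivable_id].
    by rewrite derive_cst derive_id add0r.
  have [t t01|t t01 Et] := @mean_value_segment _ G z (h *: v').
    by apply: differentiableB; [have [] := dshift _ (U1 _ t01)|exact/dF/U0].
  have [s s01|s s01 Es] := @mean_value_segment _ (fun x => 'D_(h *: v') F x) (t *: (h *: v') + z) (h *: w').
    by have [_ /(_ (h *: v'))[H _]] := sF 2%N; apply: H; exact: UU.
  exists (t, s); split => //=.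
  transitivity (G (h *: v' + z) - G z).
    rewrite /G addrA [h *: w' + h *: v']addrC; ring.
  rewrite Et.
  have [dS ES] := dshift _ (U1 _ t01).
  have dFt := dF _ (U0 _ t01).
  rewrite /G deriveB; [|exact: diff_derivable|exact: diff_derivable].
  rewrite ES Es.
  have dDs := dD v' _ (UU t s t01 s01).
  have -> : 'D_(h *: w') (fun x => 'D_(h *: v') F x) (s *: (h *: w') + (t *: (h *: v') + z))
     = 'D_(h *: w') (fun x => h *: 'D_v' F x) (s *: (h *: w') + (t *: (h *: v') + z)).
    apply: near_eq_derive; apply: (open_near oU); first exact: UU.
    by move=> y Uy; rewrite !deriveE ?linearZ //; exact: dF.
  rewrite deriveZ; last exact: diff_derivable.
  by rewrite (deriveE _ dDs) linearZ /= -(deriveE _ dDs) expr2 -mulrA.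
have [|[t s] [t01 s01 /= E1]] := key v w.
  by move=> t s t01 s01; have [] := Hr _ (inr t s t01 s01).
have inr' (a b : R) : 0 <= a <= 1 -> 0 <= b <= 1 ->
   `|z - (b *: (h *: v) + (a *: (h *: w) + z))| < r.
  by move=> a01 b01; rewrite addrCA; exact: inr.
have [|[t' s'] [t01' s01' /= E2]] := key w v.
  by move=> ? ? A1 A2; have [] := Hr _ (inr' _ _ A1 A2).
have h2 : h ^+ 2 != 0 by rewrite expf_neq0 // gt_eqF.
have E0 : F (h *: v + h *: w + z) - F (h *: w + z) - F (h *: v + z) + F z =
   F (h *: w + h *: v + z) - F (h *: v + z) - F (h *: w + z) + F z.
  by rewrite [h *: w + h *: v]addrC; congr (_ + _); exact: addrAC.
have E := mulfI h2 (etrans (esym E1) (etrans E0 E2)).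
have [_ A1 _] := Hr _ (inr t s t01 s01).
have [_ _ A2] := Hr _ (inr' _ _ t01' s01').
rewrite E in A1.
exact: dist_le_half A1 A2.
Qed.

Lemma differentiable_plane (W : normedModType R) (u : R2 -> W) (z : R2) (p q : W) :
  (forall e : R, 0 < e -> \forall h \near (0 : R2),
     `|u (h + z) - u z - (h.1 *: p + h.2 *: q)| <= e * `|h|) ->
  differentiable u z /\ (forall v, 'D_v u z = v.1 *: p + v.2 *: q).
Proof.
move=> H; pose L (v : R2) : W := v.1 *: p + v.2 *: q.
have linL : linear L.
  by move=> a v w; rewrite /L /= !scalerDl scalerDr !scalerA addrACA.
pose LM := GRing.isLinear.Build _ _ _ _ _ linL.
pose LL : {linear R2 -> W} := HB.pack L LM.
have cL : continuous LL.
  move=> v; apply: cvgD.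
    by apply: cvgZ; [exact: cvg_fst | exact: cvg_cst].
  by apply: cvgZ; [exact: cvg_snd | exact: cvg_cst].
have [du E] := differentiable_estimate cL H.
by split => // v; rewrite deriveE // E.
Qed.

(** The increment is split along a horizontal and a vertical segment, with the
    mean value theorem on each; continuity of [P] and [Q] absorbs the change of
    base point. *)
Lemma differentiable_partials (u : R2 -> R) (P Q : R2 -> R) (z : R2) (r : R) : 0 < r ->
  (forall y : R2, `|y - z| < r -> is_derive y.1 1 (fun x : R => u (x, y.2)) (P y)) ->
  (forall y : R2, `|y - z| < r -> is_derive y.2 1 (fun x : R => u (y.1, x)) (Q y)) ->
  {for z, continuous P} -> {for z, continuous Q} ->
  differentiable u z /\ (forall v, 'D_v u z = v.1 * P z + v.2 * Q z).
Proof.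
move=> r0 uP uQ cP cQ; apply: differentiable_plane => e e0.
have e2 : 0 < e / 2 by rewrite divr_gt0.
have : \forall x \near z, [/\ `|x - z| < r, `|P z - P x| < e / 2 & `|Q z - Q x| < e / 2].
  have A1 : \forall x \near z, `|x - z| < r.
    by apply/nbhs_ballP; exists r => //= y; rewrite -ball_normE /= distrC.
  have A2 := continuous_near cP e2.
  have A3 := continuous_near cQ e2.
  apply: (@filterS3 _ _ _ _ _ _ _ _ A1 A2 A3).
  move=> x B1 B2 B3.
  exact: And3 B1 B2 B3.
move=> /nbhs_ballP[d /= d0]; rewrite -ball_normE /= => Hd.
apply/nbhs_ballP; exists d => //= -[a b]; rewrite -ball_normE /= sub0r normrN.
rewrite prod_normE /= => hd.
have [ad bd] : `|a| < d /\ `|b| < d by move: hd; rewrite gt_max => /andP[].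
have near_z (c1 c2 : R) : `|c1 - z.1| <= `|a| -> `|c2 - z.2| <= `|b| -> `|z - (c1, c2)| < d.
  move=> c1a c2b; rewrite prod_normE gt_max /= distrC [X in _ && (X < _)]distrC.
  by rewrite (le_lt_trans c1a) // (le_lt_trans c2b).
have [c1] := @mean_value (fun t => u (t, b + z.2)) (fun t => P (t, b + z.2)) z.1 (a + z.1)
  ltac:(by move=> t; rewrite addrK => ta; apply: (uP (t, b + z.2));
        have [|//] := Hd (t, b + z.2); apply: near_z; rewrite ?addrK).
have [c2] := @mean_value (fun t => u (z.1, t)) (fun t => Q (z.1, t)) z.2 (b + z.2)
  ltac:(by move=> t; rewrite addrK => tb; apply: (uQ (z.1, t));
        have [|//] := Hd (z.1, t); apply: near_z; rewrite ?subrr ?normr0).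
rewrite !addrK => c2b E2 c1a E1.
have -> : u ((a, b) + z) - u z - (a *: P z + b *: Q z) =
   a * (P (c1, b + z.2) - P z) + b * (Q (z.1, c2) - Q z).
  have -> : u ((a, b) + z) - u z = (u (a + z.1, b + z.2) - u (z.1, b + z.2)) + (u (z.1, b + z.2) - u (z.1, z.2)).
    by rewrite -surjective_pairing; rewrite addrA subrK.
  rewrite E1 E2 /GRing.scale /=; ring.
have [_ P1 _] := Hd (c1, b + z.2) ltac:(by apply: near_z; rewrite ?addrK).
have [_ _ Q1] := Hd (z.1, c2) ltac:(by apply: near_z; rewrite ?subrr ?normr0).
apply: le_trans (ler_normD _ _) _.
rewrite !normrM [X in `|a| * X]distrC [X in `|b| * X]distrC.
set m := Num.max `|a| `|b|.
have M1 : `|a| <= m by rewrite le_max lexx.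
have M2 : `|b| <= m by rewrite le_max lexx orbT.
have -> : e * m = m * (e / 2) + m * (e / 2) by field.
by rewrite lerD // ler_pM // ltW.
Qed.

End MeanValue.

(** * The inverse function theorem in the plane *)

Section InverseFunction.
Variables (R : realType).
Local Notation R2 := (R * R)%type.

Lemma norm_fst (v : R2) : `|v.1| <= `|v|.
Proof. by rewrite prod_normE le_max lexx. Qed.

Lemma norm_snd (v : R2) : `|v.2| <= `|v|.
Proof. by rewrite prod_normE le_max lexx orbT. Qed.

Lemma norm_pair_le (v : R2) e : `|v.1| <= e -> `|v.2| <= e -> `|v| <= e.
Proof. by move=> v1 v2; rewrite prod_normE ge_max v1. Qed.

Lemma norm_mul_le (a b c d : R) : `|a| <= c -> `|b| <= d -> `|a| * `|b| <= c * d.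
Proof. by move=> ac bd; apply: ler_pM. Qed.

Lemma linear_form_close (c p q p' q' : R) (v : R2) :
  `|p - p'| < c / 2 -> `|q - q'| < c / 2 ->
  `|v.1 *: p' + v.2 *: q' - (v.1 *: p + v.2 *: q)| <= c * `|v|.
Proof.
move=> pp qq.
have -> : v.1 *: p' + v.2 *: q' - (v.1 *: p + v.2 *: q) =
   - (v.1 * (p - p') + v.2 * (q - q')) by rewrite /GRing.scale /=; ring.
have -> : c * `|v| = `|v| * (c / 2) + `|v| * (c / 2) by field.
rewrite normrN; apply: le_trans (ler_normD _ _) _; rewrite !normrM.
apply: lerD; apply: norm_mul_le.
- exact: norm_fst.
- exact: ltW.
- exact: norm_snd.
- exact: ltW.
Qed.

Lemma linear_form_bounded (m n j a b x y : R) : `|a| <= m -> `|b| <= m ->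
  `|x| <= n -> `|y| <= n ->
  `|(a * x - b * y) / j| <= (2 * m * `|j^-1| + 1) * n.
Proof.
move=> am bm xn yn; rewrite normrM mulrDl mul1r.
apply: ler_wpDr; first exact: le_trans (normr_ge0 _) xn.
rewrite mulrAC; apply: ler_wpM2r; first exact: normr_ge0.
have -> : 2 * m * n = m * n + m * n by ring.
apply: le_trans (ler_normB _ _) _; rewrite !normrM.
by apply: lerD; apply: norm_mul_le.
Qed.

Lemma open_ball (z : R2) r : open [set y : R2 | `|y - z| < r].
Proof.
rewrite openE => y /= yr; apply/nbhs_ballP; exists (r - `|y - z|); first by rewrite /= subr_gt0.
move=> x; rewrite -ball_normE /= => xy.
rewrite -(subrKA y) (le_lt_trans (ler_normD _ _)) // distrC.
by move: xy; rewrite ltrBrDr.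
Qed.

(** Unlike differentiability at [z], this compares two arbitrary points near [z];
    both injectivity and surjectivity of a local diffeomorphism rest on it. *)
Lemma strict_estimate (U : set R2) (u : R2 -> R) (z : R2) (c : R) :
  open U -> U z -> smooth_on U u -> 0 < c ->
  exists2 r, 0 < r & forall a b, `|a - z| < r -> `|b - z| < r ->
    U a /\ `|u a - u b - 'D_(a - b) u z| <= c * `|a - b|.
Proof.
move=> oU Uz su c0; have c2 : 0 < c / 2 by rewrite divr_gt0.
have du := smooth_onS su.
have cx := smooth_on_continuous (smooth_on_derive (ex R) su) Uz.
have cy := smooth_on_continuous (smooth_on_derive (ey R) su) Uz.
have : \forall x \near z, [/\ U x, `|'D_(ex R) u z - 'D_(ex R) u x| < c / 2
   & `|'D_(ey R) u z - 'D_(ey R) u x| < c / 2].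
  have A1 : \forall x \near z, U x by exact: open_nbhs_nbhs.
  have A2 := continuous_near cx c2.
  have A3 := continuous_near cy c2.
  apply: (@filterS3 _ _ _ _ _ _ _ _ A1 A2 A3).
  move=> x B1 B2 B3.
  exact: And3 B1 B2 B3.
move=> /nbhs_ballP[r /= r0]; rewrite -ball_normE /= => Hr; exists r => // a b az bz.
split; first by have [] := Hr a; rewrite /ball_ /= 1?distrC.
have seg (t : R) : 0 <= t <= 1 -> `|z - (t *: (a - b) + b)| < r.
  move=> /andP[t0 t1].
  have -> : z - (t *: (a - b) + b) = - (t *: (a - z) + (1 - t) *: (b - z)).
    by apply: injective_projections => /=; rewrite /GRing.scale /=; ring.
  rewrite normrN (le_lt_trans (ler_normD _ _)) // !normrZ (ger0_norm t0) [`|1 - t|]ger0_norm ?subr_ge0 //.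
  have [t1'|t1'] := ltP 0 t.
    have : t * `|a - z| < t * r by rewrite ltr_pM2l.
    have : (1 - t) * `|b - z| <= (1 - t) * r by rewrite ler_wpM2l ?subr_ge0 // ltW.
    lra.
  have -> : t = 0 by apply/eqP; rewrite eq_le t0 t1'.
  by rewrite mul0r subr0 mul1r add0r.
have [t t01|t t01 E] := @mean_value_segment _ _ u b (a - b).
  by apply: du; have [] := Hr _ (seg t t01).
have [Ut dx dy] := Hr _ (seg t t01).
rewrite -[X in u X - _](subrK b) E; set y := t *: _ + _ in Ut dx dy *.
rewrite !(derive_plane (a - b)) //; [|exact: du|exact: du].
exact: (linear_form_close (a - b) dx dy).
Qed.

Definition jac (F : R2 -> R2) (z : R2) : R :=
  ('D_(ex R) F z).1 * ('D_(ey R) F z).2 - ('D_(ex R) F z).2 * ('D_(ey R) F z).1.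

(** The inverse of the differential, by Cramer's rule. *)
Definition jac_inv (F : R2 -> R2) (z w : R2) : R2 :=
  ((('D_(ey R) F z).2 * w.1 - ('D_(ey R) F z).1 * w.2) / jac F z,
   (('D_(ex R) F z).1 * w.2 - ('D_(ex R) F z).2 * w.1) / jac F z).

Lemma jac_invK F z w : differentiable F z -> jac F z != 0 ->
  jac_inv F z ('D_w F z) = w.
Proof.
move=> dF J0; rewrite derive_plane // /jac_inv; move: J0; rewrite /jac.
case: ('D__ F z) => p q; case: ('D__ F z) => s t; case: w => a b /= J0.
by apply: injective_projections; rewrite /= /GRing.scale /=; field.
Qed.

Lemma jacK_inv F z w : differentiable F z -> jac F z != 0 ->
  'D_(jac_inv F z w) F z = w.
Proof.
move=> dF J0; rewrite derive_plane // /jac_inv; move: J0; rewrite /jac.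
case: ('D__ F z) => p q; case: ('D__ F z) => s t; case: w => a b /= J0.
by apply: injective_projections; rewrite /= /GRing.scale /=; field.
Qed.

Lemma jac_inv_linear F z : linear (jac_inv F z).
Proof.
move=> a v w; rewrite /jac_inv.
by apply: injective_projections; rewrite /= /GRing.scale /=; ring.
Qed.

Lemma jac_invB F z v w : jac_inv F z (v - w) = jac_inv F z v - jac_inv F z w.
Proof. by rewrite addrC -scaleN1r jac_inv_linear scaleN1r addrC. Qed.

Lemma jac_inv_bounded F z : exists2 k, 0 < k & forall w, `|jac_inv F z w| <= k * `|w|.
Proof.
rewrite /jac_inv; move: (jac F z) ('D_(ex R) F z) ('D_(ey R) F z) => j p q.
exists (2 * (`|p| + `|q|) * `|j^-1| + 1).
  by rewrite ltr_wpDl // !mulr_ge0 // addr_ge0.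
move=> w.
have pp := norm_fst p; have pq := norm_snd p; have qp := norm_fst q; have qq := norm_snd q.
have p0 := normr_ge0 p; have q0 := normr_ge0 q.
have w1 := norm_fst w; have w2 := norm_snd w.
by apply: norm_pair_le; apply: linear_form_bounded => //; lra.
Qed.

Lemma compact_box (z : R2) (r : R) : compact [set y : R2 | `|y - z| <= r].
Proof.
have -> : [set y : R2 | `|y - z| <= r] =
    (`[z.1 - r, z.1 + r]%classic `*` `[z.2 - r, z.2 + r]%classic).
  apply/seteqP; split => -[a b] /=; rewrite prod_normE ge_max /= !in_itv /= !ler_distl.
    by move=> /andP[-> ->].
  by move=> [-> ->].
by apply: compact_setX; exact: segment_compact.
Qed.

Lemma smooth_jac_inv (U : set R2) F v : open U -> smooth_on U F ->
  (forall y, U y -> jac F y != 0) -> smooth_on U (fun y => jac_inv F y v).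
Proof.
move=> oU sF J0.
have sx := smooth_on_derive (ex R) sF; have sy := smooth_on_derive (ey R) sF.
have sx1 := smooth_on_fst oU sx; have sx2 := smooth_on_snd oU sx.
have sy1 := smooth_on_fst oU sy; have sy2 := smooth_on_snd oU sy.
have sJ : smooth_on U (jac F).
  exact: (smooth_onB oU (smooth_onM oU sx1 sy2) (smooth_onM oU sx2 sy1)).
have sJV := smooth_onV oU J0 sJ.
have c1 := smooth_on_cst U v.1; have c2 := smooth_on_cst U v.2.
have A := smooth_onM oU (smooth_onB oU (smooth_onM oU sy2 c1) (smooth_onM oU sy1 c2)) sJV.
have B := smooth_onM oU (smooth_onB oU (smooth_onM oU sx1 c2) (smooth_onM oU sx2 c1)) sJV.
exact: (smooth_on_pair oU A B).
Qed.

(** The local inverse takes a ball (a square, for the norm of the plane) around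
    the image point onto an open neighbourhood of [z]; injectivity comes from
    the strict estimate, and surjectivity by minimising the distance to the
    target over a small closed square. *)
Theorem inverse_function (U : set R2) (F : R2 -> R2) (z : R2) :
  open U -> U z -> smooth_on U F -> (forall y, U y -> jac F y != 0) ->
  exists G : R2 -> R2, exists r : R, exists N : set R2,
  [/\ 0 < r, open N, N `<=` U & N z] /\
  [/\ forall y, N y -> `|F y - F z| < r /\ G (F y) = y,
      forall w, `|w - F z| < r -> N (G w) /\ F (G w) = w,
      smooth_on [set w : R2 | `|w - F z| < r] G &
      forall w v, `|w - F z| < r -> 'D_v G w = jac_inv F (G w) v].
Proof.
move=> oU Uz sF J0.
have dF := smooth_onS sF.
have sF1 := smooth_on_fst oU sF.
have sF2 := smooth_on_snd oU sF.
have [k k0 Hk] := jac_inv_bounded F z.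
have c0 : 0 < (2 * k)^-1 by rewrite invr_gt0 mulr_gt0.
have [r1 r10 H1] := strict_estimate oU Uz sF1 c0.
have [r2 r20 H2] := strict_estimate oU Uz sF2 c0.
have [rho rho0 Hrho] : exists2 rho, 0 < rho & forall a b, `|a - z| <= rho -> `|b - z| <= rho ->
    U a /\ `|F a - F b - 'D_(a - b) F z| <= (2 * k)^-1 * `|a - b|.
  exists (Num.min r1 r2 / 2); first by rewrite divr_gt0 // lt_min r10.
  move=> a b az bz.
  have lt_r (x : R2) : `|x - z| <= Num.min r1 r2 / 2 -> `|x - z| < r1 /\ `|x - z| < r2.
    move=> xz; have m0 : 0 < Num.min r1 r2 by rewrite lt_min r10.
    have : `|x - z| < Num.min r1 r2 by apply: le_lt_trans xz _; rewrite gtr_pMr // invf_lt1 // ltr1n.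
    by rewrite lt_min => /andP[].
  have [a1 a2] := lt_r a az; have [b1 b2] := lt_r b bz.
  have [Ua E1] := H1 a b a1 b1; have [_ E2] := H2 a b a2 b2; split => //.
  rewrite (derive_fst _ (dF z Uz)) in E1; rewrite (derive_snd _ (dF z Uz)) in E2.
  exact: norm_pair_le.
(* [F] differs from its differential, which expands distances by at least [1 / k],
   by at most half of that. *)
have lip a b : `|a - z| <= rho -> `|b - z| <= rho -> `|a - b| <= 2 * k * `|F a - F b|.
  move=> az bz; have [_ E] := Hrho a b az bz.
  have K := Hk ('D_(a - b) F z); rewrite (jac_invK _ (dF z Uz) (J0 z Uz)) in K.
  have T : `|'D_(a - b) F z| <= `|F a - F b| + (2 * k)^-1 * `|a - b|.
    rewrite -[X in `|X| <= _](subKr (F a - F b)) (le_trans (ler_normB _ _)) // lerD //.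
  have KT : k * `|'D_(a - b) F z| <= k * `|F a - F b| + `|a - b| / 2.
    apply: le_trans (ler_wpM2l (ltW k0) T) _; rewrite mulrDr lerD2l invfM.
    by rewrite mulrCA mulrA mulfVK ?gt_eqF // mulrC.
  have := le_trans K KT; lra.
(* By [lip], a point whose image is within [2 * r] of [F z] is within [4 * k * r],
   half of [rho], of [z]. *)
have [r r_gt0 Er] : exists2 r, 0 < r & 8 * k * r = rho.
  have k8 : 0 < 8 * k by rewrite mulr_gt0.
  by exists (rho / (8 * k)); [rewrite divr_gt0 | rewrite mulrCA mulfV ?mulr1 // gt_eqF].
have zz : `|z - z| <= rho by rewrite subrr normr0 ltW.
have near_of_image y : `|y - z| <= rho -> `|F y - F z| < 2 * r -> `|y - z| < rho.
  move=> yz Fyz; have L := lip _ _ yz zz.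
  apply: le_lt_trans L _; rewrite -Er.
  have : 2 * k * `|F y - F z| < 2 * k * (2 * r) by rewrite ltr_pM2l // mulr_gt0.
  have : 0 < k * r by rewrite mulr_gt0.
  by move=> A B; apply: lt_trans B _; nra.
have surj w : `|w - F z| < r -> exists2 y, `|y - z| < rho & F y = w.
  move=> wr; pose g y := `|F y - w|.
  have cg : {within [set y : R2 | `|y - z| <= rho], continuous g}.
    apply: continuous_in_subspaceT => y; rewrite inE /= => yz.
    have [Uy _] := Hrho y z yz zz.
    apply: (@continuous_comp _ _ _ (fun y => F y - w) (@Num.norm R R2)); last exact: norm_continuous.
    by apply: cvgB; [exact: smooth_on_continuous sF y Uy | exact: cvg_cst].
  have [|y yz ymin] := compact_EVT_min _ (@compact_box z rho) cg; first by exists z.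
  have yz' : `|y - z| <= rho by move: yz; rewrite inE.
  have gz : g y < r by apply: le_lt_trans (ymin z _) _; rewrite ?inE // /g distrC.
  have yrho : `|y - z| < rho.
    apply: near_of_image => //; rewrite -(subrKA w); apply: le_lt_trans (ler_normD _ _) _.
    by rewrite mulrDl mul1r ltrD.
  exists y => //; apply/eqP; rewrite -subr_eq0 -normr_eq0; apply: contraT => gy0.
  have gy : 0 < g y by rewrite lt_def gy0 normr_ge0.
  (* If [F y] missed [w], a small part [t] of the Newton step [v] would stay in the
     square and decrease the distance to [w]. *)
  pose v := jac_inv F z (w - F y).
  have Lv : 'D_v F z = w - F y by apply: jacK_inv; [exact: dF | exact: J0].
  have vk : `|v| <= k * g y by rewrite /g distrC; exact: Hk.
  pose t : R := Num.min 1 ((rho - `|y - z|) / (`|v| + 1)).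
  have v1 : 0 < `|v| + 1 by rewrite ltr_wpDl.
  have t0 : 0 < t by rewrite lt_min ltr01 divr_gt0 // subr_gt0.
  have t1 : t <= 1 by rewrite ge_min lexx.
  have tv : t * `|v| <= rho - `|y - z|.
    have : t <= (rho - `|y - z|) / (`|v| + 1) by rewrite ge_min lexx orbT.
    rewrite ler_pdivlMr //; apply: le_trans; rewrite ler_wpM2l ?(ltW t0) //.
    by rewrite lerDl.
  have y'z : `|y + t *: v - z| <= rho.
    rewrite addrAC; apply: le_trans (ler_normD _ _) _.
    by rewrite normrZ (gtr0_norm t0) -lerBrDl.
  have := ymin (y + t *: v); rewrite inE => /(_ y'z).
  have [_ E] := Hrho (y + t *: v) y y'z yz'.
  have yy : y + t *: v - y = t *: v by rewrite addrAC subrr add0r.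
  have Dt : 'D_(t *: v) F z = t *: (w - F y).
    rewrite -Lv.
    by rewrite (deriveE _ (dF z Uz)) linearZ /= -(deriveE _ (dF z Uz)).
  rewrite yy Dt normrZ (gtr0_norm t0) in E.
  have F1 : g (y + t *: v) <= (1 - t) * g y + (2 * k)^-1 * (t * `|v|).
    have -> : g (y + t *: v) = `|(1 - t) *: (F y - w) + (F (y + t *: v) - F y - t *: (w - F y))|.
      rewrite /g; congr (`|_|); apply: injective_projections => /=; rewrite /GRing.scale /=; ring.
    apply: le_trans (ler_normD _ _) _; rewrite normrZ ger0_norm ?subr_ge0 //.
    by rewrite lerD2l.
  have F2 : (2 * k)^-1 * (t * `|v|) <= t * g y / 2.
    have : t * `|v| <= t * (k * g y) by rewrite ler_wpM2l ?(ltW t0).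
    move=> tvk; have k2 : 0 < 2 * k by rewrite mulr_gt0.
    rewrite mulrC ler_pdivrMr //; apply: le_trans tvk _.
    by rewrite le_eqVlt; apply/orP; left; apply/eqP; field.
  have tg : 0 < t * g y by rewrite mulr_gt0.
  move=> F3; have := le_trans F3 (le_trans F1 (lerD (lexx _) F2)); lra.
have inj y y' : `|y - z| < rho -> `|y' - z| < rho -> F y = F y' -> y = y'.
  move=> /ltW yz /ltW yz' E; have := lip _ _ yz yz'.
  by rewrite E subrr normr0 mulr0 normr_le0 subr_eq0 => /eqP.
pose G w := xget z [set y | `|y - z| < rho /\ F y = w].
have GP w : `|w - F z| < r -> `|G w - z| < rho /\ F (G w) = w.
  by move=> /surj[y yz Fy]; apply: (xgetPex z (P := [set y | `|y - z| < rho /\ F y = w])); exists y.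
have FU y : `|y - z| < rho -> U y by move=> /ltW yz; have [] := Hrho y z yz zz.
pose N := [set y : R2 | `|y - z| < rho /\ `|F y - F z| < r].
have NU : N `<=` U by move=> y [/FU].
have oN : open N.
  rewrite openE => y [yz Fy]; have Uy := FU y yz.
  have A1 : \forall x \near y, `|x - z| < rho by exact: open_nbhs_nbhs (conj (@open_ball z rho) yz).
  have A2 : \forall x \near y, `|F x - F z| < r.
    exact: (smooth_on_continuous sF Uy) (open_nbhs_nbhs (conj (@open_ball (F z) r) Fy)).
  by apply: filterS2 A1 A2 => x.
have Gball w : `|w - F z| < r -> N (G w).
  by move=> wr; have [? E] := GP w wr; split; rewrite ?E.
have dG w : `|w - F z| < r -> differentiable G w /\ (forall v, 'D_v G w = jac_inv F (G w) v).
  move=> wr; have [yz Fy] := GP w wr; have Uy := FU _ yz.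
  set y := G w in yz Fy Uy *.
  have [K K0 HK] := jac_inv_bounded F y.
  have linA v : jac_inv F y v = v.1 *: jac_inv F y (ex R) + v.2 *: jac_inv F y (ey R).
    have L := jac_inv_linear F y; rewrite {1}[v](_ : _ = v.1 *: ex R + v.2 *: ey R).
      rewrite L; congr (_ + _); rewrite -[v.2 *: ey R]addr0 L.
      have -> : jac_inv F y 0 = 0.
        by apply: injective_projections; rewrite /jac_inv /= !mulr0 subrr mul0r.
      by rewrite addr0.
    by apply: injective_projections; rewrite /= /GRing.scale /= ?mulr1 ?mulr0 ?addr0 ?add0r.
  suff H e : 0 < e -> \forall h \near (0 : R2),
      `|G (h + w) - G w - (h.1 *: jac_inv F y (ex R) + h.2 *: jac_inv F y (ey R))| <= e * `|h|.
    by have [dG DG] := differentiable_plane H; split => // v; rewrite DG [RHS]linA.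
  move=> e0; pose e' := e / (K * (2 * k)).
  have Kk : 0 < K * (2 * k) by rewrite mulr_gt0 // mulr_gt0.
  have e'0 : 0 < e' by rewrite divr_gt0.
  have /nbhs_ballP[d /= d0] := estimate_differentiable (dF y Uy) e'0.
  rewrite -ball_normE /= => Hd.
  have A1 : \forall h \near (0 : R2), `|h + w - F z| < r.
    apply/nbhs_ballP; exists (r - `|w - F z|); first by rewrite /= subr_gt0.
    move=> h; rewrite -ball_normE /= sub0r normrN ltrBrDr => hr.
    by rewrite -addrA; exact: le_lt_trans (ler_normD _ _) hr.
  have A2 : \forall h \near (0 : R2), 2 * k * `|h| < d.
    apply/nbhs_ballP; exists (d / (2 * k)); first by rewrite /= divr_gt0 // mulr_gt0.
    by move=> h; rewrite -ball_normE /= sub0r normrN ltr_pdivlMr ?mulr_gt0 // mulrC.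
  apply: (@filterS2 _ _ _ _ _ _ _ A1 A2).
  move=> h hr hd; have [y'z Fy'] := GP _ hr.
  rewrite -linA; set q := G (h + w) - y.
  have qh : `|q| <= 2 * k * `|h|.
    by have := lip _ _ (ltW y'z) (ltW yz); rewrite Fy' Fy addrK.
  have := Hd q; rewrite /ball_ /= sub0r normrN => /(_ (le_lt_trans qh hd)).
  rewrite /q subrK Fy' Fy addrK -/q -(deriveE q (dF y Uy)) => E.
  have -> : q - jac_inv F y h = - jac_inv F y (h - 'D_q F y).
    by rewrite jac_invB (jac_invK q (dF y Uy) (J0 y Uy)) opprB.
  rewrite normrN; apply: le_trans (HK _) _.
  apply: (@le_trans _ _ (K * (e' * (2 * k * `|h|)))).
    rewrite ler_wpM2l ?(ltW K0) //; apply: le_trans E _.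
    by rewrite ler_wpM2l ?(ltW e'0).
  have -> : K * (e' * (2 * k * `|h|)) = e' * (K * (2 * k)) * `|h| by ring.
  by rewrite /e' mulfVK ?gt_eqF.
exists G, r, N; split; first by split => //; split; rewrite ?subrr ?normr0.
split.
- move=> y [yz Fy]; split => //; have [y'z Fy'] := GP _ Fy.
  exact: inj.
- by move=> w wr; split; [exact: Gball | have [] := GP w wr].
(* The derivative of [G] is [jac_inv F] composed with [G], so each order of
   smoothness gives the next one. *)
- elim=> [|n IH].
    by move=> w wr; apply: differentiable_continuous; have [] := dG w wr.
  split=> [w wr|v]; first by have [] := dG w wr.
  have S := smooth_upto_comp (@open_ball (F z) r) (fun w wr => NU _ (Gball w wr)) IH
     (smooth_jac_inv v oU sF J0 n).
  apply: smooth_upto_eq S; first exact: open_ball.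
  by move=> w wr; have [_ ->] := dG w wr.
- by move=> w v wr; have [_ ->] := dG w wr.
Qed.

End InverseFunction.

(** * Primitives of closed forms in the plane *)

Section ClosedForms.
Variable R : realType.
Local Notation R2 := (R * R)%type.
Local Notation mu := (@lebesgue_measure R).

Lemma is_derive_x (u : R2 -> R) (x y : R) : differentiable u (x, y) ->
  is_derive x 1 (fun t => u (t, y)) ('D_(ex R) u (x, y)).
Proof.
have E (t : R) : t *: ex R + (0, y) = (t, y) :> R2.
  by apply: injective_projections; rewrite /= /GRing.scale /= ?mulr1 ?mulr0 ?addr0 ?add0r.
move=> du; have := @is_derive_line R R2 u (0, y) (ex R) x; rewrite E => /(_ du).
by rewrite (_ : (fun s : R => u (s *: ex R + (0, y))) = fun t => u (t, y)) //; apply/funext => t; rewrite E.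
Qed.

Lemma is_derive_y (u : R2 -> R) (x y : R) : differentiable u (x, y) ->
  is_derive y 1 (fun t => u (x, t)) ('D_(ey R) u (x, y)).
Proof.
have E (t : R) : t *: ey R + (x, 0) = (x, t) :> R2.
  by apply: injective_projections; rewrite /= /GRing.scale /= ?mulr1 ?mulr0 ?addr0 ?add0r.
move=> du; have := @is_derive_line R R2 u (x, 0) (ey R) y; rewrite E => /(_ du).
by rewrite (_ : (fun s : R => u (s *: ey R + (x, 0))) = fun t => u (x, t)) //; apply/funext => t; rewrite E.
Qed.

Lemma continuous_x (u : R2 -> R) (x y : R) : {for (x, y), continuous u} ->
  {for x, continuous (fun t => u (t, y))}.
Proof.
move=> cu; apply: (@continuous_comp _ _ _ (fun t : R => (t, y)) u) => //.
by apply: (@cvg_pair _ _ _ (nbhs x) (nbhs x) (nbhs y) _ _ _ id (fun=> y)); [exact: cvg_id | exact: cvg_cst].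
Qed.

Lemma continuous_y (u : R2 -> R) (x y : R) : {for (x, y), continuous u} ->
  {for y, continuous (fun t => u (x, t))}.
Proof.
move=> cu; apply: (@continuous_comp _ _ _ (fun t : R => (x, t)) u) => //.
by apply: (@cvg_pair _ _ _ (nbhs y) (nbhs x) (nbhs y) _ _ _ (fun=> x) id); [exact: cvg_cst | exact: cvg_id].
Qed.

Lemma integrable_segment (g : R -> R) (a b : R) :
  (forall t, a <= t <= b -> {for t, continuous g}) ->
  mu.-integrable `[a, b] (EFin \o g).
Proof.
move=> cg; apply: continuous_compact_integrable; first exact: segment_compact.
apply: continuous_in_subspaceT => t; rewrite inE /= in_itv /= => tab.
exact: cg.
Qed.

Lemma is_derive_integral (g : R -> R) (a b x : R) :
  (forall t, a <= t <= b -> {for t, continuous g}) -> a < x < b ->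
  is_derive x 1 (fun s => \int[mu]_(t in `[a, s]) g t) (g x).
Proof.
move=> cg /andP[ax xb].
have cgx : {for x, continuous g} by apply: cg; rewrite !ltW.
have [dF EF] := continuous_FTC1_closed xb (integrable_segment cg) ax cgx.
by apply: DeriveDef; [exact: dF | rewrite -derive1E; exact: EF].
Qed.

Lemma integral_derive (F g : R -> R) (a b : R) : a < b ->
  (forall t, a <= t <= b -> {for t, continuous g}) ->
  (forall t, a <= t <= b -> is_derive t 1 F (g t)) ->
  \int[mu]_(t in `[a, b]) g t = F b - F a.
Proof.
move=> ab cg dF; rewrite /Rintegral.
rewrite (@continuous_FTC2 _ g F a b ab) //.
- apply: continuous_in_subspaceT => t; rewrite inE /= in_itv /= => tab; exact: cg.
- have cF t : a <= t <= b -> {for t, continuous F}.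
    move=> tab; have [dFt _] := dF t tab.
    by apply: differentiable_continuous; exact/derivable1_diffP.
  split.
  + by move=> t; rewrite in_itv /= => /andP[a1 a2]; have [] := dF t ltac:(by rewrite !ltW).
  + by apply: cvg_at_right_filter; apply: cF; rewrite lexx ltW.
  + by apply: cvg_at_left_filter; apply: cF; rewrite lexx ltW.
- move=> t; rewrite in_itv /= => /andP[a1 a2]; rewrite derive1E.
  by have [_ ->] := dF t ltac:(by rewrite !ltW).
Qed.

(** The Poincare lemma on a square: a primitive of the closed form
    [P dx + Q dy] is obtained by integrating along a horizontal and then a
    vertical segment from a corner of a concentric square. *)
Theorem closed_form_primitive (z0 : R2) (rho : R) (P Q : R2 -> R) : 0 < rho ->
  smooth_on [set y : R2 | `|y - z0| < rho] P ->
  smooth_on [set y : R2 | `|y - z0| < rho] Q ->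
  (forall y, `|y - z0| < rho -> 'D_(ey R) P y = 'D_(ex R) Q y) ->
  exists r : R, exists u : R2 -> R, [/\ 0 < r < rho,
    smooth_on [set y : R2 | `|y - z0| < r] u &
    forall y v, `|y - z0| < r -> 'D_v u y = v.1 * P y + v.2 * Q y].
Proof.
move=> rho0 sP sQ PQ.
have [r r0 rrho] : exists2 r, 0 < r & r < rho.
  by exists (rho / 2); rewrite ?divr_gt0 // gtr_pMr // invf_lt1 // ltr1n.
pose x0 := z0.1 - r; pose x1 := z0.1 + r; pose y0 := z0.2 - r; pose y1 := z0.2 + r.
have inU (x y : R) : x0 <= x <= x1 -> y0 <= y <= y1 -> `|(x, y) - z0| < rho.
  move=> xx yy; apply: le_lt_trans rrho; apply: norm_pair_le => /=.
    by rewrite ler_distl.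
  by rewrite ler_distl.
have cP := smooth_on_continuous sP; have cQ := smooth_on_continuous sQ.
have dP := smooth_onS sP; have dQ := smooth_onS sQ.
have cPy := smooth_on_continuous (smooth_on_derive (ey R) sP).
have cQx := smooth_on_continuous (smooth_on_derive (ex R) sQ).
have y00 : y0 <= y0 <= y1 by rewrite lexx /y0 /y1 lerD2l ge0_cp // ltW.
pose u (z : R2) : R := \int[mu]_(t in `[x0, z.1]) P (t, y0) +
                       \int[mu]_(t in `[y0, z.2]) Q (z.1, t).
have uy x y : x0 < x < x1 -> y0 < y < y1 -> is_derive y 1 (fun t => u (x, t)) (Q (x, y)).
  move=> xx yy.
  have D1 := is_derive_cst (\int[mu]_(t in `[x0, x]) P (t, y0)) y (1 : R).
  have D2 : is_derive y 1 (fun s => \int[mu]_(t in `[y0, s]) Q (x, t)) (Q (x, y)).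
    apply: (@is_derive_integral (fun t => Q (x, t)) y0 y1) => // t tt.
    apply: continuous_y; apply: cQ; apply: inU => //.
    by case/andP: xx => *; rewrite !ltW.
  by have := is_deriveD D1 D2; rewrite add0r.
have ux x y : x0 < x < x1 -> y0 < y < y1 -> is_derive x 1 (fun t => u (t, y)) (P (x, y)).
  move=> xx yy.
  have yy' t : y0 <= t <= y -> y0 <= t <= y1.
    by case/andP: yy => _ yy1 /andP[-> ty] /=; apply: le_trans ty (ltW yy1).
  have xx' : x0 <= x <= x1 by case/andP: xx => *; rewrite !ltW.
  have D1 : is_derive x 1 (fun s => \int[mu]_(t in `[x0, s]) P (t, y0)) (P (x, y0)).
    apply: (@is_derive_integral (fun t => P (t, y0)) x0 x1) => // t tt.
    by apply: continuous_x; apply: cP; exact: inU.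
  (* Differentiation under the integral sign needs a bound on the derivative; then
     [PQ] makes the integrand the derivative of [P] along the vertical segment. *)
  have [M M0 HM] : exists2 M, 0 <= M & forall a b, x0 <= a <= x1 -> y0 <= b <= y1 ->
      `|'D_(ex R) Q (a, b)| <= M.
    have [|||c _ cmax] := @compact_EVT_max R2 R (fun z => `|'D_(ex R) Q z|) [set y : R2 | `|y - z0| <= r].
    - by exists z0; rewrite /= subrr normr0 ltW.
    - exact: compact_box.
    - apply: continuous_in_subspaceT => z; rewrite inE /= => zr.
      apply: (@continuous_comp _ _ _ (fun z => 'D_(ex R) Q z) (@Num.norm R R)); last exact: norm_continuous.
      by apply: cQx; exact: le_lt_trans zr rrho.
    exists `|'D_(ex R) Q c| => // a b aa bb; apply: cmax; rewrite inE /=.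
    by apply: norm_pair_le => /=; rewrite ler_distl.
  pose f (a b : R) : R := Q (a, b).
  have df a b : x0 <= a <= x1 -> y0 <= b <= y1 -> is_derive a 1 (f^~ b) ('D_(ex R) Q (a, b)).
    by move=> aa bb; apply: is_derive_x; apply: dQ; exact: inU.
  have pf a b : x0 <= a <= x1 -> y0 <= b <= y1 -> partial1of2 f a b = 'D_(ex R) Q (a, b).
    by move=> aa bb; rewrite partial1of2E; have [_ ->] := df a b aa bb.
  have ooc a : `]x0, x1[%classic a -> x0 <= a <= x1.
    by rewrite /= in_itv /= => /andP[a1 a2]; rewrite !ltW.
  have occ b : `[y0, y]%classic b -> y0 <= b <= y1.
    by rewrite /= in_itv /= => bb; exact: yy'.
  have mB : measurable (`[y0, y]%classic : set R) by exact: measurable_itv.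
  have Ix : `]x0, x1[%classic x by rewrite /= in_itv.
  have H1 a : `]x0, x1[%classic a -> mu.-integrable `[y0, y] (EFin \o f a).
    move=> /ooc aa; apply: integrable_segment => t tt.
    by apply: continuous_y; apply: cQ; apply: inU => //; exact: yy'.
  have H2 a b : `]x0, x1[%classic a -> `[y0, y]%classic b -> derivable (f^~ b) a 1.
    by move=> /ooc aa /occ bb; have [] := df a b aa bb.
  have H3 : mu.-integrable `[y0, y] (EFin \o (fun=> M)).
    by apply: integrable_segment => t _; exact: cvg_cst.
  have H4 a b : `]x0, x1[%classic a -> `[y0, y]%classic b -> `|partial1of2 f a b| <= M.
    by move=> /ooc aa /occ bb; rewrite pf //; exact: HM.
  have dI := @derivable_under_integral R _ _ mu f _ mB x x0 x1 Ix H1 H2 (fun=> M) (fun=> M0) H3 H4.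
  have EI := @differentiation_under_integral R _ _ mu f _ mB x x0 x1 Ix H1 H2 (fun=> M) (fun=> M0) H3 H4.
  have D2 : is_derive x 1 (fun s => \int[mu]_(t in `[y0, y]) Q (s, t)) (P (x, y) - P (x, y0)).
    apply: DeriveDef; first exact: dI.
    rewrite -derive1E EI.
    transitivity (\int[mu]_(t in `[y0, y]) 'D_(ey R) P (x, t)).
      apply: eq_Rintegral => t; rewrite inE => /occ tt.
      by rewrite pf // PQ //; exact: inU.
    apply: (integral_derive (F := fun t => P (x, t))); first by case/andP: yy.
      by move=> t /yy' tt; apply: (@continuous_y (fun z => 'D_(ey R) P z)); apply: cPy; exact: inU.
    by move=> t /yy' tt; apply: (@is_derive_y P); apply: dP; exact: inU.
  by have := is_deriveD D1 D2; rewrite [P (x, y0) + _]addrC subrK.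
have open_in (z : R2) : `|z - z0| < r -> x0 < z.1 < x1 /\ y0 < z.2 < y1.
  by rewrite prod_normE gt_max /= !ltr_distl => /andP[].
have du (z : R2) : `|z - z0| < r ->
    differentiable u z /\ (forall v, 'D_v u z = v.1 * P z + v.2 * Q z).
  move=> zr; have e0 : 0 < r - `|z - z0| by rewrite subr_gt0.
  have near_in (y : R2) : `|y - z| < r - `|z - z0| -> `|y - z0| < r.
    by rewrite ltrBrDr => yz; rewrite -(subrKA z); exact: le_lt_trans (ler_normD _ _) yz.
  apply: (differentiable_partials e0).
  - by move=> [a b] /near_in /open_in [aa bb]; exact: ux.
  - by move=> [a b] /near_in /open_in [aa bb]; exact: uy.
  - by apply: cP; exact: lt_trans zr rrho.
  - by apply: cQ; exact: lt_trans zr rrho.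
exists r, u; split; first by rewrite r0.
  have sub : [set y : R2 | `|y - z0| < r] `<=` [set y : R2 | `|y - z0| < rho].
    by move=> y /= yr; exact: lt_trans yr rrho.
  have oS := @open_ball R z0 r.
  case=> [|n]; first by move=> z zr; apply: differentiable_continuous; have [] := du z zr.
  split=> [z zr|v]; first by have [] := du z zr.
  have S := smooth_onD oS (smooth_onM oS (smooth_on_cst _ v.1) (smooth_on_sub sub sP))
     (smooth_onM oS (smooth_on_cst _ v.2) (smooth_on_sub sub sQ)).
  by apply: smooth_upto_eq (S n) => // z zr; have [_ ->] := du z zr.
by move=> y v yr; have [_ ->] := du y yr.
Qed.

End ClosedForms.

(** * Functions and vector fields in charts *)

Section ChartCalculus.
Variables (R : realType) (M : surface R).
Local Notation R2 := (R * R)%type.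
Implicit Types (c d : chart R M) (p q : M) (v : R2).

Definition chart_image c : set R2 := cmap c @` dom c.

Lemma chart_image_cmap c q : dom c q -> chart_image c (cmap c q).
Proof. by move=> cq; exists q. Qed.

Lemma cinv_chart_image c z : chart_image c z -> dom c (cinv c z) /\ cmap c (cinv c z) = z.
Proof. by move=> [q cq <-]; rewrite (cmapK cq). Qed.

Lemma open_chart_image c : open (chart_image c).
Proof. exact: codom_open. Qed.

Lemma open_image c (A : set M) : open A -> open (cmap c @` (dom c `&` A)).
Proof.
move=> oA; rewrite openE => z [q [cq Aq] <-].
have N1 : \forall y \near cmap c q, chart_image c y.
  by apply: open_nbhs_nbhs; split; [exact: open_chart_image | exact: chart_image_cmap].
have N2 : \forall y \near cmap c q, A (cinv c y).
  have H : cinv c @ cmap c q --> cinv c (cmap c q) := cinv_cont cq.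
  by rewrite (cmapK cq) in H; apply: H; exact: open_nbhs_nbhs.
apply: (@filterS2 _ _ _ _ _ _ _ N1 N2) => y cy Ay.
by have [dy ey] := cinv_chart_image cy; exists (cinv c y).
Qed.

Lemma near_chart c d q : dom c q -> dom d q ->
  \forall z \near cmap c q, dom c (cinv c z) /\ dom d (cinv c z).
Proof.
move=> cq dq; have o := open_image (c := c) (dom_open d).
have H : (cmap c @` (dom c `&` dom d)) (cmap c q) by exists q.
apply: (open_near o H) => z [q' [cq' dq'] <-].
by rewrite cmapK.
Qed.

Lemma near_chart_image c q : dom c q -> \forall z \near cmap c q, chart_image c z.
Proof. by move=> cq; apply: (open_near (@open_chart_image c) (chart_image_cmap cq)). Qed.

Lemma transition_differentiable c d q : smooth_transition c d ->
  dom c q -> dom d q -> differentiable (cmap d \o cinv c) (cmap c q).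
Proof.
move=> cd cq dq; apply: (smooth_onS cd).
by exists q.
Qed.

(** The two coordinate expressions of [u] agree only near the point, where both
    charts are defined; differentiability is transported along with the
    derivative. *)
Lemma derive_transition (W : normedModType R) c d (u : M -> W) q v :
  smooth_transition c d -> dom c q -> dom d q ->
  differentiable (u \o cinv d) (cmap d q) ->
  differentiable (u \o cinv c) (cmap c q) /\
  'D_v (u \o cinv c) (cmap c q) =
  'D_('D_v (cmap d \o cinv c) (cmap c q)) (u \o cinv d) (cmap d q).
Proof.
move=> cd cq dq du; have dt := transition_differentiable cd cq dq.
have E : {near cmap c q, (u \o cinv d) \o (cmap d \o cinv c) =1 u \o cinv c}.
  apply: filterS (near_chart cq dq) => z [_ dz] /=.
  by rewrite cmapK.
have Ez : (cmap d \o cinv c) (cmap c q) = cmap d q by rewrite /= cmapK.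
have du' : differentiable (u \o cinv d) ((cmap d \o cinv c) (cmap c q)) by rewrite Ez.
split; first exact: near_eq_differentiable E (differentiable_comp dt du').
by rewrite -(near_eq_derive v E) (derive_comp v dt du') Ez.
Qed.

(** A tangent vector is given by its components in the preferred chart of its base
    point; [mder (cmap c) q v] are its components in [c]. *)
Lemma mderE (W : normedModType R) c (u : M -> W) q v :
  smooth_transition (chart_at q) c -> dom c q ->
  differentiable (u \o cinv c) (cmap c q) ->
  mder u q v = 'D_(mder (cmap c) q v) (u \o cinv c) (cmap c q).
Proof.
move=> qc cq du; have [_ E] := derive_transition v qc (chart_at_dom q) cq du.
exact: E.
Qed.

Lemma mder_chart p v : mder (cmap (chart_at p)) p v = v.
Proof.
rewrite /mder -[RHS](@derive_id R R2 (cmap (chart_at p) p) v).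
apply: near_eq_derive; apply: filterS (near_chart_image (chart_at_dom p)) => z /cinv_chart_image[_ /= ->].
by [].
Qed.

Lemma msmoothE (W : normedModType R) (u : M -> W) : msmooth u <->
  forall q, smooth_on (chart_image (chart_at q)) (u \o cinv (chart_at q)).
Proof.
by split=> H q; have := H q; rewrite /msmooth_on setTI.
Qed.

Lemma msmooth_differentiable (W : normedModType R) (u : M -> W) c q :
  msmooth u -> smooth_transition c (chart_at q) -> dom c q ->
  differentiable (u \o cinv c) (cmap c q).
Proof.
move=> /msmoothE su cc cq.
have [] // := derive_transition 0 cc cq (chart_at_dom q) _ (u := u).
by apply: (smooth_onS (su q)); apply: chart_image_cmap; exact: chart_at_dom.
Qed.

Lemma msmooth_differentiable_at (W : normedModType R) (u : M -> W) p q :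
  msmooth u -> dom (chart_at p) q ->
  differentiable (u \o cinv (chart_at p)) (cmap (chart_at p) q).
Proof. by move=> su pq; apply: msmooth_differentiable => //; exact: chart_at_smooth. Qed.

Lemma msmooth_differentiable0 (W : normedModType R) (u : M -> W) p :
  msmooth u -> differentiable (u \o cinv (chart_at p)) (cmap (chart_at p) p).
Proof. by move=> su; apply: msmooth_differentiable_at => //; exact: chart_at_dom. Qed.

Section Algebra.
Variable W : normedModType R.
Implicit Types (u w : M -> W) (a b : M -> R).

Lemma msmooth_cst (x : W) : msmooth (fun _ : M => x).
Proof. by apply/msmoothE => q; exact: smooth_on_cst. Qed.

Lemma msmoothD u w : msmooth u -> msmooth w -> msmooth (fun p => u p + w p).
Proof.
move=> /msmoothE su /msmoothE sw; apply/msmoothE => q.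
exact: (smooth_onD (@open_chart_image _) (su q) (sw q)).
Qed.

Lemma msmoothZ a u : msmooth a -> msmooth u -> msmooth (fun p => a p *: u p).
Proof.
move=> /msmoothE su /msmoothE sw; apply/msmoothE => q.
exact: (smooth_onZ (@open_chart_image _) (su q) (sw q)).
Qed.

Lemma msmoothN u : msmooth u -> msmooth (fun p => - u p).
Proof.
move=> /msmoothE su; apply/msmoothE => q.
exact: (smooth_onN (@open_chart_image _) (su q)).
Qed.

Lemma msmoothB u w : msmooth u -> msmooth w -> msmooth (fun p => u p - w p).
Proof. by move=> su sw; apply: msmoothD => //; exact: msmoothN. Qed.

Lemma mder_cst (x : W) p v : mder (fun _ : M => x) p v = 0.
Proof. exact: derive_cst. Qed.

Lemma mderD u w p v : msmooth u -> msmooth w ->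
  mder (fun q => u q + w q) p v = mder u p v + mder w p v.
Proof.
move=> su sw; have du := msmooth_differentiable0 p su; have dw := msmooth_differentiable0 p sw.
exact: (deriveD (diff_derivable du) (diff_derivable dw)).
Qed.

Lemma mderZ a u p v : msmooth a -> msmooth u ->
  mder (fun q => a q *: u q) p v = mder a p v *: u p + a p *: mder u p v.
Proof.
move=> sa su; have da := msmooth_differentiable0 p sa; have du := msmooth_differentiable0 p su.
have [_ E] := differentiable_scale da du; rewrite /mder.
have := E v; rewrite /comp !(cmapK (chart_at_dom p)).
by [].
Qed.

Lemma mder_linear u p (k : R) v v' : msmooth u ->
  mder u p (k *: v + v') = k *: mder u p v + mder u p v'.
Proof. by move=> su; apply: derive_linear; exact: msmooth_differentiable0. Qed.

Lemma mderDv u p v v' : msmooth u -> mder u p (v + v') = mder u p v + mder u p v'.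
Proof. by move=> su; rewrite -[v]scale1r mder_linear // !scale1r. Qed.

Lemma mder0v u p : mder u p 0 = 0.
Proof. exact: derive0. Qed.

Lemma mderZv u p (k : R) v : msmooth u -> mder u p (k *: v) = k *: mder u p v.
Proof. by move=> su; rewrite -[k *: v]addr0 mder_linear // mder0v addr0. Qed.

Lemma mderN u p v : msmooth u -> mder (fun q => - u q) p v = - mder u p v.
Proof.
move=> su; have du := msmooth_differentiable0 p su.
exact: (deriveN (diff_derivable du)).
Qed.

Lemma mderB u w p v : msmooth u -> msmooth w ->
  mder (fun q => u q - w q) p v = mder u p v - mder w p v.
Proof. by move=> su sw; rewrite mderD ?mderN //; exact: msmoothN. Qed.

End Algebra.

Lemma msmoothM (a b : M -> R) : msmooth a -> msmooth b -> msmooth (fun p => a p * b p).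
Proof. exact: msmoothZ. Qed.

Lemma mderM (a b : M -> R) p v : msmooth a -> msmooth b ->
  mder (fun q => a q * b q) p v = mder a p v * b p + a p * mder b p v.
Proof. exact: mderZ. Qed.

Lemma msmoothV (a : M -> R) : (forall p, a p != 0) -> msmooth a ->
  msmooth (fun p => (a p)^-1).
Proof.
move=> a0 /msmoothE sa; apply/msmoothE => q.
by apply: (smooth_onV (@open_chart_image _) _ (sa q)) => z _; exact: a0.
Qed.

Lemma msmooth_sqrt (a : M -> R) : (forall p, 0 < a p) -> msmooth a ->
  msmooth (fun p => Num.sqrt (a p)).
Proof.
move=> a0 /msmoothE sa; apply/msmoothE => q.
by apply: (smooth_on_sqrt (@open_chart_image _) _ (sa q)) => z _; exact: a0.
Qed.

Lemma msmooth_linear (W W' : normedModType R) (L : {linear W -> W'}) (u : M -> W) :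
  continuous L -> msmooth u -> msmooth (L \o u).
Proof.
move=> Lc /msmoothE su; apply/msmoothE => q.
exact: (smooth_on_linear_comp (@open_chart_image _) Lc (su q)).
Qed.

Lemma mder_linear_comp (W W' : normedModType R) (L : {linear W -> W'}) (u : M -> W) p v :
  continuous L -> msmooth u -> mder (L \o u) p v = L (mder u p v).
Proof.
move=> Lc su.
exact: (derive_linear_comp v Lc (msmooth_differentiable0 p su)).
Qed.

(** The derivative of [u] along the vector field [X]. *)
Definition der (W : normedModType R) (X : vfield M) (u : M -> W) : M -> W :=
  fun p => mder u p (X p).

(** [X] in the coordinates of the preferred chart of [p]. *)
Definition local_field p (X : vfield M) : R2 -> R2 :=
  components (chart_at p) X \o cinv (chart_at p).

Lemma local_field_smooth p (X : vfield M) : smooth_vfield X ->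
  smooth_on (chart_image (chart_at p)) (local_field p X).
Proof. by move=> sX; have := sX p p; rewrite setIid. Qed.

Lemma local_field_at p (X : vfield M) : local_field p X (cmap (chart_at p) p) = X p.
Proof. by rewrite /local_field /= (cmapK (chart_at_dom p)) /components mder_chart. Qed.

(** This is a change of charts: at the point of coordinates [z], both the vector
    and the derivative are defined through that point's own preferred chart. *)
Lemma der_local (W : normedModType R) p (X : vfield M) (u : M -> W) z :
  chart_image (chart_at p) z -> differentiable (u \o cinv (chart_at p)) z ->
  (der X u \o cinv (chart_at p)) z = 'D_(local_field p X z) (u \o cinv (chart_at p)) z.
Proof.
move=> cz du; have [dz ez] := cinv_chart_image cz.
by rewrite /= /der (mderE _ (chart_at_smooth _ p) dz) ?ez.
Qed.

Lemma msmooth_der (W : normedModType R) (X : vfield M) (u : M -> W) :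
  smooth_vfield X -> msmooth u -> msmooth (der X u).
Proof.
move=> sX su; have su' := (msmoothE u).1 su; apply/msmoothE => p.
have sX' := local_field_smooth p sX; have o := @open_chart_image (chart_at p).
have S := smooth_onD o
  (smooth_onZ o (smooth_on_fst o sX') (smooth_on_derive (ex R) (su' p)))
  (smooth_onZ o (smooth_on_snd o sX') (smooth_on_derive (ey R) (su' p))).
apply: (smooth_on_eq o _ S) => z cz; have du := smooth_onS (su' p) cz.
by rewrite (der_local X cz du) [RHS]derive_plane.
Qed.

(** The second derivatives of [u] cancel by symmetry, and the first ones combine to
    the coordinate formula for the bracket.  Smoothness of [u] is asked near [p]
    only, so that coordinate functions of other charts are allowed. *)
Lemma local_der_comm (X Y : vfield M) (u : M -> R) p (U : set R2) :
  smooth_vfield X -> smooth_vfield Y -> open U -> U (cmap (chart_at p) p) ->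
  U `<=` chart_image (chart_at p) -> smooth_on U (u \o cinv (chart_at p)) ->
  der X (der Y u) p - der Y (der X u) p = mder u p (bracket X Y p).
Proof.
move=> sX sY o cz Uc su'; set c := chart_at p; set z := cmap c p.
have second (A B : vfield M) : smooth_vfield B ->
    der A (der B u) p = 'D_('D_(A p) (local_field p B) z) (u \o cinv c) z
      + 'D_(A p) (fun y => 'D_(B p) (u \o cinv c) y) z.
  move=> sB; set b := local_field p B.
  have sb := smooth_on_sub Uc (local_field_smooth p sB) : smooth_on U b.
  have db1 := smooth_onS (smooth_on_fst o sb) cz.
  have db2 := smooth_onS (smooth_on_snd o sb) cz.
  have dux := smooth_onS (smooth_on_derive (ex R) su') cz.
  have duy := smooth_onS (smooth_on_derive (ey R) su') cz.
  have du := smooth_onS su'.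
  have db := smooth_onS sb cz.
  rewrite {1}/der /mder.
  have -> : 'D_(A p) (der B u \o cinv c) z =
     'D_(A p) (fun y => (b y).1 *: 'D_(ex R) (u \o cinv c) y + (b y).2 *: 'D_(ey R) (u \o cinv c) y) z.
    apply: near_eq_derive; apply: (open_near o cz) => y cy.
    have duy' := du y cy; by rewrite (der_local B (Uc y cy) duy') [LHS]derive_plane.
  have [d1 E1] := differentiable_scale db1 dux.
  have [d2 E2] := differentiable_scale db2 duy.
  rewrite (deriveD (diff_derivable d1) (diff_derivable d2)).
  have bz : b z = B p := local_field_at p B.
  have -> : 'D_(A p) (fun y => 'D_(B p) (u \o cinv c) y) z =
     (B p).1 *: 'D_(A p) (fun y => 'D_(ex R) (u \o cinv c) y) z +
     (B p).2 *: 'D_(A p) (fun y => 'D_(ey R) (u \o cinv c) y) z.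
    rewrite -(deriveZ (B p).1 (diff_derivable dux)) -(deriveZ (B p).2 (diff_derivable duy)).
    rewrite -deriveD; [|exact: derivableZ (diff_derivable dux)|exact: derivableZ (diff_derivable duy)].
    apply: near_eq_derive; apply: (open_near o cz) => y cy.
    by rewrite [LHS]derive_plane //; exact: du.
  rewrite [X in _ = X + _]derive_plane; last exact: du.
  by rewrite E1 E2 (derive_fst (A p) db) (derive_snd (A p) db) bz addrACA.
have S1 := second X Y sY; have S2 := second Y X sX.
have C := derive_comm (X p) (Y p) o cz su'.
have B : bracket X Y p = 'D_(X p) (local_field p Y) z - 'D_(Y p) (local_field p X) z by [].
have T (a a' b : R) : (a + b) - (a' + b) = a - a'.
  by rewrite opprD addrACA subrr addr0.
rewrite C in S2.
apply: etrans (congr2 (fun a b => a - b) S1 S2) _.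
apply: etrans (T _ _ _) _.
rewrite B /mder; set u' := u \o _.
have du := smooth_onS su' cz.
have L := derive_linear (-1) ('D_(Y p) (local_field p X) z) ('D_(X p) (local_field p Y) z) du.
by rewrite !scaleN1r ![- _ + _]addrC in L.
Qed.

Lemma der_comm (X Y : vfield M) (u : M -> R) p :
  smooth_vfield X -> smooth_vfield Y -> msmooth u ->
  der X (der Y u) p - der Y (der X u) p = mder u p (bracket X Y p).
Proof.
move=> sX sY /msmoothE su; apply: (local_der_comm sX sY (@open_chart_image _) _ _ (su p)) => //.
by apply: chart_image_cmap; exact: chart_at_dom.
Qed.

End ChartCalculus.

(** * Vector-valued functions and the ambient inner product *)

Section VectorValued.
Variables (R : realType) (M : surface R).
Local Notation R2 := (R * R)%type.
Local Notation R5 := 'rV[R]_5.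
Implicit Types (xi eta : M -> R5) (p q : M) (v : R2).

Lemma msmooth_sum (W : normedModType R) (I : Type) (s : seq I) (F : I -> M -> W) :
  (forall i, msmooth (F i)) -> msmooth (fun p => \sum_(i <- s) F i p).
Proof.
move=> sF; elim: s => [|i s IH].
  rewrite (_ : (fun p => _) = fun=> 0); first exact: msmooth_cst.
  by apply/funext => p; rewrite big_nil.
rewrite (_ : (fun p => _) = fun p => F i p + \sum_(j <- s) F j p).
  by apply: msmoothD.
by apply/funext => p; rewrite big_cons.
Qed.

Lemma mder_sum (W : normedModType R) (I : Type) (s : seq I) (F : I -> M -> W) p v :
  (forall i, msmooth (F i)) ->
  mder (fun q => \sum_(i <- s) F i q) p v = \sum_(i <- s) mder (F i) p v.
Proof.
move=> sF; elim: s => [|i s IH].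
  rewrite big_nil (_ : (fun p => _) = fun=> 0); first exact: mder_cst.
  by apply/funext => q; rewrite big_nil.
rewrite big_cons -IH -mderD //; last exact: msmooth_sum.
by congr (mder _ p v); apply/funext => q; rewrite big_cons.
Qed.

Definition coord (i : 'I_5) (x : R5) : R := x 0 i.

Lemma coord_is_linear i : linear (coord i).
Proof. by move=> a x y; rewrite /coord !mxE. Qed.
HB.instance Definition _ i := GRing.isLinear.Build R R5 R _ (coord i) (coord_is_linear i).

Lemma coordC i : continuous (coord i).
Proof. exact: coord_continuous. Qed.

Lemma msmooth_coord xi i : msmooth xi -> msmooth (fun q => xi q 0 i).
Proof. exact: (msmooth_linear (L := coord i : {linear R5 -> R}) (@coordC i)). Qed.

Lemma mder_coord xi i p v : msmooth xi ->
  mder (fun q => xi q 0 i) p v = mder xi p v 0 i.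
Proof. exact: (mder_linear_comp (L := coord i : {linear R5 -> R}) p v (@coordC i)). Qed.

(** Second derivatives of a vector-valued map commute up to the bracket,
    because those of its coordinates do. *)
Lemma der_comm_row (X Y : vfield M) xi p :
  smooth_vfield X -> smooth_vfield Y -> msmooth xi ->
  der X (der Y xi) p - der Y (der X xi) p = mder xi p (bracket X Y p).
Proof.
move=> sX sY sxi; apply/rowP => i; rewrite !mxE.
have second (A B : vfield M) : smooth_vfield A -> smooth_vfield B ->
    der A (der B xi) p 0 i = der A (der B (fun q => xi q 0 i)) p.
  move=> sA sB.
  have E : der B (fun q => xi q 0 i) = fun q => der B xi q 0 i.
    by apply/funext => q; exact: mder_coord.
  rewrite E; exact: (esym (mder_coord i p (A p) (msmooth_der sB sxi))).
have E := mder_coord i p (bracket X Y p) sxi.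
have C := der_comm p sX sY (msmooth_coord i sxi).
exact: etrans (congr2 (fun a b => a - b) (second X Y sX sY) (second Y X sY sX)) (etrans C E).
Qed.

End VectorValued.

Section InnerProduct.
Variables (R : realType) (eps : R).
Local Notation R5 := 'rV[R]_5.
Implicit Types (x y z : R5).
Local Notation ip := (ip eps).

Lemma ipC x y : ip x y = ip y x.
Proof. by apply: eq_bigr => i _; rewrite mulrAC. Qed.

Lemma ipDl x y z : ip (x + y) z = ip x z + ip y z.
Proof. by rewrite -big_split; apply: eq_bigr => i _; rewrite mxE /= mulrDr mulrDl. Qed.

Lemma ipZl a x z : ip (a *: x) z = a * ip x z.
Proof. by rewrite [RHS]mulr_sumr; apply: eq_bigr => i _; rewrite mxE; ring. Qed.

Lemma ipDr x y z : ip z (x + y) = ip z x + ip z y.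
Proof. by rewrite ipC ipDl !(ipC _ z). Qed.

Lemma ipZr a x z : ip z (a *: x) = a * ip z x.
Proof. by rewrite ipC ipZl ipC. Qed.

Lemma ipNl x z : ip (- x) z = - ip x z.
Proof. by rewrite -scaleN1r ipZl mulN1r. Qed.

Lemma ipNr x z : ip z (- x) = - ip z x.
Proof. by rewrite ipC ipNl ipC. Qed.

Lemma ip0l x : ip 0 x = 0.
Proof. by rewrite -(scale0r x) ipZl mul0r. Qed.

Lemma ip0r x : ip x 0 = 0.
Proof. by rewrite ipC ip0l. Qed.

Definition ipE := (ipDl, ipDr, ipNl, ipNr, ipZl, ipZr, ip0l, ip0r).

Variable M : surface R.
Implicit Types (xi eta : M -> R5).

Lemma msmooth_ip xi eta : msmooth xi -> msmooth eta ->
  msmooth (fun q => ip (xi q) (eta q)).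
Proof.
move=> sxi seta; apply: msmooth_sum => i.
apply: msmoothM; last exact: msmooth_coord.
by apply: msmoothM; [exact: msmooth_cst | exact: msmooth_coord].
Qed.

Lemma mder_ip xi eta p v : msmooth xi -> msmooth eta ->
  mder (fun q => ip (xi q) (eta q)) p v = ip (mder xi p v) (eta p) + ip (xi p) (mder eta p v).
Proof.
move=> sxi seta.
have sc (k : R) : msmooth (fun _ : M => k) by exact: msmooth_cst.
have sx i := msmooth_coord i sxi; have se i := msmooth_coord i seta.
have sk (k : R) i : msmooth (fun q => k * xi q 0 i) := msmoothM (sc k) (sx i).
rewrite mder_sum; last by move=> i; exact: msmoothM (sk _ i) (se i).
rewrite -big_split; apply: eq_bigr => i _ /=.
rewrite (mderM p v (sk _ i) (se i)) (mderM p v (sc _) (sx i)) mder_cst.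
by rewrite mul0r add0r !mder_coord.
Qed.

End InnerProduct.

(** * Linear algebra of the space form *)

Section SpaceFormAlgebra.
Variables (R : realType) (eps : R).
Local Notation R5 := 'rV[R]_5.
Local Notation ip := (ip eps).
Implicit Types (x v w : R5).

(** The product separated into its spatial part and the last, possibly timelike,
    coordinate. *)
Lemma ip_split x y : ip x y =
  \sum_(i < 4) x 0 (widen_ord (leqnSn 4) i) * y 0 (widen_ord (leqnSn 4) i)
  + (if eps < 0 then -1 else 1) * x 0 ord_max * y 0 ord_max.
Proof.
rewrite /Defs.ip big_ord_recr /=; congr (_ + _).
  apply: eq_bigr => i _; rewrite (_ : (_ == ord_max) = false) ?andbF ?mul1r //.
  by apply/negbTE; rewrite -val_eqE /= ltn_eqF.
by rewrite eqxx andbT.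
Qed.

Lemma cauchy_schwarz n (a b : 'I_n -> R) :
  (\sum_i a i * b i) ^+ 2 <= (\sum_i a i ^+ 2) * (\sum_i b i ^+ 2).
Proof.
have [B0|B0] := eqVneq (\sum_i b i ^+ 2) 0.
  have b0 i : b i = 0.
    by apply/eqP; rewrite -sqrf_eq0; move/eqP: B0; rewrite psumr_eq0 => [/allP/(_ i)|? _]; rewrite ?mem_index_enum ?sqr_ge0 //; apply.
  by rewrite B0 mulr0 big1 ?expr0n // => i _; rewrite b0 mulr0.
have Bp : 0 < \sum_i b i ^+ 2 by rewrite lt_def B0 sumr_ge0 // => i _; exact: sqr_ge0.
set A := \sum_i a i ^+ 2; set B := \sum_i b i ^+ 2 in Bp *; set C := \sum_i a i * b i.
have : 0 <= \sum_i (B * a i - C * b i) ^+ 2 by rewrite sumr_ge0 // => i _; exact: sqr_ge0.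
have -> : \sum_i (B * a i - C * b i) ^+ 2 = B * (A * B - C ^+ 2).
  rewrite (eq_bigr (fun i => B ^+ 2 * a i ^+ 2 + ((- (2 * B * C)) * (a i * b i) + C ^+ 2 * b i ^+ 2))).
    by rewrite !big_split /= -!mulr_sumr -/A -/B -/C; ring.
  by move=> i _; ring.
by rewrite pmulr_rge0 // subr_ge0.
Qed.

(** Only the hyperboloid is delicate.  Its position vector [x] is timelike: the
    spatial part is shorter than the last coordinate.  By orthogonality to [x] and
    Cauchy--Schwarz, the last coordinate of [v] is then shorter than the spatial
    part of [v]. *)
Lemma tangent_pos x v : space_form eps x -> space_form_tangent eps x v -> v != 0 ->
  0 < ip v v.
Proof.
move=> Sx Tv v0; rewrite ip_split.
set V := \sum_i _; have V0 : 0 <= V by apply: sumr_ge0 => i _; rewrite -expr2 sqr_ge0.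
have spatial : V = 0 -> v 0 ord_max = 0 -> v = 0.
  move=> VZ v4; apply/rowP => i; rewrite [RHS]mxE.
  have [->//|ni] := eqVneq i ord_max.
  have i4 : (i < 4)%N by have := ltn_ord i; rewrite ltnS leq_eqVlt => /orP[/eqP E|//]; case/eqP: ni; exact: val_inj.
  have H (j : 'I_4) : v 0 (widen_ord (leqnSn 4) j) = 0.
    have S : forall k : 'I_4, true -> 0 <= v 0 (widen_ord (leqnSn 4) k) * v 0 (widen_ord (leqnSn 4) k).
      by move=> k _; rewrite -expr2 sqr_ge0.
    have := psumr_eq0P S VZ (i:=j) isT => /eqP; rewrite -expr2 sqrf_eq0; exact: eqP.
  by rewrite -(H (Ordinal i4)); congr (v _ _); exact: val_inj.
have [en|ep] := ltP eps 0; last first.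
  rewrite mul1r lt_def addr_ge0 ?andbT //; last by rewrite -expr2 sqr_ge0.
  apply: contra_neq v0 => E; have := sqr_ge0 (v 0 ord_max); rewrite expr2 => v4.
  have VZ : V = 0 by lra.
  apply: spatial => //; apply/eqP; rewrite -sqrf_eq0 expr2; apply/eqP; lra.
move: Sx Tv; rewrite /space_form /space_form_tangent /= (lt_eqF en) => -[xx x4] xv.
have {}x4 := x4 en.
rewrite !ip_split en in xx xv.
move: xx xv; rewrite -/V.
set X := \sum_i _; set C := \sum_i _ => xx xv.
have CS : C ^+ 2 <= X * V.
  exact: (@cauchy_schwarz 4 (fun i => x 0 (widen_ord (leqnSn 4) i)) (fun i => v 0 (widen_ord (leqnSn 4) i))).
have ei : eps^-1 < 0 by rewrite invr_lt0.
have [VZ|VN] := eqVneq V 0.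
  have : C = 0 by apply/eqP; rewrite -sqrf_eq0 eq_le sqr_ge0 andbT; move: CS; rewrite VZ mulr0.
  move=> C0; rewrite C0 in xv.
  have v4 : v 0 ord_max = 0.
    have : x 0 ord_max * v 0 ord_max = 0 by lra.
    by move/eqP; rewrite mulf_eq0 (gt_eqF x4) /= => /eqP.
  by case/eqP: v0; exact: spatial.
have Vp : 0 < V by rewrite lt_def VN.
set a := x 0 ord_max in xx xv x4; set b := v 0 ord_max in xv *.
have Cab : C = a * b by lra.
rewrite Cab in CS.
have XE : X = a ^+ 2 + eps^-1 by rewrite expr2; lra.
have : a ^+ 2 * (V - b ^+ 2) > 0.
  have : X * V < a ^+ 2 * V by rewrite ltr_pM2r // XE; lra.
  rewrite exprMn in CS; lra.
rewrite pmulr_rgt0 ?exprn_gt0 // expr2; lra.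
Qed.

(** Five orthogonal vectors of nonzero square are the rows of an invertible matrix,
    as the coefficients of a combination are recovered by pairing; so [w] is such a
    combination, with zero coefficients. *)
Lemma orthogonal_frame_eq0 (u : 'I_5 -> R5) (c : 'I_5 -> R) w :
  (forall i j, ip (u i) (u j) = if i == j then c i else 0) ->
  (forall i, c i != 0) -> (forall i, ip w (u i) = 0) -> w = 0.
Proof.
move=> uu c0 wu; pose F : 'M[R]_5 := \matrix_(i, j) u i 0 j.
have comb (a : R5) : a *m F = \sum_i a 0 i *: u i.
  by apply/rowP => j; rewrite mxE summxE; apply: eq_bigr => i _; rewrite !mxE.
have ip_sum (I : finType) (a : I -> R) (t : I -> R5) y : ip (\sum_i a i *: t i) y = \sum_i a i * ip (t i) y.
  elim/big_rec2: _ => [|i y1 y2 _ E]; first exact: ip0l.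
  by rewrite ipDl ipZl E.
have ipc (a : R5) j : ip (a *m F) (u j) = a 0 j * c j.
  rewrite comb ip_sum (bigD1 j) //= uu eqxx big1 ?addr0 // => i ij.
  by rewrite uu (negbTE ij) mulr0.
have Ffree : row_free F.
  apply: inj_row_free => a aF; apply/rowP => j; have := ipc a j.
  by rewrite aF ip0l mxE => /esym/eqP; rewrite mulf_eq0 (negbTE (c0 j)) orbF => /eqP.
have Ffull : row_full F by rewrite row_full_unit -row_free_unit.
have /submxP[a wa] : (w <= F)%MS by exact: submx_full.
rewrite wa (_ : a = 0) ?mul0mx //; apply/rowP => j; rewrite [RHS]mxE.
by have := ipc a j; rewrite -wa wu => /esym/eqP; rewrite mulf_eq0 (negbTE (c0 j)) orbF => /eqP.
Qed.

(** The basis of the tangent space is completed by the position vector, or by the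
    last vector of the canonical basis when [eps = 0]; a tangent vector has no
    component along it. *)
Lemma frame_expansion x (t1 t2 t3 t4 w : R5) : space_form eps x ->
  space_form_tangent eps x t1 -> space_form_tangent eps x t2 ->
  space_form_tangent eps x t3 -> space_form_tangent eps x t4 ->
  ip t1 t1 = 1 -> ip t2 t2 = 1 -> ip t3 t3 = 1 -> ip t4 t4 = 1 ->
  ip t1 t2 = 0 -> ip t1 t3 = 0 -> ip t1 t4 = 0 -> ip t2 t3 = 0 -> ip t2 t4 = 0 ->
  ip t3 t4 = 0 -> space_form_tangent eps x w ->
  w = ip w t1 *: t1 + ip w t2 *: t2 + ip w t3 *: t3 + ip w t4 *: t4.
Proof.
move=> Sx T1 T2 T3 T4 o11 o22 o33 o44 o12 o13 o14 o23 o24 o34 Tw.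
pose nu : R5 := if eps == 0 then delta_mx 0 ord_max else x.
have nuE y : space_form_tangent eps x y -> ip nu y = 0.
  rewrite /space_form_tangent /nu /=; case: ifP => // _ y4.
  rewrite /Defs.ip big1 // => i _; rewrite !mxE eqxx /=.
  by have [->|_] := eqVneq i ord_max; [rewrite y4 mulr0 | rewrite mulr0 mul0r].
have [m m0 nunu] : exists2 m, m != 0 & ip nu nu = m.
  exists (ip nu nu) => //; move: Sx; rewrite /nu /space_form /=; case: ifP => [/eqP e0 _|e0 [-> _]].
    rewrite /Defs.ip (bigD1 ord_max) //= big1 ?addr0 => [|i ni].
      by rewrite !mxE !eqxx e0 ltxx /= !mulr1 oner_neq0.
    by rewrite !mxE (negbTE ni) mulr0.
  by rewrite invr_eq0 e0.
apply/eqP; rewrite -subr_eq0; apply/eqP.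
pose u (i : 'I_5) : R5 := nth nu [:: t1; t2; t3; t4] i.
pose c (i : 'I_5) : R := nth m [:: 1; 1; 1; 1] i.
have [n1 n2 n3 n4 nw] := And5 (nuE _ T1) (nuE _ T2) (nuE _ T3) (nuE _ T4) (nuE _ Tw).
apply: (@orthogonal_frame_eq0 u c).
- move=> [[|[|[|[|[|//]]]]] i5] [[|[|[|[|[|//]]]]] j5]; rewrite /u /c /= ?nunu //=; rewrite ?(ipC _ t2 t1) ?(ipC _ t3 t1) ?(ipC _ t4 t1) ?(ipC _ t3 t2) ?(ipC _ t4 t2) ?(ipC _ t4 t3) ?o11 ?o22 ?o33 ?o44 ?o12 ?o13 ?o14 ?o23 ?o24 ?o34 //;
    first [by rewrite ipC ?n1 ?n2 ?n3 ?n4 | by rewrite ?n1 ?n2 ?n3 ?n4].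
- by move=> [[|[|[|[|[|//]]]]] i5]; rewrite /c /= ?oner_neq0.
- move=> [[|[|[|[|[|//]]]]] i5]; rewrite /u /= !ipE.
  + by rewrite o11 (ipC _ t2) o12 (ipC _ t3) o13 (ipC _ t4) o14; ring.
  + by rewrite o22 o12 (ipC _ t3) o23 (ipC _ t4) o24; ring.
  + by rewrite o33 o13 o23 (ipC _ t4) o34; ring.
  + by rewrite o44 o14 o24 o34; ring.
  + by rewrite !(ipC _ _ nu) n1 n2 n3 n4 nw; ring.
Qed.

End SpaceFormAlgebra.

(** * The equations satisfied along the frame *)

(** The structure equations of a surface with flat normal bundle, as equations
    between functions differentiated along the principal frame. *)
Record structure_equations (R : realType) (eps : R) (M : surface R) (E1 E2 : vfield M)
  (f k1 k2 al a1 a2 b1 b2 : M -> R) : Prop := StructureEquations {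
  se_field1 : smooth_vfield E1;
  se_field2 : smooth_vfield E2;
  se_f : msmooth f; se_k1 : msmooth k1; se_k2 : msmooth k2; se_al : msmooth al;
  se_a1 : msmooth a1; se_a2 : msmooth a2; se_b1 : msmooth b1; se_b2 : msmooth b2;
  se_f0 : forall p, 0 < f p;
  se_al0 : forall p, al p != 0;
  se_k12 : forall p, k1 p != k2 p;
  se_trace : forall p, k1 p + k2 p = 2 * f p;
  se_bracket : forall p, bracket E1 E2 p = a1 p *: E1 p + a2 p *: E2 p;
  se_codazzi : forall p,
    [/\ der E2 k1 p = a1 p * (k2 p - k1 p) + al p * b2 p,
        der E2 al p = - (2 * a1 p * al p) - k1 p * b2 p,
        der E1 k2 p = a2 p * (k2 p - k1 p) - al p * b1 p &
        der E1 al p = 2 * al p * a2 p + k2 p * b1 p];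
  se_gauss : forall p, der E1 a2 p - der E2 a1 p
    = eps + k1 p * k2 p - al p ^+ 2 + a1 p ^+ 2 + a2 p ^+ 2;
  se_ricci : forall p, der E1 b2 p - der E2 b1 p = a1 p * b1 p + a2 p * b2 p
}.

Section FrameEquations.
Variables (R : realType) (eps : R) (M : surface R) (E1 E2 : vfield M)
  (f k1 k2 al a1 a2 b1 b2 : M -> R).
Local Notation D1 := (der E1).
Local Notation D2 := (der E2).

(** The biharmonic equation in the frame: the tangential part along [E1] and
    [E2], then the normal part along [E3] and [E4]. *)
Definition frame_biharmonic p : Prop :=
  [/\ (f p + k1 p) * D1 f p + f p * al p * b1 p = 0,
      (f p + k2 p) * D2 f p - f p * al p * b2 p = 0,
      D1 (D1 f) p + D2 (D2 f) p + a1 p * D2 f p - a2 p * D1 f p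
      - f p * (b1 p ^+ 2 + b2 p ^+ 2 + k1 p ^+ 2 + k2 p ^+ 2 - 2 * eps) = 0 &
      2 * D1 f p * b1 p + 2 * D2 f p * b2 p + f p * D1 b1 p + f p * D2 b2 p
      + a1 p * f p * b2 p - a2 p * f p * b1 p - f p * al p * (k1 p - k2 p) = 0].

(** The system as a relation between numbers, so that it can be read both on the
    surface and, in adapted coordinates, on functions of [s]. *)
Definition ode_relations (da2 df dal dk2 ddf db1 F K1 K2 AL A2 B1 : R) : Prop :=
  [/\ da2 = eps + K2 * (2 * F - K2) - AL ^+ 2 + A2 ^+ 2,
      (3 * F - K2) * df = - (F * AL * B1),
      dal = 2 * AL * A2 + K2 * B1,
      dk2 = 2 * A2 * (K2 - F) - AL * B1 &
      ddf = A2 * df + F * (B1 ^+ 2 + K1 ^+ 2 + K2 ^+ 2 - 2 * eps) /\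
      db1 = - (2 * B1 / F) * df + A2 * B1 - AL * (K2 - K1)].

Definition frame_ode p : Prop :=
  ode_relations (D1 a2 p) (D1 f p) (D1 al p) (D1 k2 p) (D1 (D1 f) p) (D1 b1 p)
    (f p) (k1 p) (k2 p) (al p) (a2 p) (b1 p).

End FrameEquations.

(** * The moving frame *)

Section MovingFrame.
Variables (R : realType) (eps : R) (M : surface R) (phi : M -> 'rV[R]_5)
  (nab : connection M) (E1 E2 : vfield M) (E4 : M -> 'rV[R]_5).
Hypotheses (imm : immersion eps phi) (LC : levi_civita (metric eps phi) nab)
  (frame : adapted_frame eps phi nab E1 E2 E4)
  (ncmc : non_CMC eps phi nab E1 E2).
Local Notation R2 := (R * R)%type.
Local Notation R5 := 'rV[R]_5.
Local Notation ip := (ip eps).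
Local Notation g := (metric eps phi).
Local Notation D1 := (der E1).
Local Notation D2 := (der E2).
Local Notation e1 := (D1 phi).
Local Notation e2 := (D2 phi).
Local Notation f := (mean_norm eps phi nab E1 E2).
Local Notation H := (mean_curv eps phi nab E1 E2).
Local Notation n3 := (E3 eps phi nab E1 E2).
Local Notation a1 := (a1 eps phi nab E1 E2).
Local Notation a2 := (a2 eps phi nab E1 E2).
Local Notation tangentN p := (space_form_tangent eps (phi p)).

Let sphi : msmooth phi. Proof. by case: imm. Qed.
Let phiN p : space_form eps (phi p). Proof. by case: imm. Qed.
Let sE1 : smooth_vfield E1. Proof. by case: (af_tangent frame). Qed.
Let sE2 : smooth_vfield E2. Proof. by case: (af_tangent frame). Qed.
Let se1 : msmooth e1. Proof. exact: msmooth_der. Qed.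
Let se2 : msmooth e2. Proof. exact: msmooth_der. Qed.
Let e11 p : ip (e1 p) (e1 p) = 1.
Proof. case: (af_tangent frame) => _ _ /(_ p)[h _ _]; exact: h. Qed.
Let e22 p : ip (e2 p) (e2 p) = 1.
Proof. case: (af_tangent frame) => _ _ /(_ p)[_ h _]; exact: h. Qed.
Let e12 p : ip (e1 p) (e2 p) = 0.
Proof. case: (af_tangent frame) => _ _ /(_ p)[_ _ h]; exact: h. Qed.

Lemma mder_ip_cst (xi eta : M -> R5) c p v : msmooth xi -> msmooth eta ->
  (forall q, ip (xi q) (eta q) = c) ->
  ip (mder xi p v) (eta p) = - ip (xi p) (mder eta p v).
Proof.
move=> sx se xc; apply/eqP; rewrite -subr_eq0 opprK -mder_ip //.
by rewrite (_ : (fun q => _) = fun=> c) ?mder_cst //; apply/funext.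
Qed.

Lemma tangentN_dphi p v : tangentN p (mder phi p v).
Proof.
rewrite /space_form_tangent /=; case: ifP => [/eqP e0|e0].
  rewrite -mder_coord // (_ : (fun q => _) = fun=> 0) ?mder_cst //.
  by apply/funext => q; have := phiN q; rewrite /space_form /= e0 eqxx.
have E q : ip (phi q) (phi q) = eps^-1.
  by have := phiN q; rewrite /space_form /= e0 => -[].
have := mder_ip_cst p v sphi sphi E; rewrite ipC => /eqP.
by rewrite -addr_eq0 -mulr2n mulrn_eq0 /= => /eqP.
Qed.

Lemma tangentN_linear p a (x y : R5) : tangentN p x -> tangentN p y -> tangentN p (a *: x + y).
Proof.
rewrite /space_form_tangent /=; case: ifP => _.
  by rewrite !mxE => -> ->; rewrite mulr0 addr0.
by rewrite !ipE => -> ->; rewrite mulr0 addr0.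
Qed.

Lemma tangentND p (x y : R5) : tangentN p x -> tangentN p y -> tangentN p (x + y).
Proof. by move=> Tx Ty; rewrite -[x]scale1r; exact: tangentN_linear. Qed.

Lemma tangentN0 p : tangentN p 0.
Proof. by rewrite /space_form_tangent /=; case: ifP => _; rewrite ?mxE ?ip0r. Qed.

Lemma tangentNZ p a (x : R5) : tangentN p x -> tangentN p (a *: x).
Proof. by move=> Tx; rewrite -[a *: x]addr0; apply: tangentN_linear => //; exact: tangentN0. Qed.

(** The position vector is orthogonal to the tangent space of the space form;
    for [eps = 0] it only ever occurs with the coefficient [eps]. *)
Lemma eps_phi p (x : R5) : tangentN p x -> eps * ip (phi p) x = 0.
Proof.
by rewrite /space_form_tangent /=; case: ifP => [/eqP -> _|_ ->]; rewrite ?mul0r ?mulr0.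
Qed.

Lemma tangentN_pb_conn (xi : M -> R5) p v : msmooth xi -> (forall q, tangentN q (xi q)) ->
  tangentN p (pb_conn eps phi xi p v).
Proof.
move=> sxi Txi; rewrite /space_form_tangent /pb_conn /=; case: ifP => [/eqP e0|e0].
  rewrite mxE -mder_coord // (_ : (fun q => _) = fun=> 0); last first.
    by apply/funext => q; have := Txi q; rewrite /space_form_tangent /= e0 eqxx.
  by rewrite mder_cst !mxE e0 !mul0r addr0.
have E q : ip (phi q) (xi q) = 0 by have := Txi q; rewrite /space_form_tangent /= e0.
have PP : ip (phi p) (phi p) = eps^-1 by have := phiN p; rewrite /space_form /= e0 => -[].
rewrite !ipE PP mulrAC divff ?e0 // mul1r /dphi (mder_ip_cst p v sphi sxi E).
by rewrite subrr.
Qed.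

Lemma metricC p v w : g p v w = g p w v.
Proof. exact: ipC. Qed.

Lemma metric_linear p a v v' w : g p (a *: v + v') w = a * g p v w + g p v' w.
Proof. by rewrite /metric /dphi mder_linear // !ipE. Qed.

Lemma metric0 p w : g p 0 w = 0.
Proof. by rewrite /metric /dphi mder0v ip0l. Qed.

Lemma metric_comb p (x y : R) : g p (x *: E1 p + y *: E2 p) (E1 p) = x /\
  g p (x *: E1 p + y *: E2 p) (E2 p) = y.
Proof.
have g11 : g p (E1 p) (E1 p) = 1 := e11 p.
have g22 : g p (E2 p) (E2 p) = 1 := e22 p.
have g12 : g p (E1 p) (E2 p) = 0 := e12 p.
split; rewrite metric_linear -[y *: E2 p]addr0 metric_linear metric0.
  by rewrite g11 (metricC _ (E2 p)) g12; ring.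
by rewrite g12 g22; ring.
Qed.

(** Orthonormality is expressed by the pulled-back metric; here it is turned into
    linear independence of the coordinate vectors. *)
Lemma frame_det p : det2 (E1 p) (E2 p) != 0.
Proof.
have indep x y : x *: E1 p + y *: E2 p = 0 -> x = 0 /\ y = 0.
  move=> E; have [h1 h2] := metric_comb p x y.
  by split; [rewrite -h1 E metric0|rewrite -h2 E metric0].
apply/eqP => d0; suff /indep[/eqP] : 1 *: E1 p + 0 *: E2 p = 0 by rewrite oner_eq0.
have i1 := indep (E2 p).2 (- (E1 p).2); have i2 := indep (E2 p).1 (- (E1 p).1).
move: d0 i1 i2; move: (E1 p) (E2 p) => [a b] [c d]; rewrite /det2 /= => d0 i1 i2.
have [_ /eqP nb] : d = 0 /\ - b = 0.
  apply: i1; apply: injective_projections; rewrite /= /GRing.scale /=; last by ring.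
  by rewrite -d0; ring.
have [_ /eqP na] : c = 0 /\ - a = 0.
  apply: i2; apply: injective_projections; rewrite /= /GRing.scale /=; first by ring.
  by rewrite -[RHS]oppr0 -d0; ring.
move: na nb; rewrite !oppr_eq0 => /eqP -> /eqP ->.
by apply: injective_projections; rewrite /= /GRing.scale /= mulr0 mul0r addr0.
Qed.

Lemma frame_expand p (v : R2) : v = g p v (E1 p) *: E1 p + g p v (E2 p) *: E2 p.
Proof.
by have [x [y ->]] := det2_span v (frame_det p); have [-> ->] := metric_comb p x y.
Qed.

(** The connection is metric and the products of the frame fields are constant. *)
Lemma nab_ortho p v : [/\ g p (nab E1 p v) (E1 p) = 0, g p (nab E2 p v) (E2 p) = 0
  & g p (nab E2 p v) (E1 p) = - g p (nab E1 p v) (E2 p)].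
Proof.
have K (X Y : vfield M) c : smooth_vfield X -> smooth_vfield Y -> (forall q, g q (X q) (Y q) = c) ->
    g p (nab X p v) (Y p) + g p (X p) (nab Y p v) = 0.
  move=> sX sY XY; rewrite -(lc_metric LC) // (_ : (fun q => _) = fun=> c) ?mder_cst //.
  exact/funext.
have K1 := K _ _ _ sE1 sE1 e11; have K2 := K _ _ _ sE2 sE2 e22; have K12 := K _ _ _ sE1 sE2 e12.
rewrite (metricC _ (E1 p)) -mulr2n in K1; rewrite (metricC _ (E2 p)) -mulr2n in K2.
rewrite (metricC _ (E1 p)) in K12.
split; [by apply/eqP; move/eqP: K1; rewrite mulrn_eq0|by apply/eqP; move/eqP: K2; rewrite mulrn_eq0|].
by apply/eqP; rewrite -addr_eq0 addrC; apply/eqP.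
Qed.

Lemma bracket_frame p : bracket E1 E2 p = a1 p *: E1 p + a2 p *: E2 p.
Proof.
rewrite (frame_expand p (bracket E1 E2 p)) -(lc_torsion_free LC sE1 sE2 p).
have B w : g p (nab E2 p (E1 p) - nab E1 p (E2 p)) w = g p (nab E2 p (E1 p)) w - g p (nab E1 p (E2 p)) w.
  by rewrite addrC -scaleN1r metric_linear mulN1r addrC.
have [x1 _ x2] := nab_ortho p (E2 p); have [_ y1 y2] := nab_ortho p (E1 p).
have F1 : g p (nab E2 p (E1 p) - nab E1 p (E2 p)) (E1 p) = a1 p.
  by rewrite (B (E1 p)) x1 subr0; exact: y2.
have F2 : g p (nab E2 p (E1 p) - nab E1 p (E2 p)) (E2 p) = a2 p.
  by rewrite (B (E2 p)) y1 sub0r -x2.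
by rewrite F1 F2.
Qed.

Lemma nab_frame p : [/\ nab E1 p (E1 p) = - a1 p *: E2 p, nab E2 p (E1 p) = a1 p *: E1 p,
  nab E1 p (E2 p) = - a2 p *: E2 p & nab E2 p (E2 p) = a2 p *: E1 p].
Proof.
have [x1 x2 x3] := nab_ortho p (E1 p); have [y1 y2 y3] := nab_ortho p (E2 p).
split; rewrite [LHS](frame_expand p) ?x1 ?x2 ?x3 ?y1 ?y2 ?scale0r ?add0r ?addr0 //.
  by rewrite /Defs.a1 opprK.
by rewrite /Defs.a2 y3 opprK.
Qed.

(** The Koszul formula for an orthonormal frame: metric compatibility and the
    torsion [x12 - x21] determine all tangential components. *)
Lemma torsion_coefficients (x11 x12 x21 x22 t1 t2 : R5) a b :
  x12 - x21 = a *: t1 + b *: t2 ->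
  ip t1 t1 = 1 -> ip t2 t2 = 1 -> ip t1 t2 = 0 ->
  ip x11 t1 = 0 -> ip x21 t1 = 0 -> ip x12 t2 = 0 -> ip x22 t2 = 0 ->
  ip x11 t2 = - ip t1 x12 -> ip x21 t2 = - ip t1 x22 ->
  [/\ ip x11 t1 = 0, ip x11 t2 = - a, ip x12 t1 = a & ip x12 t2 = 0] /\
  [/\ ip x21 t1 = 0, ip x21 t2 = - b, ip x22 t1 = b & ip x22 t2 = 0].
Proof.
move=> E t11 t22 t12 A1 A2 B1 B2 C1 C2.
have T1 : ip x12 t1 - ip x21 t1 = a.
  by rewrite -ipNl -ipDl E !ipE t11 (ipC _ t2) t12; ring.
have T2 : ip x12 t2 - ip x21 t2 = b.
  by rewrite -ipNl -ipDl E !ipE t22 t12; ring.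
rewrite (ipC _ t1) in C1; rewrite (ipC _ t1) in C2.
by split; split => //; lra.
Qed.

Lemma mder_unit (xi : M -> R5) p v : msmooth xi -> (forall q, ip (xi q) (xi q) = 1) ->
  ip (mder xi p v) (xi p) = 0.
Proof.
move=> sx xx; have := mder_ip_cst p v sx sx xx; rewrite [in RHS]ipC => /eqP.
by rewrite -addr_eq0 -mulr2n mulrn_eq0 /= => /eqP.
Qed.

Lemma torsion_frame p : D1 e2 p - D2 e1 p = a1 p *: e1 p + a2 p *: e2 p.
Proof. by rewrite (der_comm_row p sE1 sE2 sphi) bracket_frame mder_linear // mderZv. Qed.

Lemma der_frame p : [/\ ip (D1 e1 p) (e1 p) = 0, ip (D1 e1 p) (e2 p) = - a1 p,
   ip (D1 e2 p) (e1 p) = a1 p & ip (D1 e2 p) (e2 p) = 0] /\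
  [/\ ip (D2 e1 p) (e1 p) = 0, ip (D2 e1 p) (e2 p) = - a2 p,
   ip (D2 e2 p) (e1 p) = a2 p & ip (D2 e2 p) (e2 p) = 0].
Proof.
have A v := mder_unit p v se1 e11; have B v := mder_unit p v se2 e22.
have C v := mder_ip_cst p v se1 se2 e12.
exact: (torsion_coefficients (torsion_frame p) (e11 p) (e22 p) (e12 p) (A (E1 p)) (A (E2 p))
  (B (E1 p)) (B (E2 p)) (C (E1 p)) (C (E2 p))).
Qed.

Local Opaque mder Defs.ip.

Let Te1 p : tangentN p (e1 p). Proof. exact: tangentN_dphi. Qed.
Let Te2 p : tangentN p (e2 p). Proof. exact: tangentN_dphi. Qed.

Lemma a1_smooth : msmooth a1.
Proof.
have -> : a1 = fun q => - ip (D1 e1 q) (e2 q).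
  apply/funext => q; have [[_ E _ _] _] := der_frame q.
  exact: (esym (etrans (congr1 -%R E) (opprK _))).
exact: (msmoothN (msmooth_ip eps (msmooth_der sE1 se1) se2)).
Qed.

Lemma a2_smooth : msmooth a2.
Proof.
have -> : a2 = fun q => ip (D2 e2 q) (e1 q).
  apply/funext => q; have [_ [_ _ E _]] := der_frame q.
  exact: (esym E).
exact: (msmooth_ip eps (msmooth_der sE2 se2) se1).
Qed.

Local Notation sff := (sff eps phi nab).

Lemma sff11 p : sff E1 p (E1 p) = D1 e1 p + eps *: phi p + a1 p *: e2 p.
Proof.
rewrite /Defs.sff /pb_conn /dphi; have [-> _ _ _] := nab_frame p.
rewrite mderZv // scaleNr opprK.
have -> : ip (mder phi p (E1 p)) (mder phi p (E1 p)) = 1 := e11 p.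
by rewrite mulr1.
Qed.

Lemma sff22 p : sff E2 p (E2 p) = D2 e2 p + eps *: phi p - a2 p *: e1 p.
Proof.
rewrite /Defs.sff /pb_conn /dphi; have [_ _ _ ->] := nab_frame p.
rewrite mderZv //.
have -> : ip (mder phi p (E2 p)) (mder phi p (E2 p)) = 1 := e22 p.
by rewrite mulr1.
Qed.

Lemma mean_curvE p : H p = 2^-1 *: (D1 e1 p + eps *: phi p + a1 p *: e2 p
   + (D2 e2 p + eps *: phi p - a2 p *: e1 p)).
Proof. by rewrite /Defs.mean_curv sff11 sff22. Qed.

Lemma tension_mean_curv p : tension eps phi nab E1 E2 p = 2 *: H p.
Proof. by rewrite /Defs.mean_curv scalerA divff ?scale1r ?pnatr_eq0. Qed.

Let sD1e1 : msmooth (D1 e1). Proof. exact: msmooth_der. Qed.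
Let sD2e2 : msmooth (D2 e2). Proof. exact: msmooth_der. Qed.

Lemma mean_curv_smooth : msmooth H.
Proof.
have -> : H = fun p => 2^-1 *: (D1 e1 p + eps *: phi p + a1 p *: e2 p
   + (D2 e2 p + eps *: phi p - a2 p *: e1 p)) by apply/funext => p; exact: mean_curvE.
have sep : msmooth (fun p => eps *: phi p) := msmoothZ (msmooth_cst (M := M) eps) sphi.
have s1 := msmoothD (msmoothD sD1e1 sep) (msmoothZ a1_smooth se2).
have s2 := msmoothB (msmoothD sD2e2 sep) (msmoothZ a2_smooth se1).
exact: (msmoothZ (msmooth_cst (M := M) (2^-1 : R)) (msmoothD s1 s2)).
Qed.

(** The tangential components [a] and [b] of the second derivatives are exactly what
    the second fundamental form subtracts. *)
Lemma normal_part_ortho (x y t1 t2 ph : R5) a b :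
  ip t1 t1 = 1 -> ip t2 t2 = 1 -> ip t1 t2 = 0 -> eps * ip ph t1 = 0 -> eps * ip ph t2 = 0 ->
  ip x t1 = 0 -> ip x t2 = - a -> ip y t1 = b -> ip y t2 = 0 ->
  ip (2^-1 *: (x + eps *: ph + a *: t2 + (y + eps *: ph - b *: t1))) t1 = 0 /\
  ip (2^-1 *: (x + eps *: ph + a *: t2 + (y + eps *: ph - b *: t1))) t2 = 0.
Proof.
move=> t11 t22 t12 p1 p2 x1 x2 y1 y2; rewrite !ipE (ipC _ t2 t1).
by rewrite t11 t22 t12 p1 p2 x1 x2 y1 y2; split; ring.
Qed.

Lemma mean_curv_normal p : ip (H p) (e1 p) = 0 /\ ip (H p) (e2 p) = 0.
Proof.
rewrite mean_curvE; have [[x1 x2 _ _] [_ _ y1 y2]] := der_frame p.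
exact: (normal_part_ortho (e11 p) (e22 p) (e12 p) (eps_phi (Te1 p)) (eps_phi (Te2 p)) x1 x2 y1 y2).
Qed.

Lemma mean_curv_tangentN p : tangentN p (H p).
Proof.
have T1 : tangentN p (D1 e1 p + eps *: phi p).
  have := tangentN_pb_conn p (E1 p) se1 Te1; rewrite /pb_conn.
  by have -> : ip (dphi phi p (E1 p)) (e1 p) = 1 := e11 p; rewrite mulr1.
have T2 : tangentN p (D2 e2 p + eps *: phi p).
  have := tangentN_pb_conn p (E2 p) se2 Te2; rewrite /pb_conn.
  by have -> : ip (dphi phi p (E2 p)) (e2 p) = 1 := e22 p; rewrite mulr1.
rewrite mean_curvE; apply: tangentNZ; apply: tangentND; apply: tangentND => //.
  exact: tangentNZ.
by rewrite -scaleNr; exact: tangentNZ.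
Qed.

Lemma mean_curv_pos p : 0 < ip (H p) (H p).
Proof. by apply: tangent_pos (phiN p) (mean_curv_tangentN p) _; case: (ncmc p). Qed.

Lemma mean_norm_gt0 p : 0 < f p.
Proof. by rewrite /Defs.mean_norm sqrtr_gt0 mean_curv_pos. Qed.

Lemma mean_norm_sqr p : ip (H p) (H p) = f p ^+ 2.
Proof. by rewrite sqr_sqrtr // ltW // mean_curv_pos. Qed.

Lemma mean_norm_smooth : msmooth f.
Proof.
apply: msmooth_sqrt => [p|]; first exact: mean_curv_pos.
exact: msmooth_ip mean_curv_smooth mean_curv_smooth.
Qed.

Let f0 p : f p != 0. Proof. by rewrite gt_eqF // mean_norm_gt0. Qed.

Lemma n3_smooth : msmooth n3.
Proof. exact: (msmoothZ (msmoothV f0 mean_norm_smooth) mean_curv_smooth). Qed.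

Lemma mean_curv_n3 p : H p = f p *: n3 p.
Proof. by rewrite /E3 scalerA mulfV // scale1r. Qed.

Local Opaque Defs.mean_curv Defs.mean_norm.

Lemma n3_unit p : ip (n3 p) (n3 p) = 1.
Proof.
have E : ip (H p) (H p) = f p ^+ 2 by exact: mean_norm_sqr.
rewrite /E3 ipZl ipZr E; move: (f0 p); move: (f p) => r r0.
by field.
Qed.

Lemma n3_ortho p : ip (e1 p) (n3 p) = 0 /\ ip (e2 p) (n3 p) = 0.
Proof.
have [h1 h2] := mean_curv_normal p.
have h1' := etrans (ipC eps (e1 p) (H p)) h1.
have h2' := etrans (ipC eps (e2 p) (H p)) h2.
by split; rewrite /E3 ipZr ?h1' ?h2' mulr0.
Qed.

Lemma n3_tangentN p : tangentN p (n3 p).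
Proof. exact: tangentNZ (mean_curv_tangentN p). Qed.

Let sn4 : msmooth E4. Proof. exact: af_E4_smooth frame. Qed.
Let n4_tangentN p : tangentN p (E4 p).
Proof. by case: (af_E4_normal frame p). Qed.
Let n44 p : ip (E4 p) (E4 p) = 1. Proof. exact: af_E4_unit frame p. Qed.
Let n34 p : ip (n3 p) (E4 p) = 0. Proof. exact: af_E4_orth frame p. Qed.
Let n14 p : ip (e1 p) (E4 p) = 0.
Proof. by case: (af_E4_normal frame p) => _; apply. Qed.
Let n24 p : ip (e2 p) (E4 p) = 0.
Proof. by case: (af_E4_normal frame p) => _; apply. Qed.

(** Vectors are written in the moving frame [e1, e2, E3, E4] and the position
    vector, which always carries a factor [eps]. *)
Definition cmb c1 c2 c3 c4 c5 p : R5 :=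
  c1 *: e1 p + c2 *: e2 p + c3 *: n3 p + c4 *: E4 p + (eps * c5) *: phi p.

Lemma ip_combination (t1 t2 t3 t4 ph : R5) c1 c2 c3 c4 c5 :
  ip t1 t1 = 1 -> ip t2 t2 = 1 -> ip t3 t3 = 1 -> ip t4 t4 = 1 ->
  ip t1 t2 = 0 -> ip t1 t3 = 0 -> ip t1 t4 = 0 -> ip t2 t3 = 0 -> ip t2 t4 = 0 ->
  ip t3 t4 = 0 ->
  eps * ip ph t1 = 0 -> eps * ip ph t2 = 0 -> eps * ip ph t3 = 0 -> eps * ip ph t4 = 0 ->
  let x := c1 *: t1 + c2 *: t2 + c3 *: t3 + c4 *: t4 + (eps * c5) *: ph in
  [/\ ip x t1 = c1, ip x t2 = c2, ip x t3 = c3 & ip x t4 = c4].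
Proof.
move=> o11 o22 o33 o44 o12 o13 o14 o23 o24 o34 p1 p2 p3 p4 /=.
have Q t : eps * ip ph t = 0 -> eps * c5 * ip ph t = 0 by move=> h; rewrite mulrAC h mul0r.
rewrite !ipE (Q _ p1) (Q _ p2) (Q _ p3) (Q _ p4).
rewrite (ipC _ t2 t1) (ipC _ t3 t1) (ipC _ t3 t2) (ipC _ t4 t1) (ipC _ t4 t2) (ipC _ t4 t3).
by rewrite o11 o22 o33 o44 o12 o13 o14 o23 o24 o34; split; ring.
Qed.

Lemma ip_cmb c1 c2 c3 c4 c5 p (x := cmb c1 c2 c3 c4 c5 p) :
  [/\ ip x (e1 p) = c1, ip x (e2 p) = c2, ip x (n3 p) = c3 & ip x (E4 p) = c4].
Proof.
have [n13 n23] := n3_ortho p.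
exact: (ip_combination _ _ _ _ _ (e11 p) (e22 p) (n3_unit p) (n44 p) (e12 p) n13 (n14 p)
  n23 (n24 p) (n34 p) (eps_phi (Te1 p)) (eps_phi (Te2 p)) (eps_phi (n3_tangentN p))
  (eps_phi (n4_tangentN p))).
Qed.

Lemma cmb_inj c1 c2 c3 c4 c5 d1 d2 d3 d4 d5 p :
  cmb c1 c2 c3 c4 c5 p = cmb d1 d2 d3 d4 d5 p -> [/\ c1 = d1, c2 = d2, c3 = d3 & c4 = d4].
Proof.
move=> E; have [x1 x2 x3 x4] := ip_cmb c1 c2 c3 c4 c5 p.
have [y1 y2 y3 y4] := ip_cmb d1 d2 d3 d4 d5 p.
rewrite -E in y1 y2 y3 y4.
split; [exact: etrans (esym x1) y1|exact: etrans (esym x2) y2|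
        exact: etrans (esym x3) y3|exact: etrans (esym x4) y4].
Qed.

Lemma cmb_linear k c1 c2 c3 c4 c5 d1 d2 d3 d4 d5 p :
  k *: cmb c1 c2 c3 c4 c5 p + cmb d1 d2 d3 d4 d5 p =
  cmb (k * c1 + d1) (k * c2 + d2) (k * c3 + d3) (k * c4 + d4) (k * c5 + d5) p.
Proof.
rewrite /cmb; move: (e1 p) (e2 p) (n3 p) (E4 p) (phi p) => t1 t2 t3 t4 ph.
by apply/rowP => i; rewrite !mxE; ring.
Qed.

Lemma cmb0E p : cmb 0 0 0 0 0 p = 0.
Proof.
rewrite /cmb; move: (e1 p) (e2 p) (n3 p) (E4 p) (phi p) => t1 t2 t3 t4 ph.
by rewrite mulr0 !scale0r !addr0.
Qed.

(** The formulas of Gauss and Weingarten, with the derivative taken in the ambient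
    space: the component along the position vector is obtained by differentiating
    the orthogonality of [phi] and [xi]. *)
Lemma mder_expand (xi : M -> R5) p v : msmooth xi -> (forall q, tangentN q (xi q)) ->
  mder xi p v = cmb (ip (mder xi p v) (e1 p)) (ip (mder xi p v) (e2 p))
    (ip (mder xi p v) (n3 p)) (ip (mder xi p v) (E4 p)) (- ip (mder phi p v) (xi p)) p.
Proof.
move=> sxi Txi; have T := tangentN_pb_conn p v sxi Txi.
have [n13 n23] := n3_ortho p.
have X := frame_expansion (phiN p) (Te1 p) (Te2 p) (n3_tangentN p) (n4_tangentN p)
  (e11 p) (e22 p) (n3_unit p) (n44 p) (e12 p) n13 (n14 p) n23 (n24 p) (n34 p) T.
have D (t : R5) : tangentN p t -> ip (pb_conn eps phi xi p v) t = ip (mder xi p v) t.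
  move=> Tt; rewrite /pb_conn ipDl ipZl mulrAC (eps_phi Tt) mul0r addr0 //.
rewrite (D _ (Te1 p)) (D _ (Te2 p)) (D _ (n3_tangentN p)) (D _ (n4_tangentN p)) in X.
rewrite /cmb -X /pb_conn mulrN scaleNr -addrA.
by rewrite /dphi subrr addr0.
Qed.

Lemma mder_eq_cmb (xi : M -> R5) p v c1 c2 c3 c4 c5 :
  msmooth xi -> (forall q, tangentN q (xi q)) ->
  ip (mder xi p v) (e1 p) = c1 -> ip (mder xi p v) (e2 p) = c2 ->
  ip (mder xi p v) (n3 p) = c3 -> ip (mder xi p v) (E4 p) = c4 ->
  - ip (mder phi p v) (xi p) = c5 -> mder xi p v = cmb c1 c2 c3 c4 c5 p.
Proof.
by move=> sxi Txi <- <- <- <- <-; exact: mder_expand.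
Qed.

Local Notation k1 := (k1 eps phi nab E1 E2).
Local Notation k2 := (k2 eps phi nab E1 E2).
Local Notation al := (alpha eps phi nab E1 E2 E4).
Local Notation b1 := (b1 eps phi nab E1 E2 E4).
Local Notation b2 := (b2 eps phi nab E1 E2 E4).

Lemma dphi_expand p w : mder phi p w = g p w (E1 p) *: e1 p + g p w (E2 p) *: e2 p.
Proof. by rewrite {1}(frame_expand p w) mder_linear // mderZv. Qed.

Lemma ip_comb0 (t1 t2 n : R5) a b : ip t1 n = 0 -> ip t2 n = 0 -> ip (a *: t1 + b *: t2) n = 0.
Proof. by move=> n1 n2; rewrite ipDl !ipZl n1 n2 !mulr0 addr0. Qed.

Lemma dphi_n3 p w : ip (mder phi p w) (n3 p) = 0.
Proof. by have [h1 h2] := n3_ortho p; rewrite dphi_expand; exact: ip_comb0. Qed.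

Lemma dphi_n4 p w : ip (mder phi p w) (E4 p) = 0.
Proof. by case: (af_E4_normal frame p) => _; apply. Qed.

Lemma sff_normal (Y : vfield M) p v (n : R5) : tangentN p n ->
  (forall w, ip (mder phi p w) n = 0) -> ip (sff Y p v) n = ip (mder (der Y phi) p v) n.
Proof.
move=> Tn on; rewrite /Defs.sff /pb_conn /dphi ipDl ipNl on subr0 ipDl ipZl.
by rewrite mulrAC (eps_phi Tn) mul0r addr0.
Qed.

Lemma shape_entry eta p v :
  g p (shape_operator eps phi nab E1 E2 eta p v) (E1 p) = ip (sff E1 p v) (eta p) /\
  g p (shape_operator eps phi nab E1 E2 eta p v) (E2 p) = ip (sff E2 p v) (eta p).
Proof. exact: metric_comb. Qed.

Lemma k1E p : k1 p = ip (D1 e1 p) (n3 p).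
Proof.
rewrite -(sff_normal E1 (E1 p) (n3_tangentN p) (dphi_n3 p)).
exact: (proj1 (shape_entry n3 p (E1 p))).
Qed.

Lemma k2E p : k2 p = ip (D2 e2 p) (n3 p).
Proof.
rewrite -(sff_normal E2 (E2 p) (n3_tangentN p) (dphi_n3 p)).
exact: (proj2 (shape_entry n3 p (E2 p))).
Qed.

Lemma alphaE p : al p = ip (D1 e1 p) (E4 p).
Proof.
rewrite -(sff_normal E1 (E1 p) (n4_tangentN p) (dphi_n4 p)).
exact: (proj1 (shape_entry E4 p (E1 p))).
Qed.

Lemma principal_frame p : ip (D1 e2 p) (n3 p) = 0 /\ ip (D2 e1 p) (n3 p) = 0.
Proof.
have [_ H1] := shape_entry n3 p (E1 p); have [H2 _] := shape_entry n3 p (E2 p).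
rewrite (af_principal1 frame) (sff_normal E2 (E1 p) (n3_tangentN p) (dphi_n3 p)) in H1.
rewrite (af_principal2 frame) (sff_normal E1 (E2 p) (n3_tangentN p) (dphi_n3 p)) in H2.
have [_ C1] := metric_comb p (k1 p) 0; have [C2 _] := metric_comb p 0 (k2 p).
rewrite scale0r addr0 in C1; rewrite scale0r add0r in C2.
by split; [exact: etrans (esym H1) C1|exact: etrans (esym H2) C2].
Qed.

Lemma ip_torsion_normal (x y t1 t2 n : R5) a b : x - y = a *: t1 + b *: t2 ->
  ip t1 n = 0 -> ip t2 n = 0 -> ip y n = ip x n.
Proof.
move=> E n1 n2; apply/eqP; rewrite eq_sym -subr_eq0 -ipNl -ipDl E; apply/eqP.
exact: ip_comb0.
Qed.

(** The bracket is tangent, so the second fundamental form is symmetric. *)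
Lemma sff_E4_symmetric p : ip (D2 e1 p) (E4 p) = ip (D1 e2 p) (E4 p).
Proof.
exact: (ip_torsion_normal (torsion_frame p) (n14 p) (n24 p)).
Qed.

Lemma mean_curv_trace (x y t1 t2 ph n : R5) a b : ip t1 n = 0 -> ip t2 n = 0 -> eps * ip ph n = 0 ->
  ip (2^-1 *: (x + eps *: ph + a *: t2 + (y + eps *: ph - b *: t1))) n = (ip x n + ip y n) / 2.
Proof. by move=> n1 n2 np; rewrite !ipE n1 n2 np; field. Qed.

Lemma half_sum_unit (r u x y k l : R) : r * u = (x + y) / 2 -> u = 1 -> k = x -> l = y ->
  k + l = 2 * r.
Proof. by move=> E u1 -> ->; move: E; rewrite u1 mulr1 => ->; field. Qed.

Lemma half_sum_zero (r u x y k : R) : r * u = (x + y) / 2 -> u = 0 -> k = x -> y = - k.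
Proof. by move=> E u0 ->; move: E; rewrite u0; lra. Qed.

(** The mean curvature vector is [f E3], so [A_3] has trace [2 f] and [A_4] is
    traceless. *)
Lemma trace_frame p : k1 p + k2 p = 2 * f p /\ ip (D2 e2 p) (E4 p) = - al p.
Proof.
have [h1 h2] := n3_ortho p.
have H3 := mean_curv_trace (D1 e1 p) (D2 e2 p) (a1 p) (a2 p) h1 h2 (eps_phi (n3_tangentN p)).
have H4 := mean_curv_trace (D1 e1 p) (D2 e2 p) (a1 p) (a2 p) (n14 p) (n24 p) (eps_phi (n4_tangentN p)).
have F n : ip (H p) n = f p * ip (n3 p) n.
  exact: etrans (congr1 (fun x => ip x n) (mean_curv_n3 p)) (ipZl _ _ _ _).
have G3 := etrans (esym (F (n3 p))) (etrans (congr1 (fun x => ip x (n3 p)) (mean_curvE p)) H3).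
have G4 := etrans (esym (F (E4 p))) (etrans (congr1 (fun x => ip x (E4 p)) (mean_curvE p)) H4).
split; first exact: (half_sum_unit G3 (n3_unit p) (k1E p) (k2E p)).
exact: (half_sum_zero G4 (n34 p) (alphaE p)).
Qed.

Lemma ip_projection (w t1 t2 ph n : R5) a b c :
  ip t1 n = 0 -> ip t2 n = 0 -> eps * ip ph n = 0 ->
  ip (w + (eps * c) *: ph - a *: t1 - b *: t2) n = ip w n.
Proof.
by move=> n1 n2 np; rewrite !ipE n1 n2 mulrAC np; ring.
Qed.

Lemma nconn_E4 (xi : M -> R5) p v : ip (nconn eps phi E1 E2 xi p v) (E4 p) = ip (mder xi p v) (E4 p).
Proof.
exact: (ip_projection _ _ _ _ (dphi_n4 p (E1 p)) (dphi_n4 p (E2 p)) (eps_phi (n4_tangentN p))).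
Qed.

Lemma b1E p : b1 p = ip (D1 n3 p) (E4 p).
Proof. exact: nconn_E4. Qed.

Lemma b2E p : b2 p = ip (D2 n3 p) (E4 p).
Proof. exact: nconn_E4. Qed.

Let sn3 := n3_smooth.

Lemma k1_smooth : msmooth k1.
Proof.
have -> : k1 = fun p => ip (D1 e1 p) (n3 p) by apply/funext; exact: k1E.
exact: (msmooth_ip eps sD1e1 sn3).
Qed.

Lemma k2_smooth : msmooth k2.
Proof.
have -> : k2 = fun p => ip (D2 e2 p) (n3 p) by apply/funext; exact: k2E.
exact: (msmooth_ip eps sD2e2 sn3).
Qed.

Lemma alpha_smooth : msmooth al.
Proof.
have -> : al = fun p => ip (D1 e1 p) (E4 p) by apply/funext; exact: alphaE.
exact: (msmooth_ip eps sD1e1 sn4).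
Qed.

Lemma b1_smooth : msmooth b1.
Proof.
have -> : b1 = fun p => ip (D1 n3 p) (E4 p) by apply/funext; exact: b1E.
exact: (msmooth_ip eps (msmooth_der sE1 sn3) sn4).
Qed.

Lemma b2_smooth : msmooth b2.
Proof.
have -> : b2 = fun p => ip (D2 n3 p) (E4 p) by apply/funext; exact: b2E.
exact: (msmooth_ip eps (msmooth_der sE2 sn3) sn4).
Qed.

(** The off-diagonal entry of [A_4]; it vanishes when the normal bundle is flat. *)
Definition off4 p := ip (D1 e2 p) (E4 p).

Local Opaque Defs.k1 Defs.k2 Defs.alpha Defs.a1 Defs.a2 Defs.b1 Defs.b2 Defs.E3.

Let neg0 (x : R) : x = 0 -> - x = 0. Proof. by move->; rewrite oppr0. Qed.
Let n31 q : ip (n3 q) (e1 q) = 0.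
Proof. exact: etrans (ipC _ _ _) (proj1 (n3_ortho q)). Qed.
Let n32 q : ip (n3 q) (e2 q) = 0.
Proof. exact: etrans (ipC _ _ _) (proj2 (n3_ortho q)). Qed.
Let n41 q : ip (E4 q) (e1 q) = 0. Proof. exact: etrans (ipC _ _ _) (n14 q). Qed.
Let n42 q : ip (E4 q) (e2 q) = 0. Proof. exact: etrans (ipC _ _ _) (n24 q). Qed.
Let n43 q : ip (E4 q) (n3 q) = 0. Proof. exact: etrans (ipC _ _ _) (n34 q). Qed.
Let e21 q : ip (e2 q) (e1 q) = 0. Proof. exact: etrans (ipC _ _ _) (e12 q). Qed.

Lemma mder_swap (xi eta : M -> R5) p v c : msmooth xi -> msmooth eta ->
  (forall q, ip (xi q) (eta q) = 0) -> c = ip (mder eta p v) (xi p) ->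
  ip (mder xi p v) (eta p) = - c.
Proof. by move=> sx se xe ->; rewrite (mder_ip_cst p v sx se xe) ipC. Qed.

Lemma D1_frame p : [/\ D1 e1 p = cmb 0 (- a1 p) (k1 p) (al p) (-1) p,
  D1 e2 p = cmb (a1 p) 0 0 (off4 p) 0 p,
  D1 n3 p = cmb (- k1 p) (- 0) 0 (b1 p) 0 p &
  D1 E4 p = cmb (- al p) (- off4 p) (- b1 p) 0 0 p].
Proof.
have [[x1 x2 y1 y2] _] := der_frame p.
have [pr1 pr2] := principal_frame p.
split.
- exact: (mder_eq_cmb se1 Te1 x1 x2 (esym (k1E p)) (esym (alphaE p)) (congr1 -%R (e11 p))).
- exact: (mder_eq_cmb se2 Te2 y1 y2 pr1 (erefl _) (neg0 (e12 p))).
- exact: (mder_eq_cmb sn3 n3_tangentN (mder_swap sn3 se1 n31 (k1E p))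
    (mder_swap sn3 se2 n32 (esym pr1)) (mder_unit p (E1 p) sn3 n3_unit) (esym (b1E p))
    (neg0 (dphi_n3 p (E1 p)))).
- exact: (mder_eq_cmb sn4 n4_tangentN (mder_swap sn4 se1 n41 (alphaE p))
    (mder_swap sn4 se2 n42 (erefl _)) (mder_swap sn4 sn3 n43 (b1E p)) (mder_unit p (E1 p) sn4 n44)
    (neg0 (dphi_n4 p (E1 p)))).
Qed.

Lemma D2_frame p : [/\ D2 e1 p = cmb 0 (- a2 p) 0 (off4 p) 0 p,
  D2 e2 p = cmb (a2 p) 0 (k2 p) (- al p) (-1) p,
  D2 n3 p = cmb (- 0) (- k2 p) 0 (b2 p) 0 p &
  D2 E4 p = cmb (- off4 p) (- - al p) (- b2 p) 0 0 p].
Proof.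
have [_ [x1 x2 y1 y2]] := der_frame p.
have [pr1 pr2] := principal_frame p.
have [_ tr4] := trace_frame p.
split.
- exact: (mder_eq_cmb se1 Te1 x1 x2 pr2 (sff_E4_symmetric p) (neg0 (e21 p))).
- exact: (mder_eq_cmb se2 Te2 y1 y2 (esym (k2E p)) tr4 (congr1 -%R (e22 p))).
- exact: (mder_eq_cmb sn3 n3_tangentN (mder_swap sn3 se1 n31 (esym pr2))
    (mder_swap sn3 se2 n32 (k2E p)) (mder_unit p (E2 p) sn3 n3_unit) (esym (b2E p))
    (neg0 (dphi_n3 p (E2 p)))).
- exact: (mder_eq_cmb sn4 n4_tangentN (mder_swap sn4 se1 n41 (esym (sff_E4_symmetric p)))
    (mder_swap sn4 se2 n42 (esym tr4)) (mder_swap sn4 sn3 n43 (b2E p)) (mder_unit p (E2 p) sn4 n44)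
    (neg0 (dphi_n4 p (E2 p)))).
Qed.

Lemma off4_smooth : msmooth off4.
Proof. exact: (msmooth_ip eps (msmooth_der sE1 se2) sn4). Qed.

Lemma mder_sum5 (c1 c2 c3 c4 c5 : M -> R) (t1 t2 t3 t4 ph : M -> R5) p v :
  msmooth c1 -> msmooth c2 -> msmooth c3 -> msmooth c4 -> msmooth c5 ->
  msmooth t1 -> msmooth t2 -> msmooth t3 -> msmooth t4 -> msmooth ph ->
  mder (fun q => c1 q *: t1 q + c2 q *: t2 q + c3 q *: t3 q + c4 q *: t4 q + (eps * c5 q) *: ph q) p v =
  (mder c1 p v *: t1 p + mder c2 p v *: t2 p + mder c3 p v *: t3 p + mder c4 p v *: t4 p
    + (eps * mder c5 p v) *: ph p) +
  (c1 p *: mder t1 p v + c2 p *: mder t2 p v + c3 p *: mder t3 p v + c4 p *: mder t4 p v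
    + (eps * c5 p) *: mder ph p v).
Proof.
move=> s1 s2 s3 s4 s5 u1 u2 u3 u4 u5.
have se : msmooth (fun q => eps * c5 q) := msmoothM (msmooth_cst (M := M) eps) s5.
have w1 := msmoothZ s1 u1; have w2 := msmoothZ s2 u2; have w3 := msmoothZ s3 u3.
have w4 := msmoothZ s4 u4; have w5 := msmoothZ se u5.
have w12 := msmoothD w1 w2; have w123 := msmoothD w12 w3; have w1234 := msmoothD w123 w4.
rewrite (mderD p v w1234 w5) (mderD p v w123 w4) (mderD p v w12 w3) (mderD p v w1 w2).
rewrite (mderZ p v s1 u1) (mderZ p v s2 u2) (mderZ p v s3 u3) (mderZ p v s4 u4) (mderZ p v se u5).
rewrite (mderM p v (msmooth_cst (M := M) eps) s5) mder_cst mul0r add0r.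
move: (mder t1 p v) (mder t2 p v) (mder t3 p v) (mder t4 p v) (mder ph p v).
move: (t1 p) (t2 p) (t3 p) (t4 p) (ph p) => x1 x2 x3 x4 x5 y1 y2 y3 y4 y5.
by apply/rowP => i; rewrite !mxE; ring.
Qed.

Lemma mder_cmb c1 c2 c3 c4 c5 p v :
  msmooth c1 -> msmooth c2 -> msmooth c3 -> msmooth c4 -> msmooth c5 ->
  mder (fun q => cmb (c1 q) (c2 q) (c3 q) (c4 q) (c5 q) q) p v =
  cmb (mder c1 p v) (mder c2 p v) (mder c3 p v) (mder c4 p v) (mder c5 p v) p +
  (c1 p *: mder e1 p v + c2 p *: mder e2 p v + c3 p *: mder n3 p v + c4 p *: mder E4 p v
    + (eps * c5 p) *: mder phi p v).
Proof.
move=> s1 s2 s3 s4 s5.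
exact: (mder_sum5 p v s1 s2 s3 s4 s5 se1 se2 sn3 sn4 sphi).
Qed.

(** The connection matrices of [D1_frame] and [D2_frame], applied to the
    coefficients of a combination. *)
Lemma cmb_connection (t1 t2 t3 t4 ph : R5) d1 d2 d3 d4 d5 c1 c2 c3 c4 c5 k a al b o :
  let cm x1 x2 x3 x4 x5 := x1 *: t1 + x2 *: t2 + x3 *: t3 + x4 *: t4 + (eps * x5) *: ph in
  (cm d1 d2 d3 d4 d5 + (c1 *: cm 0 (- a) k al (-1) + c2 *: cm a 0 0 o 0 + c3 *: cm (- k) (- 0) 0 b 0
    + c4 *: cm (- al) (- o) (- b) 0 0 + (eps * c5) *: t1) =
  cm (d1 + a * c2 - k * c3 - al * c4 + eps * c5) (d2 - a * c1 - o * c4)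
     (d3 + k * c1 - b * c4) (d4 + al * c1 + o * c2 + b * c3) (d5 - c1)) /\
  (cm d1 d2 d3 d4 d5 + (c1 *: cm 0 (- a) 0 o 0 + c2 *: cm a 0 k (- al) (-1) + c3 *: cm (- 0) (- k) 0 b 0
    + c4 *: cm (- o) (- - al) (- b) 0 0 + (eps * c5) *: t2) =
  cm (d1 + a * c2 - o * c4) (d2 - a * c1 - k * c3 + al * c4 + eps * c5)
     (d3 + k * c2 - b * c4) (d4 + o * c1 - al * c2 + b * c3) (d5 - c2)).
Proof. by split; apply/rowP => i; rewrite !mxE; ring. Qed.

Lemma D1_cmb c1 c2 c3 c4 c5 p :
  msmooth c1 -> msmooth c2 -> msmooth c3 -> msmooth c4 -> msmooth c5 ->
  D1 (fun q => cmb (c1 q) (c2 q) (c3 q) (c4 q) (c5 q) q) p =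
  cmb (D1 c1 p + a1 p * c2 p - k1 p * c3 p - al p * c4 p + eps * c5 p)
      (D1 c2 p - a1 p * c1 p - off4 p * c4 p) (D1 c3 p + k1 p * c1 p - b1 p * c4 p)
      (D1 c4 p + al p * c1 p + off4 p * c2 p + b1 p * c3 p) (D1 c5 p - c1 p) p.
Proof.
move=> s1 s2 s3 s4 s5; have [F1 F2 F3 F4] := D1_frame p.
have E : D1 (fun q => cmb (c1 q) (c2 q) (c3 q) (c4 q) (c5 q) q) p =
    cmb (D1 c1 p) (D1 c2 p) (D1 c3 p) (D1 c4 p) (D1 c5 p) p +
    (c1 p *: D1 e1 p + c2 p *: D1 e2 p + c3 p *: D1 n3 p + c4 p *: D1 E4 p
     + (eps * c5 p) *: e1 p) := mder_cmb p (E1 p) s1 s2 s3 s4 s5.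
rewrite F1 F2 F3 F4 in E; apply: etrans E _.
exact: (proj1 (cmb_connection (e1 p) (e2 p) (n3 p) (E4 p) (phi p) _ _ _ _ _ _ _ _ _ _ _ _ _ _ _)).
Qed.

Lemma D2_cmb c1 c2 c3 c4 c5 p :
  msmooth c1 -> msmooth c2 -> msmooth c3 -> msmooth c4 -> msmooth c5 ->
  D2 (fun q => cmb (c1 q) (c2 q) (c3 q) (c4 q) (c5 q) q) p =
  cmb (D2 c1 p + a2 p * c2 p - off4 p * c4 p)
      (D2 c2 p - a2 p * c1 p - k2 p * c3 p + al p * c4 p + eps * c5 p)
      (D2 c3 p + k2 p * c2 p - b2 p * c4 p)
      (D2 c4 p + off4 p * c1 p - al p * c2 p + b2 p * c3 p) (D2 c5 p - c2 p) p.
Proof.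
move=> s1 s2 s3 s4 s5; have [F1 F2 F3 F4] := D2_frame p.
have E : D2 (fun q => cmb (c1 q) (c2 q) (c3 q) (c4 q) (c5 q) q) p =
    cmb (D2 c1 p) (D2 c2 p) (D2 c3 p) (D2 c4 p) (D2 c5 p) p +
    (c1 p *: D2 e1 p + c2 p *: D2 e2 p + c3 p *: D2 n3 p + c4 p *: D2 E4 p
     + (eps * c5 p) *: e2 p) := mder_cmb p (E2 p) s1 s2 s3 s4 s5.
rewrite F1 F2 F3 F4 in E; apply: etrans E _.
exact: (proj2 (cmb_connection (e1 p) (e2 p) (n3 p) (E4 p) (phi p) _ _ _ _ _ _ _ _ _ _ _ _ _ _ _)).
Qed.

Lemma cmb_comm_inj a b c1 c2 c3 c4 c5 d1 d2 d3 d4 d5 x1 x2 x3 x4 x5 y1 y2 y3 y4 y5 p :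
  cmb c1 c2 c3 c4 c5 p - cmb d1 d2 d3 d4 d5 p =
  a *: cmb x1 x2 x3 x4 x5 p + b *: cmb y1 y2 y3 y4 y5 p ->
  [/\ c1 - d1 = a * x1 + b * y1, c2 - d2 = a * x2 + b * y2,
      c3 - d3 = a * x3 + b * y3 & c4 - d4 = a * x4 + b * y4].
Proof.
have Z := cmb0E p.
rewrite -scaleN1r addrC cmb_linear -[b *: _]addr0 -Z !cmb_linear => /cmb_inj[h1 h2 h3 h4].
by split; [have := h1|have := h2|have := h3|have := h4]; rewrite mulN1r addr0 addrC.
Qed.

Lemma mder_comb (W : normedModType R) (xi : M -> W) p x y : msmooth xi ->
  mder xi p (x *: E1 p + y *: E2 p) = x *: D1 xi p + y *: D2 xi p.
Proof. by move=> sxi; rewrite mder_linear // mderZv. Qed.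

Lemma mder_bracket (W : normedModType R) (xi : M -> W) p : msmooth xi ->
  mder xi p (bracket E1 E2 p) = a1 p *: D1 xi p + a2 p *: D2 xi p.
Proof. by move=> sxi; rewrite bracket_frame; exact: mder_comb. Qed.

(** The commutator of [D1] and [D2] on a vector-valued function, component by
    component.  Taken on the frame itself this gives the integrability
    conditions. *)
Lemma comm_equations (xi : M -> R5) (x1 x2 x3 x4 x5 y1 y2 y3 y4 y5 : M -> R) p :
  msmooth xi ->
  msmooth x1 -> msmooth x2 -> msmooth x3 -> msmooth x4 -> msmooth x5 ->
  msmooth y1 -> msmooth y2 -> msmooth y3 -> msmooth y4 -> msmooth y5 ->
  (forall q, D1 xi q = cmb (x1 q) (x2 q) (x3 q) (x4 q) (x5 q) q) ->
  (forall q, D2 xi q = cmb (y1 q) (y2 q) (y3 q) (y4 q) (y5 q) q) ->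
  [/\ (D1 y2 p - a1 p * y1 p - off4 p * y4 p)
      - (D2 x2 p - a2 p * x1 p - k2 p * x3 p + al p * x4 p + eps * x5 p) = a1 p * x2 p + a2 p * y2 p,
      (D1 y3 p + k1 p * y1 p - b1 p * y4 p) - (D2 x3 p + k2 p * x2 p - b2 p * x4 p)
      = a1 p * x3 p + a2 p * y3 p &
      (D1 y4 p + al p * y1 p + off4 p * y2 p + b1 p * y3 p)
      - (D2 x4 p + off4 p * x1 p - al p * x2 p + b2 p * x3 p) = a1 p * x4 p + a2 p * y4 p].
Proof.
move=> sxi sx1 sx2 sx3 sx4 sx5 sy1 sy2 sy3 sy4 sy5 Ex Ey.
have C := etrans (der_comm_row p sE1 sE2 sxi) (mder_bracket p sxi).
have Fx : D1 xi = fun q => cmb (x1 q) (x2 q) (x3 q) (x4 q) (x5 q) q by apply/funext; exact: Ex.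
have Fy : D2 xi = fun q => cmb (y1 q) (y2 q) (y3 q) (y4 q) (y5 q) q by apply/funext; exact: Ey.
have Gy := D1_cmb p sy1 sy2 sy3 sy4 sy5; have Gx := D2_cmb p sx1 sx2 sx3 sx4 sx5.
rewrite -Fy in Gy; rewrite -Fx in Gx.
have L := congr2 (fun a b => a - b) Gy Gx.
have Rr := congr2 (fun a b => a1 p *: a + a2 p *: b) (Ex p) (Ey p).
have [_ h2 h3 h4] := cmb_comm_inj (etrans (esym L) (etrans C Rr)).
by split.
Qed.

Let c0 : msmooth (fun _ : M => 0 : R) := msmooth_cst (M := M) (0 : R).
Let sa1 := a1_smooth. Let sa2 := a2_smooth. Let sk1 := k1_smooth. Let sk2 := k2_smooth.
Let sal := alpha_smooth. Let sb1 := b1_smooth. Let sb2 := b2_smooth.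

(** The [E4] component of the commutator on [E3], before flatness is used. *)
Lemma ricci_off4 p : D1 b2 p - D2 b1 p + off4 p * (k1 p - k2 p) = a1 p * b1 p + a2 p * b2 p.
Proof.
have c0' := msmooth_cst (M := M) (- 0 : R).
have [_ _] := comm_equations p sn3 (msmoothN sk1) c0' c0 sb1 c0 c0' (msmoothN sk2) c0 sb2 c0
  (fun q => let: And4 _ _ h _ := D1_frame q in h) (fun q => let: And4 _ _ h _ := D2_frame q in h).
move: (D1 b2 p) (D2 b1 p) (off4 p) (k1 p) (k2 p) (al p) (a1 p) (a2 p) (b1 p) (b2 p).
by move=> x y o K1 K2 AL A1 A2 B1 B2 h; lra.
Qed.

Hypothesis flat : flat_normal_bundle eps phi E1 E2.

Lemma ip_comb_eq (x y n : R5) a b u v : u = ip x n -> v = ip y n ->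
  ip (a *: x + b *: y) n = a * u + b * v.
Proof. by move=> -> ->; rewrite ipDl !ipZl. Qed.

Lemma nconn_n3 i p : nconn eps phi E1 E2 n3 p (if i then E1 p else E2 p) =
  (if i then b1 p else b2 p) *: E4 p.
Proof.
have A (x t1 t2 n ph : R5) x1 x2 b : x = x1 *: t1 + x2 *: t2 + 0 *: 0 + b *: n + (eps * 0) *: ph ->
    ip t1 t1 = 1 -> ip t2 t2 = 1 -> ip t1 t2 = 0 -> ip n t1 = 0 -> ip n t2 = 0 ->
    x - ip x t1 *: t1 - ip x t2 *: t2 = b *: n.
  move=> -> t11 t22 t12 nt1 nt2; rewrite mulr0 !scale0r !addr0 !ipE (ipC _ t2 t1) t11 t22 t12 nt1 nt2.
  by apply/rowP => j; rewrite !mxE; ring.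
have B c1 c2 c4 : mder n3 p (if i then E1 p else E2 p) = cmb c1 c2 0 c4 0 p ->
    nconn eps phi E1 E2 n3 p (if i then E1 p else E2 p) = c4 *: E4 p.
  move=> E; rewrite /nconn /normal_proj /pb_conn /dphi (dphi_n3 p) mulr0 scale0r addr0.
  apply: (A _ _ _ _ (phi p) c1 c2 c4 _ (e11 p) (e22 p) (e12 p) (n41 p) (n42 p)).
  by rewrite E /cmb !scale0r.
case: i B => B.
  have [_ _ F _] := D1_frame p; exact: B F.
have [_ _ F _] := D2_frame p; exact: B F.
Qed.

Lemma der_bE4 (b : M -> R) p v : msmooth b -> ip (mder (fun q => b q *: E4 q) p v) (E4 p) = mder b p v.
Proof.
move=> sb; rewrite (mderZ p v sb sn4) ipDl !ipZl n44 (mder_unit p v sn4 n44).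
by rewrite mulr1 mulr0 addr0.
Qed.

(** Flatness applied to [E3], whose normal derivatives are [b1 E4] and [b2 E4]; the
    derivatives of [E4] do not contribute to the [E4] component. *)
Lemma ricci p : D1 b2 p - D2 b1 p = a1 p * b1 p + a2 p * b2 p.
Proof.
have Nn3 : normal_section eps phi n3.
  by move=> q; split; [exact: n3_tangentN | move=> v; exact: dphi_n3].
have F := flat sE1 sE2 sn3 Nn3 p.
have G1 : (fun q => nconn eps phi E1 E2 n3 q (E1 q)) = fun q => b1 q *: E4 q.
  by apply/funext => q; exact: (nconn_n3 true q).
have G2 : (fun q => nconn eps phi E1 E2 n3 q (E2 q)) = fun q => b2 q *: E4 q.
  by apply/funext => q; exact: (nconn_n3 false q).
have T h1 h2 : h1 = (fun q => nconn eps phi E1 E2 n3 q (E1 q)) ->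
    h2 = (fun q => nconn eps phi E1 E2 n3 q (E2 q)) ->
    nconn eps phi E1 E2 h2 p (E1 p) - nconn eps phi E1 E2 h1 p (E2 p)
    - nconn eps phi E1 E2 n3 p (bracket E1 E2 p) = 0 by move=> -> ->; exact: F.
have F' := T _ _ (esym G1) (esym G2).
have A (x y z n : R5) u v a b c d : x - y - z = 0 -> ip x n = u -> ip y n = v -> ip z n = a * b + c * d ->
    u - v = a * b + c * d.
  by move=> /(congr1 (fun x => ip x n)) H <- <- <-; move: H; rewrite !ipE => H; lra.
have Z : ip (nconn eps phi E1 E2 n3 p (bracket E1 E2 p)) (E4 p) = a1 p * b1 p + a2 p * b2 p.
  apply: etrans (nconn_E4 n3 p (bracket E1 E2 p)) _; rewrite (mder_bracket p sn3).
  exact: ip_comb_eq (b1E p) (b2E p).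
exact: (A _ _ _ _ _ _ _ _ _ _ F' (etrans (nconn_E4 _ p (E1 p)) (der_bE4 p (E1 p) sb2))
  (etrans (nconn_E4 _ p (E2 p)) (der_bE4 p (E2 p) sb1)) Z).
Qed.

Lemma shape_comp (eta : M -> R5) p x y : tangentN p (eta p) -> (forall w, ip (mder phi p w) (eta p) = 0) ->
  shape_operator eps phi nab E1 E2 eta p (x *: E1 p + y *: E2 p) =
  (x * ip (D1 e1 p) (eta p) + y * ip (D2 e1 p) (eta p)) *: E1 p +
  (x * ip (D1 e2 p) (eta p) + y * ip (D2 e2 p) (eta p)) *: E2 p.
Proof.
move=> Te oe; set v := x *: E1 p + y *: E2 p.
have h1 := etrans (sff_normal E1 v Te oe) (etrans (congr1 (fun w => ip w (eta p))
  (mder_comb p x y se1)) (ip_comb_eq x y (erefl _) (erefl _))).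
have h2 := etrans (sff_normal E2 v Te oe) (etrans (congr1 (fun w => ip w (eta p))
  (mder_comb p x y se2)) (ip_comb_eq x y (erefl _) (erefl _))).
exact: (congr2 (fun a b => a *: E1 p + b *: E2 p) h1 h2).
Qed.

Lemma shape_n3 p x y : shape_operator eps phi nab E1 E2 n3 p (x *: E1 p + y *: E2 p) =
  (x * k1 p) *: E1 p + (y * k2 p) *: E2 p.
Proof.
have [pr1 pr2] := principal_frame p.
apply: etrans (shape_comp x y (n3_tangentN p) (dphi_n3 p)) _.
have A (u v z w : R) : z = 0 -> u = w -> v * u + y * z = v * w by move=> -> ->; ring.
have B (u v z w : R) : z = 0 -> u = w -> x * z + v * u = v * w by move=> -> ->; ring.
congr (_ *: _ + _ *: _); first exact: A pr2 (esym (k1E p)).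
exact: B pr1 (esym (k2E p)).
Qed.

(** Otherwise [A_3] would be [f] times the identity. *)
Lemma k_neq p : k1 p != k2 p.
Proof.
apply/eqP => k12; have [_ _] := ncmc p; apply => v.
have [tr _] := trace_frame p.
have kf : k1 p = f p by rewrite -k12 in tr; move: tr; move: (k1 p) (f p) => a b; lra.
have k2f : k2 p = f p := etrans (esym k12) kf.
have F := frame_expand p v; set x := g p v (E1 p) in F; set y := g p v (E2 p) in F.
rewrite F shape_n3 kf k2f scalerDr !scalerA.
by congr (_ *: _ + _ *: _); exact: mulrC.
Qed.

(** Comparison of the two forms of the Ricci equation. *)
Lemma off4_eq0 p : off4 p = 0.
Proof.
have A (x y o u v z : R) : x + o * (u - v) = z -> x = z -> u != v -> o = 0.
  move=> E xz uv; apply: (mulIf (x := u - v)); first by rewrite subr_eq0.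
  by move: E; rewrite xz mul0r => E; lra.
exact: A (ricci_off4 p) (ricci p) (k_neq p).
Qed.

Lemma alpha_neq0 p : (exists v, shape_operator eps phi nab E1 E2 E4 p v != 0) -> al p != 0.
Proof.
move=> [v]; apply: contra_neq => al0; have [_ tr4] := trace_frame p.
rewrite (frame_expand p v); apply: etrans (shape_comp _ _ (n4_tangentN p) (dphi_n4 p)) _.
have A (x y z w : R) : z = 0 -> w = 0 -> x * z + y * w = 0 by move=> -> ->; rewrite !mulr0 addr0.
have h1 : ip (D1 e1 p) (E4 p) = 0 := etrans (esym (alphaE p)) al0.
have h2 : ip (D1 e2 p) (E4 p) = 0 := off4_eq0 p.
have h3 : ip (D2 e1 p) (E4 p) = 0 := etrans (sff_E4_symmetric p) h2.
have h4 : ip (D2 e2 p) (E4 p) = 0 := etrans tr4 (neg0 al0).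
have Z : 0 *: E1 p + 0 *: E2 p = 0 by rewrite !scale0r addr0.
exact: (etrans (congr2 (fun a b => a *: E1 p + b *: E2 p) (A _ _ _ _ h1 h3) (A _ _ _ _ h2 h4)) Z).
Qed.

(** The hypotheses are the components of the commutator on [e1] and [e2], in the
    form produced by [comm_equations]. *)
Lemma codazzi_algebra (A1 A2 K1 K2 AL OF B1 B2 e na2 na1 nal da2 da1 dk1 dal2
    dof1 dof2 dal1 dk2 z0 z2 : R) :
  OF = 0 -> dof1 = 0 -> dof2 = 0 ->
  na2 = - da2 -> na1 = - da1 -> nal = - dal1 -> z0 = 0 -> z2 = 0 ->
  (na2 - A1 * 0 - OF * OF) - (na1 - A2 * 0 - K2 * K1 + AL * AL + e * (-1))
    = A1 * (- A1) + A2 * (- A2) ->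
  (z0 + K1 * 0 - B1 * OF) - (dk1 + K2 * (- A1) - B2 * AL) = A1 * K1 + A2 * 0 ->
  (dof1 + AL * 0 + OF * (- A2) + B1 * 0) - (dal2 + OF * 0 - AL * (- A1) + B2 * K1)
    = A1 * AL + A2 * OF ->
  (dk2 + K1 * A2 - B1 * (- AL)) - (z2 + K2 * 0 - B2 * OF) = A1 * 0 + A2 * K2 ->
  (nal + AL * A2 + OF * 0 + B1 * K2) - (dof2 + OF * A1 - AL * 0 + B2 * 0)
    = A1 * OF + A2 * (- AL) ->
  [/\ dk1 = A1 * (K2 - K1) + AL * B2, dal2 = - (2 * A1 * AL) - K1 * B2,
      dk2 = A2 * (K2 - K1) - AL * B1 & dal1 = 2 * AL * A2 + K2 * B1] /\
  da2 - da1 = e + K1 * K2 - AL ^+ 2 + A1 ^+ 2 + A2 ^+ 2.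
Proof.
do 8 move=> ->; rewrite !expr2 => g1 g2 g3 h2 h3.
by split; [split; [move: g2|move: g3|move: h2|move: h3]|move: g1] => h; lra.
Qed.

Lemma codazzi p :
  [/\ D2 k1 p = a1 p * (k2 p - k1 p) + al p * b2 p, D2 al p = - (2 * a1 p * al p) - k1 p * b2 p,
      D1 k2 p = a2 p * (k2 p - k1 p) - al p * b1 p & D1 al p = 2 * al p * a2 p + k2 p * b1 p] /\
  D1 a2 p - D2 a1 p = eps + k1 p * k2 p - al p ^+ 2 + a1 p ^+ 2 + a2 p ^+ 2.
Proof.
have so := off4_smooth.
have c1 := msmooth_cst (M := M) (-1 : R).
have [g1 g2 g3] := comm_equations p se1 c0 (msmoothN sa1) sk1 sal c1 c0 (msmoothN sa2) c0 so c0
  (fun q => let: And4 h _ _ _ := D1_frame q in h) (fun q => let: And4 h _ _ _ := D2_frame q in h).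
have [_ h2 h3] := comm_equations p se2 sa1 c0 c0 so c0 sa2 c0 sk2 (msmoothN sal) c1
  (fun q => let: And4 _ h _ _ := D1_frame q in h) (fun q => let: And4 _ h _ _ := D2_frame q in h).
have N1 (u : M -> R) : msmooth u -> D1 (fun q => - u q) p = - D1 u p := @mderN _ _ _ _ p (E1 p).
have N2 (u : M -> R) : msmooth u -> D2 (fun q => - u q) p = - D2 u p := @mderN _ _ _ _ p (E2 p).
have Z1 (c : R) : D1 (fun=> c) p = 0 := mder_cst c p (E1 p).
have Z2 (c : R) : D2 (fun=> c) p = 0 := mder_cst c p (E2 p).
have o0 : off4 = fun=> 0 by apply/funext => q; exact: off4_eq0.
have o1 : D1 off4 p = 0 := etrans (congr1 (fun u => D1 u p) o0) (Z1 0).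
have o2 : D2 off4 p = 0 := etrans (congr1 (fun u => D2 u p) o0) (Z2 0).
exact: (codazzi_algebra (off4_eq0 p) o1 o2 (N1 _ sa2) (N2 _ sa1) (N1 _ sal) (Z1 0) (Z2 0)
  g1 g2 g3 h2 h3).
Qed.

Lemma nab_linear (Y : vfield M) p x y v w : smooth_vfield Y ->
  nab Y p (x *: v + y *: w) = x *: nab Y p v + y *: nab Y p w.
Proof.
move=> sY; have L := lc_linear LC sY p.
have Z : nab Y p 0 = 0.
  by have := L 1 0 0; rewrite scaler0 addr0 scale1r => /eqP; rewrite -subr_eq0 opprD addNKr oppr_eq0 => /eqP.
by rewrite L -[y *: w]addr0 L Z addr0.
Qed.

Lemma gauss_algebra (x y z u v : R) : x - y = z + u + v -> x - y - u - v = z.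
Proof. by move=> h; lra. Qed.

Lemma gauss_curvatureE p : gauss_curvature eps phi nab E1 E2 p = eps + k1 p * k2 p - al p ^+ 2.
Proof.
have G1 : (fun q => nab E2 q (E2 q)) = fun q => a2 q *: E1 q.
  by apply/funext => q; have [_ _ _ h] := nab_frame q.
have G2 : (fun q => nab E2 q (E1 q)) = fun q => a1 q *: E1 q.
  by apply/funext => q; have [_ h _ _] := nab_frame q.
have [n1 n2 n3' n4] := nab_frame p.
have X1 : nab (fun q => nab E2 q (E2 q)) p (E1 p) = D1 a2 p *: E1 p + a2 p *: (- a1 p *: E2 p).
  by rewrite G1 (lc_leibniz LC sa2 sE1) n1.
have X2 : nab (fun q => nab E2 q (E1 q)) p (E2 p) = D2 a1 p *: E1 p + a1 p *: (- a2 p *: E2 p).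
  by rewrite G2 (lc_leibniz LC sa1 sE1) n3'.
have X3 : nab E2 p (bracket E1 E2 p) = a1 p *: (a1 p *: E1 p) + a2 p *: (a2 p *: E1 p).
  by rewrite bracket_frame nab_linear // n2 n4.
have A (v w : R2) da2 da1 A1 A2 : da2 *: v + A2 *: (- A1 *: w) - (da1 *: v + A1 *: (- A2 *: w))
    - (A1 *: (A1 *: v) + A2 *: (A2 *: v)) = (da2 - da1 - A1 ^+ 2 - A2 ^+ 2) *: v + 0 *: w.
  by apply: injective_projections; rewrite /= /GRing.scale /=; ring.
have E : gauss_curvature eps phi nab E1 E2 p =
    g p ((D1 a2 p - D2 a1 p - a1 p ^+ 2 - a2 p ^+ 2) *: E1 p + 0 *: E2 p) (E1 p).
  by rewrite /gauss_curvature X1 X2 X3 A.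
have [m _] := metric_comb p (D1 a2 p - D2 a1 p - a1 p ^+ 2 - a2 p ^+ 2) 0.
have [_ G] := codazzi p; apply: etrans (etrans E m) _.
exact: gauss_algebra G.
Qed.

(** The term added by [pb_conn] cancels the component along the position vector. *)
Lemma cmb_phi (t1 t2 t3 t4 ph : R5) c1 c2 c3 c4 z c :
  z = 0 ->
  c1 *: t1 + c2 *: t2 + c3 *: t3 + c4 *: t4 + (eps * (z - c)) *: ph + (eps * c) *: ph =
  c1 *: t1 + c2 *: t2 + c3 *: t3 + c4 *: t4 + (eps * 0) *: ph.
Proof. by move=> ->; apply/rowP => i; rewrite !mxE; ring. Qed.

(** * The bitension field in the frame *)

Lemma cmb_congr c1 c2 c3 c4 c5 d1 d2 d3 d4 d5 p : c1 = d1 -> c2 = d2 -> c3 = d3 -> c4 = d4 -> c5 = d5 ->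
  cmb c1 c2 c3 c4 c5 p = cmb d1 d2 d3 d4 d5 p.
Proof. by move=> -> -> -> -> ->. Qed.

Lemma plus_eps0 (x : R) : x + eps * 0 = x.
Proof. by rewrite mulr0 addr0. Qed.

Lemma off_terms (o : R) : o = 0 -> [/\ forall x y, x - o * y = x,
  forall x y z, x + o * y + z = x + z & forall x y z w, x + o * y - z + w = x - z + w].
Proof. by move=> ->; split=> *; rewrite mul0r ?subr0 ?addr0. Qed.

Lemma pb_conn1 c1 c2 c3 c4 p : msmooth c1 -> msmooth c2 -> msmooth c3 -> msmooth c4 ->
  pb_conn eps phi (fun q => cmb (c1 q) (c2 q) (c3 q) (c4 q) 0 q) p (E1 p) =
  cmb (D1 c1 p + a1 p * c2 p - k1 p * c3 p - al p * c4 p) (D1 c2 p - a1 p * c1 p)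
      (D1 c3 p + k1 p * c1 p - b1 p * c4 p) (D1 c4 p + al p * c1 p + b1 p * c3 p) 0 p.
Proof.
move=> s1 s2 s3 s4; have E := D1_cmb p s1 s2 s3 s4 c0.
have I : ip (dphi phi p (E1 p)) (cmb (c1 p) (c2 p) (c3 p) (c4 p) 0 p) = c1 p.
  have [h _ _ _] := ip_cmb (c1 p) (c2 p) (c3 p) (c4 p) 0 p.
  exact: etrans (ipC _ _ _) h.
have P : pb_conn eps phi (fun q => cmb (c1 q) (c2 q) (c3 q) (c4 q) 0 q) p (E1 p) =
   D1 (fun q => cmb (c1 q) (c2 q) (c3 q) (c4 q) 0 q) p + (eps * c1 p) *: phi p.
  exact: (congr1 (fun x => D1 (fun q => cmb (c1 q) (c2 q) (c3 q) (c4 q) 0 q) p + (eps * x) *: phi p) I).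
apply: etrans P _; apply: etrans (congr1 (fun x => x + (eps * c1 p) *: phi p) E) _.
apply: etrans (cmb_phi (e1 p) (e2 p) (n3 p) (E4 p) (phi p) _ _ _ _ (c1 p) (mder_cst 0 p (E1 p))) _.
have [ho1 ho2 ho3] := off_terms (off4_eq0 p).
by apply: cmb_congr; [exact: plus_eps0|exact: ho1| |exact: ho2|].
Qed.

Lemma pb_conn2 c1 c2 c3 c4 p : msmooth c1 -> msmooth c2 -> msmooth c3 -> msmooth c4 ->
  pb_conn eps phi (fun q => cmb (c1 q) (c2 q) (c3 q) (c4 q) 0 q) p (E2 p) =
  cmb (D2 c1 p + a2 p * c2 p) (D2 c2 p - a2 p * c1 p - k2 p * c3 p + al p * c4 p)
      (D2 c3 p + k2 p * c2 p - b2 p * c4 p) (D2 c4 p - al p * c2 p + b2 p * c3 p) 0 p.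
Proof.
move=> s1 s2 s3 s4; have E := D2_cmb p s1 s2 s3 s4 c0.
have I : ip (dphi phi p (E2 p)) (cmb (c1 p) (c2 p) (c3 p) (c4 p) 0 p) = c2 p.
  have [_ h _ _] := ip_cmb (c1 p) (c2 p) (c3 p) (c4 p) 0 p.
  exact: etrans (ipC _ _ _) h.
have P : pb_conn eps phi (fun q => cmb (c1 q) (c2 q) (c3 q) (c4 q) 0 q) p (E2 p) =
   D2 (fun q => cmb (c1 q) (c2 q) (c3 q) (c4 q) 0 q) p + (eps * c2 p) *: phi p.
  exact: (congr1 (fun x => D2 (fun q => cmb (c1 q) (c2 q) (c3 q) (c4 q) 0 q) p + (eps * x) *: phi p) I).
apply: etrans P _; apply: etrans (congr1 (fun x => x + (eps * c2 p) *: phi p) E) _.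
apply: etrans (cmb_phi (e1 p) (e2 p) (n3 p) (E4 p) (phi p) _ _ _ _ (c2 p) (mder_cst 0 p (E2 p))) _.
have [ho1 ho2 ho3] := off_terms (off4_eq0 p).
by apply: cmb_congr; [exact: ho1|exact: plus_eps0| |exact: ho3|].
Qed.

Lemma tension_cmb q : tension eps phi nab E1 E2 q = cmb 0 0 (2 * f q) 0 0 q.
Proof.
have A (h : R5) (t1 t2 t3 t4 ph x : R5) r : x = 2^-1 *: h -> x = r *: t3 ->
    h = 0 *: t1 + 0 *: t2 + (2 * r) *: t3 + 0 *: t4 + (eps * 0) *: ph.
  move=> hx xr; rewrite mulr0 !scale0r !addr0 !add0r -scalerA -xr hx scalerA divff ?pnatr_eq0 //.
  by rewrite scale1r.
apply: (A _ _ _ _ _ _ (H q) (f q)); last exact: mean_curv_n3.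
by rewrite /tension sff11 sff22 -mean_curvE.
Qed.

Lemma pb_connZ (xi : M -> R5) p a v : msmooth xi ->
  pb_conn eps phi xi p (a *: v) = a *: pb_conn eps phi xi p v.
Proof.
move=> sxi; rewrite /pb_conn /dphi mderZv // mderZv // ipZl.
by rewrite scalerDr scalerA mulrCA.
Qed.

Lemma zero_mul_add (x y : R) : 0 * x + y = y.
Proof. by rewrite mul0r add0r. Qed.

Lemma pb_tension_algebra (z d d' : R) : z = 0 -> d = d' -> forall a k al b r : R,
  [/\ z + a * 0 - k * (2 * r) - al * 0 = - (k * (2 * r)), z - a * 0 = 0,
      d + k * 0 - b * 0 = d', z + al * 0 + b * (2 * r) = b * (2 * r) &
      [/\ z + a * 0 = 0, z - a * 0 - k * (2 * r) + al * 0 = - (k * (2 * r)) &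
          z - al * 0 + b * (2 * r) = b * (2 * r)]].
Proof. by move=> -> -> *; split; [..|split]; ring. Qed.

Lemma bitension_algebra (t1 t2 t3 t4 ph : R5) x1 x2 x3 x4 u1 u2 u3 u4 y1 y2 y3 y4 z1 z2 z3 z4 a b r :
  let cm c1 c2 c3 c4 c5 := c1 *: t1 + c2 *: t2 + c3 *: t3 + c4 *: t4 + (eps * c5) *: ph in
  let T := cm 0 0 (2 * r) 0 0 in
  cm x1 x2 x3 x4 0 - (- a) *: cm z1 z2 z3 z4 0 - eps *: (0 *: t1 - 1 *: T)
  + (cm y1 y2 y3 y4 0 - b *: cm u1 u2 u3 u4 0 - eps *: (0 *: t2 - 1 *: T)) =
  cm (x1 + y1 + a * z1 - b * u1) (x2 + y2 + a * z2 - b * u2)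
     (x3 + y3 + a * z3 - b * u3 + 4 * eps * r) (x4 + y4 + a * z4 - b * u4) 0.
Proof. by move=> cm T; rewrite /T /cm; apply/rowP => i; rewrite !mxE; ring. Qed.

Let s2f : msmooth (fun q => 2 * f q) := msmoothM (msmooth_cst (M := M) (2 : R)) mean_norm_smooth.

Local Notation T := (tension eps phi nab E1 E2).

Lemma tension_smooth : msmooth T.
Proof.
have -> : T = fun q => 2 *: H q.
  by apply/funext; exact: tension_mean_curv.
exact: (msmoothZ (msmooth_cst (M := M) (2 : R)) mean_curv_smooth).
Qed.

(** The derivatives of the tension field [2 f E3] along [E1] and [E2]. *)
Definition PT1 q := cmb (- (k1 q * (2 * f q))) 0 (2 * D1 f q) (b1 q * (2 * f q)) 0 q.
Definition PT2 q := cmb 0 (- (k2 q * (2 * f q))) (2 * D2 f q) (b2 q * (2 * f q)) 0 q.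

Lemma tension_fun : T = fun q => cmb 0 0 (2 * f q) 0 0 q.
Proof. by apply/funext; exact: tension_cmb. Qed.

Lemma pb_tension q : pb_conn eps phi T q (E1 q) = PT1 q /\ pb_conn eps phi T q (E2 q) = PT2 q.
Proof.
rewrite tension_fun.
have h1 := pb_conn1 q c0 c0 s2f c0; have h2 := pb_conn2 q c0 c0 s2f c0.
have Z1 : D1 (fun _ : M => 0 : R) q = 0 := mder_cst 0 q (E1 q).
have Z2 : D2 (fun _ : M => 0 : R) q = 0 := mder_cst 0 q (E2 q).
have F1 : D1 (fun q => 2 * f q) q = 2 * D1 f q.
  exact: (etrans (mderM q (E1 q) (msmooth_cst (M := M) (2 : R)) mean_norm_smooth)
    (etrans (congr1 (fun x => x * f q + 2 * D1 f q) (mder_cst (2 : R) q (E1 q))) (zero_mul_add _ _))).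
have F2 : D2 (fun q => 2 * f q) q = 2 * D2 f q.
  exact: (etrans (mderM q (E2 q) (msmooth_cst (M := M) (2 : R)) mean_norm_smooth)
    (etrans (congr1 (fun x => x * f q + 2 * D2 f q) (mder_cst (2 : R) q (E2 q))) (zero_mul_add _ _))).
have A := pb_tension_algebra Z1 F1; have B := pb_tension_algebra Z2 F2.
split; [apply: etrans h1 _|apply: etrans h2 _].
  have [q1 q2 q3 q4 _] := A (a1 q) (k1 q) (al q) (b1 q) (f q).
  exact: cmb_congr q1 q2 q3 q4 (erefl _).
have [_ _ q3 _ [q1 q2 q4]] := B (a2 q) (k2 q) (al q) (b2 q) (f q).
exact: cmb_congr q1 q2 q3 q4 (erefl _).
Qed.

Lemma PT1_fun : (fun q => pb_conn eps phi T q (E1 q)) = PT1.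
Proof. by apply/funext => q; exact: (proj1 (pb_tension q)). Qed.

Lemma PT2_fun : (fun q => pb_conn eps phi T q (E2 q)) = PT2.
Proof. by apply/funext => q; exact: (proj2 (pb_tension q)). Qed.

Lemma curvN_tension (t tau : R5) : ip t tau = 0 -> ip t t = 1 ->
  curvN eps t tau t = eps *: (0 *: t - 1 *: tau).
Proof. by move=> h1 h2; rewrite /curvN (ipC _ tau) h1 h2. Qed.

Let m1 q := - (k1 q * (2 * f q)).
Let m2 q := - (k2 q * (2 * f q)).
Let sf := mean_norm_smooth.
Let sm1 : msmooth m1 := msmoothN (msmoothM sk1 s2f).
Let sm2 : msmooth m2 := msmoothN (msmoothM sk2 s2f).
Let sX : msmooth (D1 f) := msmooth_der sE1 sf.
Let sY : msmooth (D2 f) := msmooth_der sE2 sf.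
Let s2X : msmooth (fun q => 2 * D1 f q) := msmoothM (msmooth_cst (M := M) (2 : R)) sX.
Let s2Y : msmooth (fun q => 2 * D2 f q) := msmoothM (msmooth_cst (M := M) (2 : R)) sY.
Let sbf1 : msmooth (fun q => b1 q * (2 * f q)) := msmoothM sb1 s2f.
Let sbf2 : msmooth (fun q => b2 q * (2 * f q)) := msmoothM sb2 s2f.

Lemma mder2 (u : M -> R) p v : msmooth u -> mder (fun q => 2 * u q) p v = 2 * mder u p v.
Proof.
by move=> su; rewrite (mderM p v (msmooth_cst (M := M) (2 : R)) su) mder_cst mul0r add0r.
Qed.

Lemma mder_2f (b : M -> R) p v : msmooth b ->
  mder (fun q => b q * (2 * f q)) p v = mder b p v * (2 * f p) + b p * (2 * mder f p v).
Proof. by move=> sb; rewrite (mderM p v sb s2f) (mder2 p v sf). Qed.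

Lemma bitension_cmb p : bitension eps phi nab E1 E2 p = cmb
  (D1 m1 p + a1 p * 0 - k1 p * (2 * D1 f p) - al p * (b1 p * (2 * f p))
   + (D2 (fun=> 0 : R) p + a2 p * m2 p) + a1 p * 0 - a2 p * m1 p)
  (D1 (fun=> 0 : R) p - a1 p * m1 p
   + (D2 m2 p - a2 p * 0 - k2 p * (2 * D2 f p) + al p * (b2 p * (2 * f p)))
   + a1 p * m2 p - a2 p * 0)
  (D1 (fun q => 2 * D1 f q) p + k1 p * m1 p - b1 p * (b1 p * (2 * f p))
   + (D2 (fun q => 2 * D2 f q) p + k2 p * m2 p - b2 p * (b2 p * (2 * f p)))
   + a1 p * (2 * D2 f p) - a2 p * (2 * D1 f p) + 4 * eps * f p)
  (D1 (fun q => b1 q * (2 * f q)) p + al p * m1 p + b1 p * (2 * D1 f p)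
   + (D2 (fun q => b2 q * (2 * f q)) p - al p * m2 p + b2 p * (2 * D2 f p))
   + a1 p * (b2 p * (2 * f p)) - a2 p * (b1 p * (2 * f p))) 0 p.
Proof.
have [n1 _ _ n4] := nab_frame p.
have [q1 q2] := pb_tension p.
have [t13 t23] := n3_ortho p.
have t1T : ip (e1 p) (T p) = 0.
  have [h _ _ _] := ip_cmb 0 0 (2 * f p) 0 0 p.
  exact: etrans (congr1 (fun x => ip (e1 p) x) (tension_cmb p)) (etrans (ipC _ _ _) h).
have t2T : ip (e2 p) (T p) = 0.
  have [_ h _ _] := ip_cmb 0 0 (2 * f p) 0 0 p.
  exact: etrans (congr1 (fun x => ip (e2 p) x) (tension_cmb p)) (etrans (ipC _ _ _) h).
have A1 := etrans (congr1 (fun h => pb_conn eps phi h p (E1 p)) PT1_fun)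
  (pb_conn1 p sm1 c0 s2X sbf1).
have A2 := etrans (congr1 (fun h => pb_conn eps phi h p (E2 p)) PT2_fun)
  (pb_conn2 p c0 sm2 s2Y sbf2).
have B1 := etrans (congr1 (pb_conn eps phi T p) n1)
  (etrans (pb_connZ p (- a1 p) (E2 p) tension_smooth) (congr1 (fun x => - a1 p *: x) q2)).
have B2 := etrans (congr1 (pb_conn eps phi T p) n4)
  (etrans (pb_connZ p (a2 p) (E1 p) tension_smooth) (congr1 (fun x => a2 p *: x) q1)).
have C1 := etrans (curvN_tension t1T (e11 p)) (congr1 (fun x => eps *: (0 *: e1 p - 1 *: x)) (tension_cmb p)).
have C2 := etrans (curvN_tension t2T (e22 p)) (congr1 (fun x => eps *: (0 *: e2 p - 1 *: x)) (tension_cmb p)).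
have S1 := congr2 (fun x y => x - y) (congr2 (fun x y => x - y) A1 B1) C1.
have S2 := congr2 (fun x y => x - y) (congr2 (fun x y => x - y) A2 B2) C2.
apply: etrans (congr2 (fun x y => x + y) S1 S2) _.
exact: (bitension_algebra (e1 p) (e2 p) (n3 p) (E4 p) (phi p)).
Qed.

Lemma biharmonic_algebra (A1 A2 K1 K2 AL B1 B2 F X Y e dm1 dm2 z1 z2 d2X d2Y dbf1 dbf2
    dk11 dk22 dk12 dk21 db1 db2 X1 Y2 : R) :
  dm1 = - (dk11 * (2 * F) + K1 * (2 * X)) -> dm2 = - (dk22 * (2 * F) + K2 * (2 * Y)) ->
  z1 = 0 -> z2 = 0 -> d2X = 2 * X1 -> d2Y = 2 * Y2 ->
  dbf1 = db1 * (2 * F) + B1 * (2 * X) -> dbf2 = db2 * (2 * F) + B2 * (2 * Y) ->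
  dk11 = 2 * X - dk12 -> dk22 = 2 * Y - dk21 -> dk12 = A2 * (K2 - K1) - AL * B1 ->
  dk21 = A1 * (K2 - K1) + AL * B2 ->
  [/\ dm1 + A1 * 0 - K1 * (2 * X) - AL * (B1 * (2 * F)) + (z2 + A2 * - (K2 * (2 * F))) + A1 * 0
      - A2 * - (K1 * (2 * F)) = - 4 * ((F + K1) * X + F * AL * B1),
      z1 - A1 * - (K1 * (2 * F)) + (dm2 - A2 * 0 - K2 * (2 * Y) + AL * (B2 * (2 * F)))
      + A1 * - (K2 * (2 * F)) - A2 * 0 = - 4 * ((F + K2) * Y - F * AL * B2),
      d2X + K1 * - (K1 * (2 * F)) - B1 * (B1 * (2 * F)) + (d2Y + K2 * - (K2 * (2 * F))
      - B2 * (B2 * (2 * F))) + A1 * (2 * Y) - A2 * (2 * X) + 4 * e * F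
      = 2 * (X1 + Y2 + A1 * Y - A2 * X - F * (B1 ^+ 2 + B2 ^+ 2 + K1 ^+ 2 + K2 ^+ 2 - 2 * e)) &
      dbf1 + AL * - (K1 * (2 * F)) + B1 * (2 * X) + (dbf2 - AL * - (K2 * (2 * F)) + B2 * (2 * Y))
      + A1 * (B2 * (2 * F)) - A2 * (B1 * (2 * F))
      = 2 * (2 * X * B1 + 2 * Y * B2 + F * db1 + F * db2 + A1 * F * B2 - A2 * F * B1 - F * AL * (K1 - K2))].
Proof. by do 12 move=> ->; split; ring. Qed.

(** The four scalar equations are the components of the bitension field divided by
    [-4], [-4], [2] and [2]; the Codazzi equations remove the derivatives of [k1]
    and [k2] from the tangential ones. *)
Lemma bitension_eq0 p : bitension eps phi nab E1 E2 p = 0 <->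
  frame_biharmonic eps E1 E2 f k1 k2 al a1 a2 b1 b2 p.
Proof.
have dm1 : D1 m1 p = - (D1 k1 p * (2 * f p) + k1 p * (2 * D1 f p)).
  exact: etrans (mderN p (E1 p) (msmoothM sk1 s2f)) (congr1 -%R (mder_2f p (E1 p) sk1)).
have dm2 : D2 m2 p = - (D2 k2 p * (2 * f p) + k2 p * (2 * D2 f p)).
  exact: etrans (mderN p (E2 p) (msmoothM sk2 s2f)) (congr1 -%R (mder_2f p (E2 p) sk2)).
have tr q : k1 q + k2 q = 2 * f q := proj1 (trace_frame q).
have k1f : k1 = fun q => 2 * f q - k2 q by apply/funext => q; rewrite -tr addrK.
have k2f : k2 = fun q => 2 * f q - k1 q by apply/funext => q; rewrite -tr addrAC subrr add0r.
have dk11 : D1 k1 p = 2 * D1 f p - D1 k2 p.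
  exact: (etrans (congr1 (fun u => D1 u p) k1f) (etrans (mderB p (E1 p) s2f sk2)
    (congr1 (fun x => x - D1 k2 p) (mder2 p (E1 p) sf)))).
have dk22 : D2 k2 p = 2 * D2 f p - D2 k1 p.
  exact: (etrans (congr1 (fun u => D2 u p) k2f) (etrans (mderB p (E2 p) s2f sk1)
    (congr1 (fun x => x - D2 k1 p) (mder2 p (E2 p) sf)))).
have [[cd1 _ cd3 _] _] := codazzi p.
have [q1 q2 q3 q4] := biharmonic_algebra eps dm1 dm2 (mder_cst 0 p (E1 p)) (mder_cst 0 p (E2 p))
  (mder2 p (E1 p) sX) (mder2 p (E2 p) sY) (mder_2f p (E1 p) sb1) (mder_2f p (E2 p) sb2)
  dk11 dk22 cd3 cd1.
have BC := etrans (bitension_cmb p) (cmb_congr p q1 q2 q3 q4 (erefl 0)).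
have N (c x : R) : c != 0 -> c * x = 0 -> x = 0 by move=> c0' /eqP; rewrite mulf_eq0 (negbTE c0') /= => /eqP.
have n4 : - 4 != 0 :> R by rewrite oppr_eq0 pnatr_eq0.
have n2 : 2 != 0 :> R by rewrite pnatr_eq0.
split=> [b0|[h1 h2 h3 h4]].
  have [h1 h2 h3 h4] := cmb_inj (etrans (esym BC) (etrans b0 (esym (cmb0E p)))).
  split; [exact: N n4 h1|exact: N n4 h2|exact: N n2 h3|exact: N n2 h4].
apply: etrans BC (etrans _ (cmb0E p)).
have Z (c x : R) : x = 0 -> c * x = 0 by move=> ->; rewrite mulr0.
exact: cmb_congr (Z _ _ h1) (Z _ _ h2) (Z _ _ h3) (Z _ _ h4) (erefl 0).
Qed.

End MovingFrame.

(** * Consequences of the biharmonic equation *)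

Section BiharmonicW.
Variables (R : realType) (eps : R) (M : surface R) (E1 E2 : vfield M)
  (f k1 k2 al a1 a2 b1 b2 : M -> R).
Hypothesis SE : structure_equations eps E1 E2 f k1 k2 al a1 a2 b1 b2.
Local Notation D1 := (der E1).
Local Notation D2 := (der E2).
Local Notation X := (D1 f).
Local Notation Y := (D2 f).
Local Notation R2 := (R * R)%type.

Let sE1 := se_field1 SE. Let sE2 := se_field2 SE.
Let sf := se_f SE. Let sk1 := se_k1 SE. Let sk2 := se_k2 SE. Let sal := se_al SE.
Let sa1 := se_a1 SE. Let sa2 := se_a2 SE. Let sb1 := se_b1 SE. Let sb2 := se_b2 SE.
Let sX : msmooth X := msmooth_der sE1 sf.
Let sY : msmooth Y := msmooth_der sE2 sf.

Local Opaque mder.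

Lemma derD (Z : vfield M) (u w : M -> R) p : msmooth u -> msmooth w ->
  der Z (fun q => u q + w q) p = der Z u p + der Z w p.
Proof. exact: mderD. Qed.

Lemma derB (Z : vfield M) (u w : M -> R) p : msmooth u -> msmooth w ->
  der Z (fun q => u q - w q) p = der Z u p - der Z w p.
Proof. exact: mderB. Qed.

Lemma derM (Z : vfield M) (u w : M -> R) p : msmooth u -> msmooth w ->
  der Z (fun q => u q * w q) p = der Z u p * w p + u p * der Z w p.
Proof. exact: mderM. Qed.

Lemma derM_cst (Z : vfield M) (c : R) (u : M -> R) p : msmooth u ->
  der Z (fun q => c * u q) p = c * der Z u p.
Proof.
move=> su; rewrite derM //; last exact: msmooth_cst.
by rewrite {1}/der mder_cst mul0r add0r.
Qed.

Lemma der_cst (Z : vfield M) (c : R) p : der Z (fun _ : M => c) p = 0.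
Proof. exact: mder_cst. Qed.

Lemma der_eq (Z : vfield M) (u w : M -> R) p : (forall q, u q = w q) -> der Z u p = der Z w p.
Proof. by move=> uw; congr der; apply/funext. Qed.

Lemma frame_comm (u : M -> R) p : msmooth u ->
  D1 (D2 u) p - D2 (D1 u) p = a1 p * D1 u p + a2 p * D2 u p.
Proof.
move=> su; rewrite (der_comm p sE1 sE2 su) (se_bracket SE) mder_linear //.
by rewrite mderZv.
Qed.

Lemma der_k1 (Z : vfield M) p : der Z k1 p = 2 * der Z f p - der Z k2 p.
Proof.
rewrite -(derM_cst Z 2 p sf) -derB //; last by apply: msmoothM => //; exact: msmooth_cst.
by apply: der_eq => q; rewrite -(se_trace SE) addrK.
Qed.

Lemma der_k2 (Z : vfield M) p : der Z k2 p = 2 * der Z f p - der Z k1 p.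
Proof. by rewrite der_k1 opprB addrCA subrr addr0. Qed.

(** The Gaussian curvature, expressed by the Gauss equation. *)
Definition gaussK p := eps + k1 p * k2 p - al p ^+ 2.

Lemma gaussK_smooth : msmooth gaussK.
Proof.
apply: msmoothB; last exact: (msmoothM sal sal).
by apply: msmoothD; [exact: msmooth_cst|exact: msmoothM].
Qed.

Lemma der_gaussK (Z : vfield M) p :
  der Z gaussK p = der Z k1 p * k2 p + k1 p * der Z k2 p - 2 * al p * der Z al p.
Proof.
have sk := msmoothM sk1 sk2; have sa := msmoothM sal sal.
have se := msmooth_cst (M := M) eps.
have E : der Z gaussK p = der Z (fun q => eps + k1 q * k2 q - al q * al q) p by [].
rewrite E (derB Z p (msmoothD se sk) sa) (derD Z p se sk) der_cst (derM Z p sk1 sk2) (derM Z p sal sal).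
by move: (der Z k1 p) (der Z k2 p) (der Z al p) => x y z; ring.
Qed.

Local Notation biharmonic_at := (frame_biharmonic eps E1 E2 f k1 k2 al a1 a2 b1 b2).
Local Notation ode_at := (frame_ode eps E1 f k1 k2 al a2 b1).

Section Symmetric.
Hypotheses (a1_0 : forall p, a1 p = 0) (b2_0 : forall p, b2 p = 0)
  (Y_0 : forall p, Y p = 0).

Let der0 (Z : vfield M) (w : M -> R) p : (forall q, w q = 0) -> der Z w p = 0.
Proof. by move=> w0; rewrite (der_eq Z (w := fun=> 0) p w0) der_cst. Qed.

Lemma symmetric_bracket p : bracket E1 E2 p = a2 p *: E2 p.
Proof. by rewrite (se_bracket SE) a1_0 scale0r add0r. Qed.

Lemma symmetric_comm (w : M -> R) p : msmooth w ->
  D1 (D2 w) p - D2 (D1 w) p = a2 p * D2 w p.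
Proof. by move=> sw; rewrite (frame_comm p sw) a1_0 mul0r add0r. Qed.

(** Apart from [a2], all invariants are constant along [E2] by the structure
    equations alone. *)
Lemma symmetric_invariants p : [/\ D2 k1 p = 0, D2 k2 p = 0, D2 al p = 0, D2 b1 p = 0 &
  D2 X p = 0 /\ D2 gaussK p = 0].
Proof.
have [c1 c2 _ _] := se_codazzi SE p.
have h1 : D2 k1 p = 0 by rewrite c1 a1_0 b2_0 mul0r mulr0 addr0.
have h2 : D2 k2 p = 0 by rewrite der_k2 Y_0 h1 mulr0 subr0.
have h3 : D2 al p = 0 by rewrite c2 a1_0 b2_0 !(mulr0, mul0r) oppr0 addr0.
have h4 : D2 b1 p = 0.
  have := se_ricci SE p; rewrite (der0 E1 p b2_0) a1_0 b2_0 mul0r mulr0 sub0r addr0.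
  by move=> /eqP; rewrite oppr_eq0 => /eqP.
have h5 : D2 X p = 0.
  have := symmetric_comm p sf; rewrite (der0 E1 p Y_0) Y_0 mulr0 sub0r.
  by move=> /eqP; rewrite oppr_eq0 => /eqP.
split => //; split => //.
by rewrite der_gaussK h1 h2 h3 mul0r !mulr0 addr0 subr0.
Qed.

(** The four equations once [Y], [a1] and [b2] vanish; [3 * F - K2] is [F + K1] by the
    trace. *)
Lemma frame_ode_algebra (F K1 K2 AL A2 B1 x dx db : R) : F != 0 -> K1 + K2 = 2 * F ->
  [/\ (F + K1) * x + F * AL * B1 = 0, (F + K2) * 0 - F * AL * 0 = 0,
      dx + 0 + 0 * 0 - A2 * x - F * (B1 ^+ 2 + 0 ^+ 2 + K1 ^+ 2 + K2 ^+ 2 - 2 * eps) = 0 &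
      2 * x * B1 + 2 * 0 * 0 + F * db + F * 0 + 0 * F * 0 - A2 * F * B1 - F * AL * (K1 - K2) = 0]
  <-> [/\ (3 * F - K2) * x = - (F * AL * B1),
      dx = A2 * x + F * (B1 ^+ 2 + K1 ^+ 2 + K2 ^+ 2 - 2 * eps) &
      db = - (2 * B1 / F) * x + A2 * B1 - AL * (K2 - K1)].
Proof.
move=> F0 tr; have EK : K2 = 2 * F - K1 by rewrite -tr addrAC subrr add0r.
subst K2; split=> [[h1 _ h3 h4]|[h1 h3 h4]].
  split; apply/eqP.
  - by rewrite -subr_eq0 -h1; apply/eqP; ring.
  - by rewrite -subr_eq0 -h3; apply/eqP; ring.
  - by rewrite -subr_eq0 -(mulr0 F^-1) -h4; apply/eqP; field.
split.
- apply: etrans (_ : (3 * F - (2 * F - K1)) * x + F * AL * B1 = 0); last by rewrite h1 addNr.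
  ring.
- ring.
- rewrite h3; ring.
- rewrite h4; field.
  exact: F0.
Qed.

(** Gauss and Codazzi account for the equations of the system that do not come from
    the biharmonic equation. *)
Lemma frame_biharmonic_ode p : biharmonic_at p <-> ode_at p.
Proof.
have A := frame_ode_algebra (al p) (a2 p) (b1 p) (X p) (D1 X p) (D1 b1 p)
  (lt0r_neq0 (se_f0 SE p)) (se_trace SE p).
have [_ _ c3 c4] := se_codazzi SE p; have g := se_gauss SE p.
rewrite /frame_biharmonic Y_0 a1_0 b2_0 (der0 E2 p Y_0) (der0 E2 p b2_0).
rewrite (der0 E2 p a1_0) a1_0 subr0 expr0n addr0 in g.
have EK : k1 p = 2 * f p - k2 p by rewrite -(se_trace SE) addrK.
have e1 : D1 a2 p = eps + k2 p * (2 * f p - k2 p) - al p ^+ 2 + a2 p ^+ 2.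
  by rewrite g EK [k2 p * _]mulrC.
have e2 : D1 k2 p = 2 * a2 p * (k2 p - f p) - al p * b1 p.
  by rewrite c3 EK; move: (k2 p) (f p) (a2 p) (al p) (b1 p) => *; ring.
apply: iff_trans A _; split=> [[h1 h2 h3]|[_ h1 _ _ [h2 h3]]].
  by split; [exact: e1|exact: h1|exact: c4|exact: e2|split; [exact: h2|exact: h3]].
by split; [exact: h1|exact: h2|exact: h3].
Qed.

End Symmetric.

Hypothesis biharm : forall p, biharmonic_at p.
Hypothesis grad0 : forall p, X p != 0 \/ Y p != 0.
Hypothesis a20 : forall p, a2 p != 0.
Hypothesis W : exists W : R2 -> R, [/\ smooth_on setT W,
  forall z, exists v, 'D_v W z != 0 & forall p, W (f p, gaussK p) = 0].
Hypothesis K0 : forall p, 3 * f p ^+ 2 + gaussK p - eps != 0.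

(** By the Gauss equation this function of [f] and the curvature measures the
    deviation from umbilicity: it is [(k1 - k2) ^+ 2 + 4 * al ^+ 2]. *)
Let discr p := 4 * (f p ^+ 2 - gaussK p + eps).

Lemma discr_gt0 p : 0 < discr p.
Proof.
have -> : discr p = (k1 p - k2 p) ^+ 2 + 4 * al p ^+ 2.
  rewrite /discr /gaussK; have : f p = (k1 p + k2 p) / 2 by rewrite (se_trace SE) mulrC mulKf ?pnatr_eq0.
  by move=> ->; field.
have : 0 < (k1 p - k2 p) ^+ 2 by rewrite exprn_even_gt0 //= subr_eq0 (se_k12 SE).
have : 0 <= al p ^+ 2 by exact: sqr_ge0.
by lra.
Qed.

Lemma gaussK_gradient_algebra (F K1 K2 AL A1 A2 B1 B2 x y dk11 dk12 dk21 dk22 dal1 dal2 e : R) :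
  K1 + K2 = 2 * F -> dk11 = 2 * x - dk12 -> dk22 = 2 * y - dk21 ->
  dk21 = A1 * (K2 - K1) + AL * B2 -> dal2 = - (2 * A1 * AL) - K1 * B2 ->
  dk12 = A2 * (K2 - K1) - AL * B1 -> dal1 = 2 * AL * A2 + K2 * B1 ->
  (F + K1) * x + F * AL * B1 = 0 -> (F + K2) * y - F * AL * B2 = 0 ->
  let d := 4 * (F ^+ 2 - (e + K1 * K2 - AL ^+ 2) + e) in
  dk11 * K2 + K1 * dk12 - 2 * AL * dal1 = 6 * F * x - A2 * d /\
  dk21 * K2 + K1 * dk22 - 2 * AL * dal2 = 6 * F * y + A1 * d.
Proof.
move=> tr -> -> -> -> -> -> h1 h2 d; have EK : K2 = 2 * F - K1 by rewrite -tr addrAC subrr add0r.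
subst K2; rewrite /d; split.
  by apply/eqP; rewrite -subr_eq0 -[X in _ == X](mulr0 (-2)) -h1; apply/eqP; ring.
by apply/eqP; rewrite -subr_eq0 -[X in _ == X](mulr0 (-2)) -h2; apply/eqP; ring.
Qed.

(** For a biharmonic surface the gradient of the curvature is explicit: this
    combines Codazzi with the tangential part of the biharmonic equation. *)
Lemma gaussK_gradient p : D1 gaussK p = 6 * f p * X p - a2 p * discr p /\
  D2 gaussK p = 6 * f p * Y p + a1 p * discr p.
Proof.
have [c1 c2 c3 c4] := se_codazzi SE p; have [h1 h2 _ _] := biharm p.
have [g1 g2] := gaussK_gradient_algebra eps (se_trace SE p) (der_k1 E1 p) (der_k2 E2 p) c1 c2 c3 c4 h1 h2.
by split; [exact: etrans (der_gaussK E1 p) g1|exact: etrans (der_gaussK E2 p) g2].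
Qed.

(** The chain rule for [Wf \o (u, w)], which is constant. *)
Lemma mder_relation (Wf : R2 -> R) (u w : M -> R) p v :
  smooth_on setT Wf -> msmooth u -> msmooth w -> (forall q, Wf (u q, w q) = 0) ->
  mder u p v * 'D_(ex R) Wf (u p, w p) + mder w p v * 'D_(ey R) Wf (u p, w p) = 0.
Proof.
move=> sW su sw Wuw; set c := chart_at p; set z := cmap c p.
have du := msmooth_differentiable0 p su; have dw := msmooth_differentiable0 p sw.
have dp := differentiable_pair du dw.
have pc : cinv c z = p := cmapK (chart_at_dom p).
have dW : differentiable Wf ((fun y => (u (cinv c y), w (cinv c y))) z) by exact: (smooth_onS sW).
have E := derive_comp v dp dW.
have Z : 'D_v (Wf \o (fun y => (u (cinv c y), w (cinv c y)))) z = 0.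
  have -> : Wf \o (fun y => (u (cinv c y), w (cinv c y))) = fun=> 0.
    by apply/funext => y; rewrite /= Wuw.
  exact: derive_cst.
have F := etrans (esym E) Z; rewrite (derive_plane _ dW) -(derive_fst v dp) -(derive_snd v dp) in F.
move: F; rewrite /= pc; exact.
Qed.

(** The relation has a nonzero gradient, so the gradients of [f] and the curvature
    are linearly dependent. *)
Lemma W_relation p : X p * D2 gaussK p - Y p * D1 gaussK p = 0.
Proof.
have [Wf [sW nW Wz]] := W.
have h1 := mder_relation p (E1 p) sW sf gaussK_smooth Wz.
have h2 := mder_relation p (E2 p) sW sf gaussK_smooth Wz.
have [v Wv] := nW (f p, gaussK p).
rewrite derive_plane in Wv; last exact: (smooth_onS sW).
move: h1 h2 Wv; rewrite -/(D1 f p) -/(D2 f p) -/(D1 gaussK p) -/(D2 gaussK p).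
move: (D1 f p) (D2 f p) (D1 gaussK p) (D2 gaussK p) ('D_(ex R) Wf _) ('D_(ey R) Wf _) => x y c d m n h1 h2 Wv.
apply/eqP; apply: contraNT Wv => xd.
have m0 : m = 0.
  apply: (mulfI xd); rewrite mulr0.
  have -> : (x * d - y * c) * m = d * (x * m + c * n) - c * (y * m + d * n) by ring.
  by rewrite h1 h2 !mulr0 subrr.
have n0 : n = 0.
  apply: (mulfI xd); rewrite mulr0.
  have -> : (x * d - y * c) * n = x * (y * m + d * n) - y * (x * m + c * n) by ring.
  by rewrite h1 h2 !mulr0 subrr.
by rewrite m0 n0 !scaler0 addr0.
Qed.

(** In the determinant of the two gradients the terms [6 * f * X] and [6 * f * Y]
    cancel, and the positive factor [discr] can be divided out. *)
Lemma gradient_relation p : a1 p * X p + a2 p * Y p = 0.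
Proof.
have := W_relation p; have [-> ->] := gaussK_gradient p.
move: (discr_gt0 p); move: (discr p) (X p) (Y p) (a1 p) (a2 p) (f p) => d x y A1 A2 F d0 h.
apply: (mulfI (lt0r_neq0 d0)); rewrite mulr0 -h; ring.
Qed.

Lemma X_neq0 p : X p != 0.
Proof.
have [//|Y0] := grad0 p; apply/eqP => X0; have := gradient_relation p.
rewrite X0 mulr0 add0r => /eqP; rewrite mulf_eq0 (negbTE (a20 p)) (negbTE Y0).
by [].
Qed.

(** By [gradient_relation] the bracket of the frame annihilates [f]. *)
Lemma mixed_derivative p : D1 Y p = D2 X p.
Proof.
by have := frame_comm p sf; rewrite gradient_relation => /eqP; rewrite subr_eq0 => /eqP.
Qed.

Let sdiscr : msmooth discr.
Proof.
have sq := msmoothM sf sf.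
exact: (msmoothM (msmooth_cst (M := M) (4 : R))
  (msmoothD (msmoothB sq gaussK_smooth) (msmooth_cst (M := M) eps))).
Qed.

Lemma der_discr (Z : vfield M) p : der Z discr p = 8 * f p * der Z f p - 4 * der Z gaussK p.
Proof.
have sq := msmoothM sf sf; have sd := msmoothB sq gaussK_smooth.
have se := msmooth_cst (M := M) eps.
have E : der Z discr p = der Z (fun q => 4 * (f q * f q - gaussK q + eps)) p by [].
rewrite E (derM_cst Z 4 p (msmoothD sd se)) (derD Z p sd se) (derB Z p sq gaussK_smooth).
rewrite (derM Z p sf sf) der_cst.
by move: (der Z f p) (der Z gaussK p) => x y; ring.
Qed.

Lemma divergence_algebra (F x y A1 A2 d dK1 dK2 dY dX da1 da2 dd1 dd2 : R) :
  A1 * x + A2 * y = 0 -> dY = dX -> 0 < d ->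
  dK1 = 6 * F * x - A2 * d -> dK2 = 6 * F * y + A1 * d ->
  dd1 = 8 * F * x - 4 * dK1 -> dd2 = 8 * F * y - 4 * dK2 ->
  (6 * (x * y + F * dY) + (da1 * d + A1 * dd1)) - (6 * (y * x + F * dX) - (da2 * d + A2 * dd2))
    = A1 * dK1 + A2 * dK2 -> da1 + da2 = 0.
Proof.
move=> g -> d0 -> -> -> ->.
have -> : A1 * (6 * F * x - A2 * d) + A2 * (6 * F * y + A1 * d) = 6 * F * (A1 * x + A2 * y) by ring.
rewrite g mulr0 => h; apply: (mulfI (lt0r_neq0 d0)); rewrite mulr0 -h.
have -> : A1 * (8 * F * x - 4 * (6 * F * x - A2 * d)) = -16 * F * (A1 * x) + 4 * A1 * A2 * d by ring.
have -> : A2 * (8 * F * y - 4 * (6 * F * y + A1 * d)) = -16 * F * (A2 * y) - 4 * A1 * A2 * d by ring.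
have -> : A1 * x = - (A2 * y) by apply/eqP; rewrite -addr_eq0; apply/eqP.
ring.
Qed.

(** The commutator applied to the curvature, whose derivatives are given by
    [gaussK_gradient]. *)
Lemma divergence_relation p : D1 a1 p + D2 a2 p = 0.
Proof.
have F1 : D1 gaussK = fun q => 6 * (f q * X q) - a2 q * discr q.
  by apply/funext => q; have [-> _] := gaussK_gradient q; rewrite mulrA.
have F2 : D2 gaussK = fun q => 6 * (f q * Y q) + a1 q * discr q.
  by apply/funext => q; have [_ ->] := gaussK_gradient q; rewrite mulrA.
have sfX := msmoothM sf sX; have sfY := msmoothM sf sY.
have s6 := msmooth_cst (M := M) (6 : R).
have G2 : D1 (D2 gaussK) p = 6 * (X p * Y p + f p * D1 Y p) + (D1 a1 p * discr p + a1 p * D1 discr p).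
  rewrite F2 (derD E1 p (msmoothM s6 sfY) (msmoothM sa1 sdiscr)) (derM_cst E1 6 p sfY).
  by rewrite (derM E1 p sf sY) (derM E1 p sa1 sdiscr).
have G1 : D2 (D1 gaussK) p = 6 * (Y p * X p + f p * D2 X p) - (D2 a2 p * discr p + a2 p * D2 discr p).
  rewrite F1 (derB E2 p (msmoothM s6 sfX) (msmoothM sa2 sdiscr)) (derM_cst E2 6 p sfX).
  by rewrite (derM E2 p sf sX) (derM E2 p sa2 sdiscr).
have C := frame_comm p gaussK_smooth.
have [g1 g2] := gaussK_gradient p.
have C' := etrans (congr2 (fun x y => x - y) (esym G2) (esym G1)) C.
exact: (divergence_algebra (gradient_relation p) (mixed_derivative p) (discr_gt0 p) g1 g2
  (der_discr E1 p) (der_discr E2 p) C').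
Qed.


(** The point of the function [f * (k1 - f)]: by Codazzi and the biharmonic equation
    its derivatives involve neither [al] nor the normal connection. *)
Lemma shape_potential_algebra (F K1 K2 AL A1 A2 B1 B2 x y dk11 dk12 dk21 : R) :
  K1 + K2 = 2 * F -> dk11 = 2 * x - dk12 ->
  dk21 = A1 * (K2 - K1) + AL * B2 -> dk12 = A2 * (K2 - K1) - AL * B1 ->
  (F + K1) * x + F * AL * B1 = 0 -> (F + K2) * y - F * AL * B2 = 0 ->
  x * (K1 - F) + F * (dk11 - x) = 2 * A2 * (F * (K1 - F)) - F * x /\
  y * (K1 - F) + F * (dk21 - y) = - (2 * A1 * (F * (K1 - F))) + F * y.
Proof.
move=> tr -> -> -> h1 h2; have EK : K2 = 2 * F - K1 by rewrite -tr addrAC subrr add0r.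
subst K2; split.
  by apply/eqP; rewrite -subr_eq0 -h1; apply/eqP; ring.
by apply/eqP; rewrite -subr_eq0 -[X in _ == X]oppr0 -h2; apply/eqP; ring.
Qed.

Let u p := f p * (k1 p - f p).
Let skf : msmooth (fun p => k1 p - f p). Proof. exact: msmoothB. Qed.
Let su : msmooth u. Proof. exact: msmoothM sf skf. Qed.

Let der_u p : D1 u p = 2 * (a2 p * u p) - f p * X p /\
  D2 u p = f p * Y p - 2 * (a1 p * u p).
Proof.
have [c1 _ c3 _] := se_codazzi SE p; have [h1 h2 _ _] := biharm p.
have [g1 g2] := shape_potential_algebra (se_trace SE p) (der_k1 E1 p) c1 c3 h1 h2.
have G (Z : vfield M) : der Z u p = der Z f p * (k1 p - f p) + f p * (der Z k1 p - der Z f p).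
  by rewrite (derM Z p sf skf) (derB Z p sk1 sf).
split.
  by rewrite G g1 -mulrA.
by rewrite G g2 -mulrA addrC.
Qed.

Lemma mixed_value_algebra (F x y A1 A2 v d1u d2u da1 da2 dY dX : R) :
  A1 * x + A2 * y = 0 -> dY = dX -> da1 + da2 = 0 ->
  d1u = 2 * (A2 * v) - F * x -> d2u = F * y - 2 * (A1 * v) ->
  (x * y + F * dY - 2 * (da1 * v + A1 * d1u)) - (2 * (da2 * v + A2 * d2u) - (y * x + F * dX))
  = A1 * d1u + A2 * d2u -> F * dY = 3 * F * A2 * y - x * y.
Proof.
move=> g <- dv -> ->; have -> : da2 = - da1 by apply/eqP; rewrite -addr_eq0 addrC dv.
have Eg : A1 * x = - (A2 * y) by apply/eqP; rewrite -addr_eq0 g.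
move=> h; apply: (mulfI (_ : 2 != 0)); first by rewrite pnatr_eq0.
have E : 2 * (F * dY) - 2 * (3 * F * A2 * y - x * y) =
  ((x * y + F * dY - 2 * (da1 * v + A1 * (2 * (A2 * v) - F * x))) -
   (2 * (- da1 * v + A2 * (F * y - 2 * (A1 * v))) - (y * x + F * dY)))
  - (A1 * (2 * (A2 * v) - F * x) + A2 * (F * y - 2 * (A1 * v))) - 3 * F * (A1 * x + A2 * y) by ring.
by apply/eqP; rewrite -subr_eq0 E h g subrr mulr0 subr0.
Qed.

(** The commutator applied to [f * (k1 - f)] gives a second expression for the
    mixed derivative of [f]. *)
Lemma mixed_derivative_value p : f p * D1 Y p = 3 * f p * a2 p * Y p - X p * Y p.
Proof.
have F1 : D1 u = fun q => 2 * (a2 q * u q) - f q * X q.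
  by apply/funext => q; have [-> _] := der_u q.
have F2 : D2 u = fun q => f q * Y q - 2 * (a1 q * u q).
  by apply/funext => q; have [_ ->] := der_u q.
have sfX := msmoothM sf sX; have sfY := msmoothM sf sY.
have s2 := msmooth_cst (M := M) (2 : R).
have s1u := msmoothM sa1 su; have s2u := msmoothM sa2 su.
have G2 : D1 (D2 u) p = X p * Y p + f p * D1 Y p - 2 * (D1 a1 p * u p + a1 p * D1 u p).
  rewrite F2 (derB E1 p sfY (msmoothM s2 s1u)) (derM_cst E1 2 p s1u).
  by rewrite (derM E1 p sf sY) (derM E1 p sa1 su).
have G1 : D2 (D1 u) p = 2 * (D2 a2 p * u p + a2 p * D2 u p) - (Y p * X p + f p * D2 X p).
  rewrite F1 (derB E2 p (msmoothM s2 s2u) sfX) (derM_cst E2 2 p s2u).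
  by rewrite (derM E2 p sf sX) (derM E2 p sa2 su).
have [g1 g2] := der_u p.
have C := etrans (congr2 (fun x y => x - y) (esym G2) (esym G1)) (frame_comm p su).
exact: (mixed_value_algebra (gradient_relation p) (mixed_derivative p) (divergence_relation p) g1 g2 C).
Qed.

Lemma normal_torsion_algebra (F K1 K2 AL A1 A2 B1 B2 x y dY dX dk12 dk21 dal1 dal2 db1 db2 : R) :
  K1 + K2 = 2 * F ->
  dk21 = A1 * (K2 - K1) + AL * B2 -> dal2 = - (2 * A1 * AL) - K1 * B2 ->
  dk12 = A2 * (K2 - K1) - AL * B1 -> dal1 = 2 * AL * A2 + K2 * B1 ->
  db2 - db1 = A1 * B1 + A2 * B2 ->
  (F + K1) * x + F * AL * B1 = 0 -> (F + K2) * y - F * AL * B2 = 0 ->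
  A1 * x + A2 * y = 0 -> dY = dX -> F * dY = 3 * F * A2 * y - x * y ->
  (x + dk12) * y + (F + K2) * dY = (x * AL + F * dal1) * B2 + (F * AL) * db2 ->
  (y + dk21) * x + (F + K1) * dX = - ((y * AL + F * dal2) * B1 + (F * AL) * db1) ->
  F ^+ 2 * (B1 * B2) = - (x * y).
Proof.
move=> tr -> -> -> -> r h1 h2 g <- m e1 e2.
have EK : K2 = 2 * F - K1 by rewrite -tr addrAC subrr add0r.
have Er : db2 = db1 + (A1 * B1 + A2 * B2) by rewrite -r addrC subrK.
subst K2 db2; apply: (mulfI (_ : 2 != 0)); first by rewrite pnatr_eq0.
have z1 : (x + (A2 * (2 * F - K1 - K1) - AL * B1)) * y + (F + (2 * F - K1)) * dY
  - ((x * AL + F * (2 * AL * A2 + (2 * F - K1) * B1)) * B2 + F * AL * (db1 + (A1 * B1 + A2 * B2))) = 0.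
  by rewrite e1 subrr.
have z2 : (y + (A1 * (2 * F - K1 - K1) + AL * B2)) * x + (F + K1) * dY
  + ((y * AL + F * (- (2 * A1 * AL) - K1 * B2)) * B1 + F * AL * db1) = 0.
  by rewrite e2 addNr.
have z3 : F * dY - (3 * F * A2 * y - x * y) = 0 by rewrite m subrr.
apply/eqP; rewrite -subr_eq0.
set A := (X in X = 0) in z1; set B := (X in X = 0) in z2; set C := (X in X = 0) in z3.
set D := (X in X = 0) in h1; set E := (X in X = 0) in h2; set G := (X in X = 0) in g.
have -> : 2 * (F ^+ 2 * (B1 * B2)) - 2 * - (x * y) =
  - A - B + 4 * C + (-(3 * A1)) * D + 3 * A2 * E + (5 * F + K1) * G.
  rewrite /A /B /C /D /E /G; ring.
by rewrite z1 z2 z3 h1 h2 g !mulr0 !oppr0 !addr0.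
Qed.

(** The Ricci equation, with the normal connection form eliminated by the
    tangential part of the biharmonic equation. *)
Lemma normal_torsion p : f p ^+ 2 * (b1 p * b2 p) = - (X p * Y p).
Proof.
have sfk1 := msmoothD sf sk1; have sfk2 := msmoothD sf sk2; have sfal := msmoothM sf sal.
have F2 : (fun q => (f q + k2 q) * Y q) = fun q => f q * al q * b2 q.
  by apply/funext => q; have [_ /eqP h _ _] := biharm q; move: h; rewrite subr_eq0 => /eqP.
have F1 : (fun q => (f q + k1 q) * X q) = fun q => - (f q * al q * b1 q).
  by apply/funext => q; have [/eqP h _ _ _] := biharm q; move: h; rewrite addr_eq0 => /eqP.
have e1 : (X p + D1 k2 p) * Y p + (f p + k2 p) * D1 Y p =
    (X p * al p + f p * D1 al p) * b2 p + f p * al p * D1 b2 p.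
  have := congr1 (fun w => D1 w p) F2; rewrite (derM E1 p sfk2 sY) (derD E1 p sf sk2).
  by rewrite (derM E1 p sfal sb2) (derM E1 p sf sal).
have e2 : (Y p + D2 k1 p) * X p + (f p + k1 p) * D2 X p =
    - ((Y p * al p + f p * D2 al p) * b1 p + f p * al p * D2 b1 p).
  have := congr1 (fun w => D2 w p) F1; rewrite (derM E2 p sfk1 sX) (derD E2 p sf sk1).
  rewrite /der (mderN _ _ (msmoothM sfal sb1)) -/(der E2 _ p).
  by rewrite -/(der E2 (fun q => f q * al q * b1 q) p) (derM E2 p sfal sb1) (derM E2 p sf sal).
have [c1 c2 c3 c4] := se_codazzi SE p; have [h1 h2 _ _] := biharm p.
exact: (normal_torsion_algebra (se_trace SE p) c1 c2 c3 c4 (se_ricci SE p) h1 h2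
  (gradient_relation p) (mixed_derivative p) (mixed_derivative_value p) e1 e2).
Qed.

(** Multiplying [normal_torsion] by [AL ^+ 2] makes both factors [F * AL * B1] and
    [F * AL * B2] available. *)
Lemma Y_eq0_algebra (F K1 K2 AL B1 B2 x y e : R) : K1 + K2 = 2 * F ->
  (F + K1) * x + F * AL * B1 = 0 -> (F + K2) * y - F * AL * B2 = 0 ->
  F ^+ 2 * (B1 * B2) = - (x * y) ->
  x * y * (3 * F ^+ 2 + (e + K1 * K2 - AL ^+ 2) - e) = 0.
Proof.
move=> tr h1 h2 h3; have EK : K2 = 2 * F - K1 by rewrite -tr addrAC subrr add0r.
subst K2.
have z3 : F ^+ 2 * (B1 * B2) + x * y = 0 by rewrite h3 addNr.
set A := (X in X = 0) in h1; set B := (X in X = 0) in h2; set C := (X in X = 0) in z3.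
have -> : x * y * (3 * F ^+ 2 + (e + K1 * (2 * F - K1) - AL ^+ 2) - e) =
  (F + (2 * F - K1)) * y * A - F * AL * B1 * B - AL ^+ 2 * C.
  rewrite /A /B /C; ring.
by rewrite h1 h2 z3 !mulr0 !subr0.
Qed.

Lemma Y_eq0 p : Y p = 0.
Proof.
have [h1 h2 _ _] := biharm p.
have := Y_eq0_algebra eps (se_trace SE p) h1 h2 (normal_torsion p).
rewrite -/(gaussK p) => /eqP; rewrite mulf_eq0 (negbTE (K0 p)) orbF mulf_eq0 (negbTE (X_neq0 p)).
by move=> /eqP.
Qed.

Lemma a1_eq0 p : a1 p = 0.
Proof.
have := gradient_relation p; rewrite Y_eq0 mulr0 addr0 => /eqP.
by rewrite mulf_eq0 (negbTE (X_neq0 p)) orbF => /eqP.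
Qed.

Lemma b2_eq0 p : b2 p = 0.
Proof.
have [_ h2 _ _] := biharm p; move: h2; rewrite Y_eq0 mulr0 sub0r => /eqP.
rewrite oppr_eq0 !mulf_eq0 (negbTE (lt0r_neq0 (se_f0 SE p))) (negbTE (se_al0 SE p)).
by move=> /eqP.
Qed.

Lemma D2a2_eq0 p : D2 a2 p = 0.
Proof.
have := divergence_relation p.
by rewrite (der_eq E1 (w := fun=> 0) p a1_eq0) der_cst add0r.
Qed.

End BiharmonicW.
(** * Straightening a frame in the plane *)

Section Straightening.
Variable R : realType.
Local Notation R2 := (R * R)%type.
Implicit Types (e : R2 -> R2) (u A B b : R2 -> R).

Lemma derive_pairing (e : R2 -> R2) (P Q : R2 -> R) y v :
  differentiable e y -> differentiable P y -> differentiable Q y ->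
  'D_v (fun z => (e z).1 * P z + (e z).2 * Q z) y =
  (('D_v e y).1 * P y + ('D_v e y).2 * Q y)
  + ((e y).1 * (v.1 * 'D_(ex R) P y + v.2 * 'D_(ey R) P y)
  + (e y).2 * (v.1 * 'D_(ex R) Q y + v.2 * 'D_(ey R) Q y)).
Proof.
move=> de dP dQ.
have de1 : differentiable (fun z => (e z).1) y.
  apply: differentiable_comp => //; apply: linear_differentiable; exact: fst_continuous.
have de2 : differentiable (fun z => (e z).2) y.
  apply: differentiable_comp => //; apply: linear_differentiable; exact: snd_continuous.
have [d1' E1] := differentiable_scale de1 dP.
have [d2' E2] := differentiable_scale de2 dQ.
rewrite (deriveD (diff_derivable d1') (diff_derivable d2')) E1 E2.
rewrite (derive_fst v de) (derive_snd v de) (derive_plane v dP) (derive_plane v dQ).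
by rewrite addrACA.
Qed.

(** Cartan's formula for the exterior derivative of the form [P dx + Q dy] on the
    frame [(a1, a2)], [(c1, c2)], whose bracket is [k] times the second vector. *)
Lemma closedness_algebra (a1 a2 c1 c2 P Q Px Py Qx Qy s1 s2 t1 t2 k : R) :
  a1 * c2 - a2 * c1 != 0 ->
  s1 - t1 = k * c1 -> s2 - t2 = k * c2 ->
  (s1 * P + s2 * Q + (c1 * (a1 * Px + a2 * Py) + c2 * (a1 * Qx + a2 * Qy)))
  - (t1 * P + t2 * Q + (a1 * (c1 * Px + c2 * Py) + a2 * (c1 * Qx + c2 * Qy)))
  = k * (c1 * P + c2 * Q) -> Py = Qx.
Proof.
move=> J0 h1 h2 h; apply/eqP; rewrite eq_sym -subr_eq0; apply/eqP.
apply: (mulfI J0); rewrite mulr0.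
have Es : s1 = k * c1 + t1 by rewrite -h1 subrK.
have Et : s2 = k * c2 + t2 by rewrite -h2 subrK.
subst s1 s2; move/eqP: h; rewrite -subr_eq0 => /eqP <-; ring.
Qed.

(** The system [e1 u = A], [e2 u = B] is the closedness of a 1-form whose
    values on the frame are [A] and [B]. *)
Lemma frame_primitive (U : set R2) e1 e2 b A B (z0 : R2) :
  open U -> U z0 -> smooth_on U e1 -> smooth_on U e2 ->
  (forall y, U y -> det2 (e1 y) (e2 y) != 0) ->
  (forall y, U y -> 'D_(e1 y) e2 y - 'D_(e2 y) e1 y = b y *: e2 y) ->
  smooth_on U A -> smooth_on U B ->
  (forall y, U y -> 'D_(e1 y) B y - 'D_(e2 y) A y = b y * B y) ->
  exists r : R, exists u, [/\ 0 < r, [set y : R2 | `|y - z0| < r] `<=` U,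
    smooth_on [set y : R2 | `|y - z0| < r] u &
    forall y, `|y - z0| < r -> 'D_(e1 y) u y = A y /\ 'D_(e2 y) u y = B y].
Proof.
move=> oU Uz s1 s2 J0 br sA sB AB.
have s11 := smooth_on_fst oU s1; have s12 := smooth_on_snd oU s1.
have s21 := smooth_on_fst oU s2; have s22 := smooth_on_snd oU s2.
have sJ := smooth_onV oU J0 (smooth_onB oU (smooth_onM oU s11 s22) (smooth_onM oU s12 s21)).
(* The coefficients of the form, by Cramer's rule. *)
pose P y := (A y * (e2 y).2 - B y * (e1 y).2) * (det2 (e1 y) (e2 y))^-1.
pose Q y := (B y * (e1 y).1 - A y * (e2 y).1) * (det2 (e1 y) (e2 y))^-1.
have sP : smooth_on U P := smooth_onM oU (smooth_onB oU (smooth_onM oU sA s22) (smooth_onM oU sB s12)) sJ.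
have sQ : smooth_on U Q := smooth_onM oU (smooth_onB oU (smooth_onM oU sB s11) (smooth_onM oU sA s21)) sJ.
have EA y : U y -> (e1 y).1 * P y + (e1 y).2 * Q y = A y.
  move=> /J0; rewrite /P /Q /det2.
  by move: (e1 y) (e2 y) (A y) (B y) => [? ?] [? ?] /= a c0 J; field.
have EB y : U y -> (e2 y).1 * P y + (e2 y).2 * Q y = B y.
  move=> /J0; rewrite /P /Q /det2.
  by move: (e1 y) (e2 y) (A y) (B y) => [? ?] [? ?] /= a c0 J; field.
have closed_form y : U y -> 'D_(ey R) P y = 'D_(ex R) Q y.
  move=> Uy; have dP := smooth_onS sP Uy; have dQ := smooth_onS sQ Uy.
  have d1 := smooth_onS s1 Uy; have d2 := smooth_onS s2 Uy.
  have GA v : 'D_v A y = 'D_v (fun z => (e1 z).1 * P z + (e1 z).2 * Q z) y.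
    by apply: near_eq_derive; apply: (open_near oU Uy) => z Uz'; rewrite EA.
  have GB v : 'D_v B y = 'D_v (fun z => (e2 z).1 * P z + (e2 z).2 * Q z) y.
    by apply: near_eq_derive; apply: (open_near oU Uy) => z Uz'; rewrite EB.
  have C := AB y Uy; rewrite GA GB (derive_pairing _ d1 dP dQ) (derive_pairing _ d2 dP dQ) -(EB _ Uy) in C.
  have Br := br y Uy.
  exact: (closedness_algebra (J0 y Uy) (congr1 fst Br) (congr1 snd Br) C).
have [rho rho0 sub] : exists2 rho, 0 < rho & [set y : R2 | `|y - z0| < rho] `<=` U.
  have /nbhs_ballP[rho /= rho0 H] : nbhs z0 U by apply: open_nbhs_nbhs.
  exists rho => // y /= yr; apply: H; rewrite -ball_normE /=.
  by rewrite distrC.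
have [r [u [/andP[r0 rrho] su du]]] := closed_form_primitive rho0 (smooth_on_sub sub sP)
  (smooth_on_sub sub sQ) (fun y yr => closed_form y (sub y yr)).
have sub' : [set y : R2 | `|y - z0| < r] `<=` U by move=> y /= yr; apply: sub; exact: lt_trans yr rrho.
exists r, u; split=> // y yr.
by rewrite !du // EA ?EB //; exact: sub'.
Qed.

Lemma constant_along_ey (u : R2 -> R) (w0 w : R2) r :
  (forall y, `|y - w0| < r -> differentiable u y /\ 'D_(ey R) u y = 0) ->
  `|w - w0| < r -> u w = u (w.1, w0.2).
Proof.
move=> du wr; pose v : R2 := (0, w.2 - w0.2); pose z : R2 := (w.1, w0.2).
have vz : v + z = w by rewrite /v /z; apply: injective_projections; rewrite /= ?add0r ?subrK.
have inB (t : R) : 0 <= t <= 1 -> `|t *: v + z - w0| < r.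
  move=> /andP[t0 t1]; apply: le_lt_trans wr; apply: norm_pair_le; rewrite /= /GRing.scale /=.
    by rewrite mulr0 add0r; exact: (norm_fst (w - w0)).
  rewrite addrK normrM (ger0_norm t0); apply: le_trans (norm_snd (w - w0)).
  by rewrite ler_piMl.
have [t t01] := @mean_value_segment R R2 u z v (fun t tt => (du _ (inB t tt)).1).
have [dt Dt] := du _ (inB t t01).
rewrite vz (derive_plane v dt) Dt scaler0 addr0 /= scale0r => /eqP.
by rewrite subr_eq0 => /eqP.
Qed.

Lemma det_neq0 (h : R) (v w p q : R2) : h != 0 ->
  v.1 *: p + v.2 *: q = ex R -> w.1 *: p + w.2 *: q = h *: ey R ->
  p.1 * q.2 - p.2 * q.1 != 0.
Proof.
case: v => [a1 a2]; case: w => [c1 c2]; case: p q => [p1 p2] [m n] h0 /= E1 E2.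
have := congr1 fst E1; have := congr1 snd E1; have := congr1 fst E2; have := congr1 snd E2.
rewrite /= /GRing.scale /= mulr0 mulr1 => x1 x2 x3 x4.
apply: contra_neq h0 => j0.
have <- : (a1 * p1 + a2 * m) * (c1 * p2 + c2 * n) - (a1 * p2 + a2 * n) * (c1 * p1 + c2 * m) = h.
  by rewrite x1 x2 x3 x4 mul1r mul0r subr0.
rewrite (_ : _ - _ = (a1 * c2 - a2 * c1) * (p1 * n - p2 * m)); last by ring.
by rewrite j0 mulr0.
Qed.

(** Coordinates [(s, t)] with [e1 = d/ds] and [e2 = h(s) d/dt]: the functions
    [s], [log h], [t] have the derivatives [(1, 0)], [(b, 0)], [(0, h)] along
    the frame, and each of these pairs satisfies the integrability condition. *)
Theorem straightening (U : set R2) e1 e2 b (z0 : R2) :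
  open U -> U z0 -> smooth_on U e1 -> smooth_on U e2 ->
  (forall y, U y -> det2 (e1 y) (e2 y) != 0) ->
  (forall y, U y -> 'D_(e1 y) e2 y - 'D_(e2 y) e1 y = b y *: e2 y) ->
  smooth_on U b -> (forall y, U y -> 'D_(e2 y) b y = 0) ->
  exists Psi G : R2 -> R2, exists r : R, exists N : set R2, exists h : R -> R,
  [/\ 0 < r, open N, N `<=` U & N z0] /\
  [/\ forall y, N y -> `|Psi y - Psi z0| < r /\ G (Psi y) = y,
      forall w, `|w - Psi z0| < r -> N (G w) /\ Psi (G w) = w,
      smooth_on N Psi,
      smooth_on [set w : R2 | `|w - Psi z0| < r] G &
      forall w, `|w - Psi z0| < r -> [/\ 0 < h w.1, 'D_(ex R) G w = e1 (G w) &
        e2 (G w) = h w.1 *: 'D_(ey R) G w]].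
Proof.
move=> oU Uz s1 s2 J0 br sb D2b.
have s0 := smooth_on_cst U (0 : R); have sc1 := smooth_on_cst U (1 : R).
have [] := frame_primitive oU Uz s1 s2 J0 br sc1 s0.
  by move=> y _; rewrite !derive_cst subrr mulr0.
move=> rs [s [rs0 subs ss Ds]].
have [] := frame_primitive oU Uz s1 s2 J0 br sb s0.
  by move=> y Uy; rewrite derive_cst D2b // subrr mulr0.
move=> rl [l [rl0 subl sl Dl]].
have ol := @open_ball R z0 rl; set Ul := [set y : R2 | `|y - z0| < rl] in subl sl ol.
have zl : Ul z0 by rewrite /Ul /= subrr normr0.
have sh := smooth_on_exp ol sl.
have Dh y v : Ul y -> 'D_v (fun y => expR (l y)) y = 'D_v l y * expR (l y).
  move=> Ury; have dl := smooth_onS sl Ury.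
  have de : differentiable (@expR R) (l y) by apply/derivable1_diffP; exact: derivable_expR.
  have L := derive_homogeneous ('D_v l y) (1 : R) de.
  have e : 'D_v l y = 'D_v l y *: (1 : R) by rewrite [RHS]mulr1.
  apply: etrans (derive_comp v dl de) _.
  apply: etrans (congr1 (fun c => 'D_c (@expR R) (l y)) e) _.
  by rewrite L derive_val.
have [] := frame_primitive ol zl (smooth_on_sub subl s1) (smooth_on_sub subl s2)
  (fun y Uy => J0 y (subl y Uy)) (fun y Uy => br y (subl y Uy)) (smooth_on_cst Ul (0 : R)) sh.
  by move=> y Uy; rewrite derive_cst subr0 Dh //; have [-> _] := Dl y Uy.
move=> rt [t [rt0 subt st Dt]].
pose r1 := Num.min rs rt; pose V := [set y : R2 | `|y - z0| < r1].
have Vs : V `<=` [set y : R2 | `|y - z0| < rs] by move=> y /=; rewrite /V /= lt_min => /andP[].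
have Vt : V `<=` [set y : R2 | `|y - z0| < rt] by move=> y /=; rewrite /V /= lt_min => /andP[].
have VU : V `<=` U by move=> y /Vs; exact: subs.
have Vl : V `<=` Ul by move=> y /Vt; exact: subt.
have oV : open V := @open_ball R z0 r1.
have Vz : V z0 by rewrite /V /= subrr normr0 lt_min rs0.
pose Psi y : R2 := (s y, t y).
have sPsi : smooth_on V Psi := smooth_on_pair oV (smooth_on_sub Vs ss) (smooth_on_sub Vt st).
have DPsi y v : V y -> 'D_v Psi y = ('D_v s y, 'D_v t y).
  move=> Vy; have d := smooth_onS sPsi Vy.
  by apply: injective_projections; [rewrite -(derive_fst v d)|rewrite -(derive_snd v d)].
have D1 y : V y -> 'D_(e1 y) Psi y = ex R.
  by move=> Vy; rewrite DPsi //; have [-> _] := Ds y (Vs y Vy); have [-> _] := Dt y (Vt y Vy).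
have D2 y : V y -> 'D_(e2 y) Psi y = expR (l y) *: ey R.
  move=> Vy; rewrite DPsi //; have [_ ->] := Ds y (Vs y Vy); have [_ ->] := Dt y (Vt y Vy).
  by apply: injective_projections; rewrite /= /GRing.scale /= ?mulr0 ?mulr1.
have jac0 y : V y -> jac Psi y != 0.
  move=> Vy; have d := smooth_onS sPsi Vy.
  have h0 : expR (l y) != 0 by rewrite gt_eqF // expR_gt0.
  exact: (det_neq0 h0 (etrans (esym (derive_plane _ d)) (D1 y Vy))
    (etrans (esym (derive_plane _ d)) (D2 y Vy))).
have [G [r [N [[r0 oN NV Nz] [PsiG GPsi sG DG]]]]] := inverse_function oV Vz sPsi jac0.
have D1G w : `|w - Psi z0| < r -> 'D_(ex R) G w = e1 (G w).
  move=> wr; have [Nw _] := GPsi w wr; have Vw := NV _ Nw.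
  by rewrite DG // -(D1 _ Vw) jac_invK //; [exact: smooth_onS sPsi _ Vw|exact: jac0].
have D2G w : `|w - Psi z0| < r -> e2 (G w) = expR (l (G w)) *: 'D_(ey R) G w.
  move=> wr; have [Nw _] := GPsi w wr; have Vw := NV _ Nw.
  have d := smooth_onS sPsi Vw.
  have dG := smooth_onS sG wr.
  rewrite DG // -[in LHS](jac_invK (e2 (G w)) d (jac0 _ Vw)) (D2 _ Vw).
  have := jac_inv_linear Psi (G w) (expR (l (G w))) (ey R) 0.
  have -> : jac_inv Psi (G w) 0 = 0.
    by have := jac_invB Psi (G w) 0 0; rewrite subrr => ->; rewrite subrr.
  by rewrite !addr0.
(* [l] is annihilated by [e2], hence constant along the [t] coordinate lines. *)
pose h x := expR (l (G (x, (Psi z0).2))).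
have hE w : `|w - Psi z0| < r -> h w.1 = expR (l (G w)).
  move=> wr; rewrite /h; congr expR; symmetry.
  apply: (@constant_along_ey (l \o G) (Psi z0) w r _ wr) => y yr.
  have [Ny _] := GPsi y yr; have Vy := NV _ Ny.
  have dG := smooth_onS sG yr; have dl := smooth_onS sl (Vl _ Vy).
  split; first exact: differentiable_comp dG dl.
  have [_ Z] := Dl (G y) (Vl _ Vy); move: Z; rewrite (D2G y yr).
  rewrite (derive_homogeneous _ _ dl) => /eqP.
  rewrite scaler_eq0 gt_eqF ?expR_gt0 //= => /eqP <-.
  exact: derive_comp.
exists Psi, G, r, N, h; split; first by split => // y /NV /VU.
split => //; first exact: smooth_on_sub NV sPsi.
move=> w wr; split; [exact: expR_gt0|exact: D1G|].
by rewrite hE //; exact: D2G.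
Qed.

End Straightening.

(** * Charts adapted to a frame *)

Section AdaptedChart.
Variables (R : realType) (M : surface R).
Local Notation R2 := (R * R)%type.

(** Back to the preferred chart of [q] from the coordinates of the chart of [p]. *)
Lemma local_field_push p (X : vfield M) q : dom (chart_at p) q ->
  'D_(local_field p X (cmap (chart_at p) q)) (cmap (chart_at q) \o cinv (chart_at p))
    (cmap (chart_at p) q) = X q.
Proof.
move=> pq; have d := transition_differentiable (chart_at_smooth p q) pq (chart_at_dom q).
have E := mderE (X q) (chart_at_smooth q p) pq d; rewrite mder_chart in E.
by rewrite {1}/local_field /= (cmapK pq) /components -E.
Qed.

Lemma local_field_det p (X Y : vfield M) q : dom (chart_at p) q -> det2 (X q) (Y q) != 0 ->
  det2 (local_field p X (cmap (chart_at p) q)) (local_field p Y (cmap (chart_at p) q)) != 0.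
Proof.
move=> pq; have d := transition_differentiable (chart_at_smooth p q) pq (chart_at_dom q).
rewrite -(local_field_push X pq) -(local_field_push Y pq).
apply: contra_neq => J0.
have E (v w m n : R2) : det2 (v.1 *: m + v.2 *: n) (w.1 *: m + w.2 *: n) = det2 v w * det2 m n.
  case: v w m n => [? ?] [? ?] [? ?] [? ?]; rewrite /det2 /= /GRing.scale /=; ring.
apply: etrans (congr2 (@det2 R) (derive_plane _ d) (derive_plane _ d)) _.
apply: etrans (E _ _ _ _) _.
exact: etrans (congr1 (fun x => x * _) J0) (mul0r _).
Qed.

Lemma near_der_projection (L : {linear R2 -> R}) (p : M) (X : vfield M) y : continuous L ->
  chart_image (chart_at p) y ->
  (der X (L \o cmap (chart_at p)) \o cinv (chart_at p)) y = L (local_field p X y).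
Proof.
move=> Lc cy; have [dy ey] := cinv_chart_image cy.
have d := transition_differentiable (chart_at_smooth (cinv (chart_at p) y) p) (chart_at_dom _) dy.
exact: (derive_linear_comp _ Lc d).
Qed.

(** The coordinate formula for the bracket holds in every chart, although the
    bracket is defined at each point in the preferred chart of that point. *)
Lemma local_field_bracket p (X Y : vfield M) q : smooth_vfield X -> smooth_vfield Y ->
  dom (chart_at p) q -> let z := cmap (chart_at p) q in
  'D_(local_field p X z) (local_field p Y) z - 'D_(local_field p Y z) (local_field p X) z
  = local_field p (bracket X Y) z.
Proof.
move=> sX sY pq z; set c := chart_at p.
have cz : chart_image c z := chart_image_cmap pq.
have oc := @open_chart_image R M c.
have o := open_image (c := chart_at q) (dom_open c).
set U := cmap (chart_at q) @` _ in o.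
have Uz : U (cmap (chart_at q) q) by exists q => //; split => //; exact: chart_at_dom.
have UC : U `<=` chart_image (chart_at q) by move=> _ [q' [dq' _] <-]; exact: chart_image_cmap.
have st : smooth_on U (cmap c \o cinv (chart_at q)) := chart_at_smooth q p.
have dt := smooth_onS st Uz.
have main (L : {linear R2 -> R}) : continuous L ->
  L ('D_(local_field p X z) (local_field p Y) z) - L ('D_(local_field p Y z) (local_field p X) z)
  = L (local_field p (bracket X Y) z).
  move=> Lc.
  have second (A B : vfield M) : smooth_vfield A -> smooth_vfield B ->
      der A (der B (L \o cmap c)) q = L ('D_(local_field p A z) (local_field p B) z).
    move=> sA sB; have dB := smooth_onS (local_field_smooth p sB) cz.
    have N : {near z, L \o local_field p B =1 der B (L \o cmap c) \o cinv c}.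
      by apply: (open_near oc cz) => y cy; rewrite (near_der_projection B Lc cy).
    have dL := smooth_onS (smooth_on_linear_comp oc Lc (local_field_smooth p sB)) cz.
    have dN := near_eq_differentiable N dL.
    rewrite {1}/der (mderE _ (chart_at_smooth q p) pq dN) -(near_eq_derive _ N).
    have EA : mder (cmap c) q (A q) = local_field p A z by rewrite /local_field /= (cmapK pq).
    rewrite EA; exact: (derive_linear_comp _ Lc dB).
  have C := local_der_comm (u := L \o cmap c) sX sY o Uz UC (smooth_on_linear_comp o Lc st).
  have EB : mder (cmap c) q (bracket X Y q) = local_field p (bracket X Y) z.
    by rewrite /local_field /= (cmapK pq).
  apply: etrans (congr2 (fun x y => x - y) (esym (second X Y sX sY)) (esym (second Y X sY sX))) _.
  apply: etrans C _; rewrite -EB; exact: (derive_linear_comp _ Lc dt).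
have m1 := main (@fst R R) (@fst_continuous R R R).
have m2 := main (@snd R R) (@snd_continuous R R R).
by apply: injective_projections; [exact: m1|exact: m2].
Qed.

Lemma chart_der (W : normedModType R) (c : chart R M) (u : M -> W) q v :
  local_coordinates c -> msmooth u -> dom c q ->
  'D_v (u \o cinv c) (cmap c q) = mder u q ('D_v (cmap (chart_at q) \o cinv c) (cmap c q)).
Proof.
move=> lc su cq; have d := msmooth_differentiable0 q su.
by have [_ ->] := derive_transition v (lc q).2 cq (chart_at_dom q) d.
Qed.

Section DependsOnS.
Variables (c : chart R M) (u : M -> R) (F : R -> R).
Hypotheses (lc : local_coordinates c) (su : msmooth u) (uF : depends_only_on_s c u F).

Let near_F q : dom c q -> {near cmap c q, u \o cinv c =1 F \o fst}.
Proof.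
move=> cq; apply: (open_near (@open_chart_image R M c) (chart_image_cmap cq)) => y cy.
by have [dy ey] := cinv_chart_image cy; rewrite /= (uF dy) ey.
Qed.

(** The difference quotients of [F \o fst] along the first axis are those of [F]. *)
Lemma coord_s_depends q : dom c q -> mder u q (coord_s c q) = derive1 F (cmap c q).1.
Proof.
move=> cq; rewrite -(chart_der _ lc su cq) (near_eq_derive _ (near_F cq)) derive1E /derive.
by congr (lim _); congr (_ @ _); apply/funext => h.
Qed.

Lemma coord_t_depends q : dom c q -> mder u q (coord_t c q) = 0.
Proof.
move=> cq; rewrite -(chart_der _ lc su cq) (near_eq_derive _ (near_F cq)).
rewrite /derive.
rewrite (_ : (fun h : R => _) = fun=> 0) ?lim_cst //; apply/funext => h /=.
by rewrite /GRing.scale /= mulr0 add0r subrr mulr0.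
Qed.

End DependsOnS.

Variables (E1 E2 : vfield M) (a2 : M -> R).
Hypotheses (sE1 : smooth_vfield E1) (sE2 : smooth_vfield E2) (sa2 : msmooth a2).
Hypothesis br : forall q, bracket E1 E2 q = a2 q *: E2 q.
Hypothesis D2a2 : forall q, der E2 a2 q = 0.
Hypothesis indep : forall q, det2 (E1 q) (E2 q) != 0.

(** The diffeomorphism of [straightening] composed with the preferred chart of [p].
    Its image is a square, so that a function annihilated by [E2] is constant on
    each line of constant [s]. *)
Theorem straightening_chart p : exists (c : chart R M) (h : R -> R),
  [/\ dom c p, local_coordinates c,
      forall q, dom c q -> [/\ 0 < h (cmap c q).1, E1 q = coord_s c q &
        E2 q = h (cmap c q).1 *: coord_t c q] &
      forall u, msmooth u -> (forall q, der E2 u q = 0) ->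
        exists F, depends_only_on_s c u F].
Proof.
pose c0 := chart_at p; pose z0 := cmap c0 p.
have o0 : open (chart_image c0) := @open_chart_image R M c0.
have z00 : chart_image c0 z0 by apply: chart_image_cmap; exact: chart_at_dom.
have s1 := local_field_smooth p sE1; have s2 := local_field_smooth p sE2.
have sb := (msmoothE a2).1 sa2 p.
have J0 y : chart_image c0 y -> det2 (local_field p E1 y) (local_field p E2 y) != 0.
  by move=> cy; have [dy ey] := cinv_chart_image cy; rewrite -ey; apply: local_field_det.
have Br y : chart_image c0 y -> 'D_(local_field p E1 y) (local_field p E2) y -
    'D_(local_field p E2 y) (local_field p E1) y = (a2 \o cinv c0) y *: local_field p E2 y.
  move=> cy; have [dy ey] := cinv_chart_image cy.
  have := local_field_bracket sE1 sE2 dy; rewrite -/c0 /= ey => ->.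
  set q := cinv c0 y.
  have d := transition_differentiable (chart_at_smooth q p) (chart_at_dom q) dy.
  rewrite /local_field /= /components br.
  exact: (derive_homogeneous (a2 q) (E2 q) d).
have D2b y : chart_image c0 y -> 'D_(local_field p E2 y) (a2 \o cinv c0) y = 0.
  by move=> cy; rewrite -(der_local E2 cy (smooth_onS sb cy)) /= D2a2.
have [Psi [G [r [N [h [[r0 oN NU Nz] [PsiG GPsi sPsi sG DG]]]]]]] :=
  straightening o0 z00 s1 s2 J0 Br sb D2b.
pose D := [set q | dom c0 q /\ N (cmap c0 q)].
pose B := [set w : R2 | `|w - Psi z0| < r].
have oB : open B := @open_ball R (Psi z0) r.
have D_of w : B w -> D (cinv c0 (G w)) /\ (Psi \o cmap c0) (cinv c0 (G w)) = w.
  move=> Bw; have [Nw Ew] := GPsi w Bw; have [dw ew] := cinv_chart_image (NU _ Nw).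
  by rewrite /D /= ew.
have oD : open D.
  rewrite openE => q [dq Nq].
  have N1 : \forall y \near q, dom c0 y by apply: open_nbhs_nbhs; split => //; exact: dom_open.
  have N2 : \forall y \near q, N (cmap c0 y).
    have H : cmap c0 @ q --> cmap c0 q := cmap_cont dq.
    by apply: H; exact: open_nbhs_nbhs.
  by apply: (@filterS2 _ _ _ _ _ _ _ N1 N2) => y.
have imD : (Psi \o cmap c0) @` D = B.
  apply/seteqP; split=> [_ [q [dq Nq] <-]|w Bw]; first by have [] := PsiG _ Nq.
  by have [Dw Ew] := D_of w Bw; exists (cinv c0 (G w)).
have oI : open ((Psi \o cmap c0) @` D) by rewrite imD.
have K q : D q -> (cinv c0 \o G) ((Psi \o cmap c0) q) = q.
  by move=> [dq Nq]; have [_ E] := PsiG _ Nq; rewrite /= E (cmapK dq).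
have cm q : D q -> {for q, continuous (Psi \o cmap c0)}.
  move=> [dq Nq]; apply: continuous_comp; first exact: cmap_cont.
  exact: (smooth_on_continuous sPsi).
have ci q : D q -> {for (Psi \o cmap c0) q, continuous (cinv c0 \o G)}.
  move=> [dq Nq]; have [Bq E] := PsiG _ Nq; apply: continuous_comp.
    exact: (smooth_on_continuous sG).
  by rewrite /= E; exact: cinv_cont.
pose c : chart R M := Chart oD oI K cm ci.
have imc : chart_image c = B := imD.
have chart_imageE y : chart_image c y -> B y by rewrite imc.
have lc : local_coordinates c.
  move=> q; split.
    have o := open_image (c := chart_at q) oD.
    apply: (smooth_on_comp (U' := N) (f := cmap c0 \o cinv (chart_at q)) (g := Psi) o) => //.
      by move=> _ [q' [dq' [_ Nq']] <-] /=; rewrite (cmapK dq').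
    apply: smooth_on_sub (chart_at_smooth q p) => _ [q' [dq' [d0 _]] <-].
    by exists q'.
  have o := open_image (c := c) (dom_open (chart_at q)).
  apply: (smooth_on_comp (U' := cmap c0 @` (dom c0 `&` dom (chart_at q))) (f := G)
    (g := cmap (chart_at q) \o cinv c0) o).
  - move=> _ [q' [[dq' Nq'] d0] <-] /=; have [_ ->] := PsiG _ Nq'.
    by exists q'.
  - apply: smooth_on_sub sG => _ [q' [Dq' _] <-]; apply: chart_imageE; exact: chart_image_cmap.
  - exact: chart_at_smooth.
have coordE q v : dom c q ->
    'D_v (cmap (chart_at q) \o cinv c) (cmap c q) =
    'D_('D_v G (cmap c q)) (cmap (chart_at q) \o cinv c0) (cmap c0 q).
  move=> [dq Nq]; have [Bq E] := PsiG _ Nq.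
  have dG : differentiable G (cmap c q) := smooth_onS sG Bq.
  have E' : G (cmap c q) = cmap c0 q := E.
  have d := transition_differentiable (chart_at_smooth p q) dq (chart_at_dom q).
  rewrite -/c0 -E' in d; rewrite -E'; exact: (derive_comp v dG d).
have frameE q : dom c q -> [/\ 0 < h (cmap c q).1, E1 q = coord_s c q &
    E2 q = h (cmap c q).1 *: coord_t c q].
  move=> dcq; have [dq Nq] := dcq; have [Bq E] := PsiG _ Nq.
  have [h0 e1E e2E] := DG _ Bq; rewrite E in e1E e2E.
  split; first exact: h0.
    rewrite /coord_s (coordE q _ dcq) -[LHS](local_field_push E1 dq).
    by congr ('D_ _ _ _); exact: esym e1E.
  have d := transition_differentiable (chart_at_smooth p q) dq (chart_at_dom q).
  rewrite /coord_t (coordE q _ dcq) -[LHS](local_field_push E2 dq) -/c0 e2E.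
  exact: (derive_homogeneous _ _ d).
exists c, h; split => //; first by split => //; exact: chart_at_dom.
move=> u su D2u; exists (fun x => u (cinv c (x, (Psi z0).2))) => q dcq.
have Bq := chart_imageE _ (chart_image_cmap dcq).
rewrite -[in LHS](cmapK dcq); apply: (@constant_along_ey R (u \o cinv c) (Psi z0) (cmap c q) r _ Bq).
move=> y Dy; have [q' dq' <-] : chart_image c y by rewrite imc.
split; first by apply: (msmooth_differentiable su _ dq'); exact: (lc q').2.
rewrite (chart_der _ lc su dq') -/(coord_t c q').
have [h0 _ e2E] := frameE q' dq'; have := D2u q'; rewrite /der e2E mderZv // => /eqP.
by rewrite scaler_eq0 gt_eqF //= => /eqP.
Qed.

End AdaptedChart.

(** * The two directions of the equivalence *)

Section Reduction.
Variables (R : realType) (eps : R) (M : surface R) (phi : M -> 'rV[R]_5)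
  (nab : connection M) (E1 E2 : vfield M) (E4 : M -> 'rV[R]_5).
Hypotheses (imm : immersion eps phi) (LC : levi_civita (metric eps phi) nab)
  (frame : adapted_frame eps phi nab E1 E2 E4)
  (ncmc : non_CMC eps phi nab E1 E2) (flat : flat_normal_bundle eps phi E1 E2)
  (hA4 : forall p, exists v, shape_operator eps phi nab E1 E2 E4 p v != 0)
  (hE2 : forall p, nab E2 p (E2 p) != 0).
Local Notation R2 := (R * R)%type.
Local Notation g := (metric eps phi).
Local Notation f := (mean_norm eps phi nab E1 E2).
Local Notation k1 := (k1 eps phi nab E1 E2).
Local Notation k2 := (k2 eps phi nab E1 E2).
Local Notation al := (alpha eps phi nab E1 E2 E4).
Local Notation a1 := (a1 eps phi nab E1 E2).
Local Notation a2 := (a2 eps phi nab E1 E2).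
Local Notation b1 := (b1 eps phi nab E1 E2 E4).
Local Notation b2 := (b2 eps phi nab E1 E2 E4).
Local Notation K := (gauss_curvature eps phi nab E1 E2).
Local Notation D1 := (der E1).
Local Notation D2 := (der E2).

Lemma frame_structure : structure_equations eps E1 E2 f k1 k2 al a1 a2 b1 b2.
Proof.
have [sE1 sE2 _] := af_tangent frame.
split.
- exact: sE1.
- exact: sE2.
- exact: (mean_norm_smooth imm LC frame ncmc).
- exact: (k1_smooth imm LC frame ncmc).
- exact: (k2_smooth imm LC frame ncmc).
- exact: (alpha_smooth imm frame).
- exact: (a1_smooth imm LC frame).
- exact: (a2_smooth imm LC frame).
- exact: (b1_smooth imm LC frame ncmc).
- exact: (b2_smooth imm LC frame ncmc).
- exact: (mean_norm_gt0 imm LC frame ncmc).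
- move=> p; exact: (alpha_neq0 imm LC frame ncmc flat (hA4 p)).
- exact: (k_neq imm LC frame ncmc).
- move=> p; exact: (proj1 (trace_frame imm LC frame ncmc p)).
- exact: (bracket_frame imm LC frame).
- move=> p; exact: (proj1 (codazzi imm LC frame ncmc flat p)).
- move=> p; exact: (proj2 (codazzi imm LC frame ncmc flat p)).
- exact: (ricci imm LC frame ncmc flat).
Qed.

Let SE := frame_structure.

Lemma biharmonicE : biharmonic eps phi nab E1 E2 <->
  forall p, frame_biharmonic eps E1 E2 f k1 k2 al a1 a2 b1 b2 p.
Proof.
by split=> H p; have [h1 h2] := bitension_eq0 imm LC frame ncmc flat p;
  [exact: h1 (H p)|exact: h2 (H p)].
Qed.

Lemma mean_norm_gradient p : D1 f p != 0 \/ D2 f p != 0.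
Proof.
have A (x y : R) (v w : R2) : x *: v + y *: w != 0 -> x != 0 \/ y != 0.
  have [-> h|x0 _] := eqVneq x 0; last by left.
  by right; apply: contra_neq h => ->; rewrite !scale0r addr0.
have [_ G _] := ncmc p.
exact: (A _ _ _ _ G).
Qed.

Lemma a2_neq0 p : a2 p != 0.
Proof.
have [_ _ _ E] := nab_frame imm LC frame p.
by apply: contra_neq (hE2 p) => a0; rewrite E a0 scale0r.
Qed.

Section Chart.
Variables (c : chart R M) (f_ k1_ k2_ al_ a2_ b1_ : R -> R).
Hypotheses (lc : local_coordinates c) (cE1 : forall q, dom c q -> E1 q = coord_s c q)
  (hf : depends_only_on_s c f f_) (hk1 : depends_only_on_s c k1 k1_)
  (hk2 : depends_only_on_s c k2 k2_) (hal : depends_only_on_s c al al_)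
  (ha2 : depends_only_on_s c a2 a2_) (hb1 : depends_only_on_s c b1 b1_).

Lemma D1_depends (u : M -> R) F : msmooth u -> depends_only_on_s c u F ->
  depends_only_on_s c (D1 u) (derive1 F).
Proof. by move=> su uF q cq; rewrite /der (cE1 cq); exact: coord_s_depends. Qed.

Lemma ode_congr (da2 df dal dk2 ddf db1 F K1 K2 AL A2 B1
    da2' df' dal' dk2' ddf' db1' F' K1' K2' AL' A2' B1' : R) :
  da2 = da2' -> df = df' -> dal = dal' -> dk2 = dk2' -> ddf = ddf' -> db1 = db1' ->
  F = F' -> K1 = K1' -> K2 = K2' -> AL = AL' -> A2 = A2' -> B1 = B1' ->
  ode_relations eps da2 df dal dk2 ddf db1 F K1 K2 AL A2 B1 <->
  ode_relations eps da2' df' dal' dk2' ddf' db1' F' K1' K2' AL' A2' B1'.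
Proof. by move=> -> -> -> -> -> -> -> -> -> -> -> ->. Qed.

Lemma frame_odeE q (s := (cmap c q).1) : dom c q -> frame_ode eps E1 f k1 k2 al a2 b1 q <->
  ode_relations eps (derive1 a2_ s) (derive1 f_ s) (derive1 al_ s) (derive1 k2_ s)
    (derive1n 2 f_ s) (derive1 b1_ s) (f_ s) (k1_ s) (k2_ s) (al_ s) (a2_ s) (b1_ s).
Proof.
move=> cq; have df := D1_depends (se_f SE) hf.
exact: (ode_congr (D1_depends (se_a2 SE) ha2 cq) (df q cq) (D1_depends (se_al SE) hal cq)
  (D1_depends (se_k2 SE) hk2 cq) (D1_depends (msmooth_der (se_field1 SE) (se_f SE)) df cq)
  (D1_depends (se_b1 SE) hb1 cq) (hf cq) (hk1 cq) (hk2 cq) (hal cq) (ha2 cq) (hb1 cq)).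
Qed.

End Chart.

Lemma adapted_of_straightening (c : chart R M) (h : R -> R) :
  (forall q, dom c q -> [/\ 0 < h (cmap c q).1, E1 q = coord_s c q &
     E2 q = h (cmap c q).1 *: coord_t c q]) ->
  adapted_coordinates eps phi E1 E2 c (fun x => (h x)^-1 ^+ 2).
Proof.
move=> H q cq; have [h0 e1 e2] := H q cq.
have [_ _ /(_ q)[g11 g22 g12]] := af_tangent frame.
have h0' := lt0r_neq0 h0.
have ct : coord_t c q = (h (cmap c q).1)^-1 *: E2 q + 0.
  have A (k : R) (v w : R2) : k != 0 -> w = k *: v -> v = k^-1 *: w + 0.
    by move=> k0 ->; rewrite addr0 scalerA mulVf // scale1r.
  exact: A h0' e2.
have gt w : g q (coord_t c q) w = (h (cmap c q).1)^-1 * g q (E2 q) w.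
  by rewrite ct (metric_linear imm) metric0 addr0.
have sg : Num.sqrt ((h (cmap c q).1)^-1 ^+ 2) = (h (cmap c q).1)^-1.
  by rewrite sqrtr_sqr ger0_norm // invr_ge0 ltW.
split.
- by rewrite -e1.
- by rewrite (metricC eps) gt -e1 (metricC eps) g12 mulr0.
- by rewrite gt (metricC eps) gt g22 mulr1.
- exact: e1.
- by rewrite sg invrK.
Qed.

Lemma D2_depends (c : chart R M) g22 (u : M -> R) F : local_coordinates c ->
  adapted_coordinates eps phi E1 E2 c g22 -> msmooth u -> depends_only_on_s c u F ->
  forall q, dom c q -> D2 u q = 0.
Proof.
move=> lc ac su uF q cq; have [_ _ _ _ e2] := ac q cq.
by rewrite /der e2 mderZv // (coord_t_depends lc su uF cq) scaler0.
Qed.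

(** Along a chart of the stated form, [f], [D1 f] and [k1] are constant in the
    direction of [E2]; the commutator on [f] and one Codazzi equation then make
    [a1] and [b2] vanish. *)
Lemma symmetric_of_charts :
  (forall p, [/\ D2 f p = 0, D2 (D1 f) p = 0 & D2 k1 p = 0]) ->
  forall p, a1 p = 0 /\ b2 p = 0.
Proof.
move=> H p; have [Y0 DX0 Dk0] := H p.
have D2f : D2 f = fun=> 0 by apply/funext => q; case: (H q).
have C := frame_comm SE p (se_f SE).
have X0 : D1 f p != 0 by have [//|] := mean_norm_gradient p; rewrite Y0 eqxx.
have A0 : a1 p = 0.
  move: C; rewrite Y0 DX0 D2f der_cst subr0 mulr0 addr0 => /esym/eqP.
  by rewrite mulf_eq0 (negbTE X0) orbF => /eqP.
split; first exact: A0.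
have [c1 _ _ _] := se_codazzi SE p; move: c1; rewrite Dk0 A0 mul0r add0r => /esym/eqP.
by rewrite mulf_eq0 (negbTE (se_al0 SE p)) => /eqP.
Qed.

End Reduction.

Unset Implicit Arguments.
Theorem theorem4p1 (R : realType) (eps : R) (M : surface R)
  (phi : M -> 'rV[R]_5) (nab : connection M)
  (E1 E2 : vfield M) (E4 : M -> 'rV[R]_5)
  (phi_immersion : immersion eps phi)
  (nab_LC : levi_civita (metric eps phi) nab)
  (frame : adapted_frame eps phi nab E1 E2 E4)
  (labelling : labelling_convention eps phi nab E1 E2 E4)
  (hnonCMC : non_CMC eps phi nab E1 E2)
  (hW : W_surface eps phi nab E1 E2)
  (hflat : flat_normal_bundle eps phi E1 E2)
  (hK : forall p, 3 * mean_norm eps phi nab E1 E2 p ^+ 2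
                  + gauss_curvature eps phi nab E1 E2 p - eps != 0)
  (hE3 : forall p, exists v,
      nconn eps phi E1 E2 (E3 eps phi nab E1 E2) p v != 0)
  (hA4 : forall p, exists v, shape_operator eps phi nab E1 E2 E4 p v != 0)
  (hE2 : forall p, nab E2 p (E2 p) != 0) :
  biharmonic eps phi nab E1 E2 <->
  forall p : M, exists (c : chart R M) (g22 f_ k1_ k2_ al_ a2_ b1_ K_ : R -> R),
    [/\ dom c p, local_coordinates c,
        adapted_coordinates eps phi E1 E2 c g22,
        [/\ depends_only_on_s c (mean_norm eps phi nab E1 E2) f_,
            depends_only_on_s c (k1 eps phi nab E1 E2) k1_,
            depends_only_on_s c (k2 eps phi nab E1 E2) k2_,
            depends_only_on_s c (alpha eps phi nab E1 E2 E4) al_ &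
            [/\ depends_only_on_s c (a2 eps phi nab E1 E2) a2_,
                depends_only_on_s c (b1 eps phi nab E1 E2 E4) b1_ &
                depends_only_on_s c (gauss_curvature eps phi nab E1 E2) K_]] &
        forall q, dom c q -> let s := (cmap c q).1 in
          [/\ derive1 a2_ s = eps + k2_ s * (2 * f_ s - k2_ s)
                              - al_ s ^+ 2 + a2_ s ^+ 2,
              (3 * f_ s - k2_ s) * derive1 f_ s = - (f_ s * al_ s * b1_ s),
              derive1 al_ s = 2 * al_ s * a2_ s + k2_ s * b1_ s,
              derive1 k2_ s = 2 * a2_ s * (k2_ s - f_ s) - al_ s * b1_ s &
              derive1n 2 f_ s = a2_ s * derive1 f_ s
                  + f_ s * (b1_ s ^+ 2 + k1_ s ^+ 2 + k2_ s ^+ 2 - 2 * eps) /\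
              derive1 b1_ s = - (2 * b1_ s / f_ s) * derive1 f_ s
                  + a2_ s * b1_ s - al_ s * (k2_ s - k1_ s)]].
Proof.
have SE := frame_structure phi_immersion nab_LC frame hnonCMC hflat hA4.
have bE := biharmonicE phi_immersion nab_LC frame hnonCMC hflat.
have KE := gauss_curvatureE phi_immersion nab_LC frame hnonCMC hflat.
have sK : gauss_curvature eps phi nab E1 E2 =
    gaussK eps (k1 eps phi nab E1 E2) (k2 eps phi nab E1 E2) (alpha eps phi nab E1 E2 E4).
  by apply/funext => q; rewrite KE.
have grad0 := mean_norm_gradient hnonCMC.
have a20 := a2_neq0 phi_immersion nab_LC frame hE2.
split=> [/bE bih p|charts].
  have W : exists W : R * R -> R, [/\ smooth_on setT W, forall z, exists v, 'D_v W z != 0 &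
      forall q, W (mean_norm eps phi nab E1 E2 q, gaussK eps (k1 eps phi nab E1 E2)
        (k2 eps phi nab E1 E2) (alpha eps phi nab E1 E2 E4) q) = 0].
    by rewrite -sK.
  have K0 := hK; rewrite sK in K0.
  have Y0 := Y_eq0 SE bih grad0 a20 W K0.
  have A0 := a1_eq0 SE bih grad0 a20 W K0.
  have B0 := b2_eq0 SE bih grad0 a20 W K0.
  have A2 := D2a2_eq0 SE bih grad0 a20 W K0.
  have inv := symmetric_invariants SE A0 B0 Y0.
  have [c [h [cp lc fr dep]]] := straightening_chart (se_field1 SE) (se_field2 SE) (se_a2 SE)
    (symmetric_bracket SE A0) A2 (frame_det phi_immersion frame) p.
  have [f_ hf] := dep _ (se_f SE) Y0.
  have [k1_ hk1] : exists F, depends_only_on_s c (k1 eps phi nab E1 E2) F.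
    by apply: dep (se_k1 SE) _ => q; case: (inv q).
  have [k2_ hk2] : exists F, depends_only_on_s c (k2 eps phi nab E1 E2) F.
    by apply: dep (se_k2 SE) _ => q; case: (inv q).
  have [al_ hal] : exists F, depends_only_on_s c (alpha eps phi nab E1 E2 E4) F.
    by apply: dep (se_al SE) _ => q; case: (inv q).
  have [b1_ hb1] : exists F, depends_only_on_s c (b1 eps phi nab E1 E2 E4) F.
    by apply: dep (se_b1 SE) _ => q; case: (inv q).
  have [a2_ ha2] := dep _ (se_a2 SE) A2.
  have [K_ hK'] : exists F, depends_only_on_s c (gauss_curvature eps phi nab E1 E2) F.
    by rewrite sK; apply: dep (gaussK_smooth SE) _ => q; case: (inv q) => _ _ _ _ [].
  exists c, (fun x => (h x)^-1 ^+ 2), f_, k1_, k2_, al_, a2_, b1_, K_.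
  split => //; first exact: (adapted_of_straightening phi_immersion frame fr).
  move=> q cq; have cE1 q' : dom c q' -> E1 q' = coord_s c q' by move=> /fr[].
  exact: (frame_odeE phi_immersion nab_LC frame hnonCMC hflat hA4 lc cE1 hf hk1 hk2 hal ha2 hb1 cq).1
    ((frame_biharmonic_ode SE A0 B0 Y0 q).1 (bih q)).
have ode q : [/\ der E2 (mean_norm eps phi nab E1 E2) q = 0,
    der E2 (der E1 (mean_norm eps phi nab E1 E2)) q = 0,
    der E2 (k1 eps phi nab E1 E2) q = 0 &
    frame_ode eps E1 (mean_norm eps phi nab E1 E2) (k1 eps phi nab E1 E2) (k2 eps phi nab E1 E2)
      (alpha eps phi nab E1 E2 E4) (a2 eps phi nab E1 E2) (b1 eps phi nab E1 E2 E4) q].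
  have [c [g22 [f_ [k1_ [k2_ [al_ [a2_ [b1_ [K_ [cq lc ac [hf hk1 hk2 hal [ha2 hb1 _]] eqs]]]]]]]]]] := charts q.
  have cE1 q' : dom c q' -> E1 q' = coord_s c q' by move=> /ac[].
  have dX := D1_depends lc cE1 (se_f SE) hf.
  split.
  - exact: (D2_depends lc ac (se_f SE) hf cq).
  - exact: (D2_depends lc ac (msmooth_der (se_field1 SE) (se_f SE)) dX cq).
  - exact: (D2_depends lc ac (se_k1 SE) hk1 cq).
  - exact: (frame_odeE phi_immersion nab_LC frame hnonCMC hflat hA4 lc cE1 hf hk1 hk2 hal ha2 hb1 cq).2
      (eqs q cq).
have AB := symmetric_of_charts phi_immersion nab_LC frame hnonCMC hflat hA4
  (fun q => let: And4 x y z _ := ode q in And3 x y z).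
apply/bE => q; have [_ _ _ o] := ode q.
apply/(frame_biharmonic_ode SE (fun q => (AB q).1) (fun q => (AB q).2)
  (fun q => let: And4 x _ _ _ := ode q in x) q).
exact: o.
Qed.
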